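(* Let $W=S_n$, $\mathfrak h=\mathbb C^{n-1}$ its reflection representation, and $c=-r/m$ with integers $2\le m\le n$, $1\le r\le m-1$. Let $\tau$ be an irreducible representation of $W$. Then the irreducible representation $L=L_c(\tau)$ of $H_c(W,\mathfrak h)$ is aspherical if and only if its support is not equal to $\mathfrak h$.
   Context: Let $S$ be the set of reflections (transpositions) of $S_n$ in $\mathfrak h$; for $s\in S$, $\alpha_s\in\mathfrak h^*$, $\alpha_s^\vee\in\mathfrak h$ span the $-1$-eigenspaces of $s$, with $(\alpha_s,\alpha_s^\vee)=2$. $H_c(S_n,\mathfrak h)$ is the quotient of $\mathbb C[S_n]\ltimes T(\mathfrak h\oplus\mathfrak h^* )$ by $[x,x']=0$, $[y,y']=0$, $[y,x]=(y,x)-c\sum_{s\in S}(y,\alpha_s)(x,\alpha_s^\vee)s$ ($x,x'\in\mathfrak h^*$, $y,y'\in\mathfrak h$). $L_c(\tau)=L_c(W,\mathfrak h,\tau)$ is the unique irreducible quotient of the standard module $M_c(W,\mathfrak h,\tau)=H_c(W,\mathfrak h)\otimes_{\mathbb C[W]\ltimes\mathbb C[\mathfrak h^*]}\tau$, with $\mathfrak h$ acting on $\tau$ by $0$. The support of a module is its support in $\mathfrak h$ as a (finitely generated) $\mathbb C[\mathfrak h]$-module. A nonzero module $M$ is aspherical if $e_WM=0$, where $e_W=\frac1{|W|}\sum_{w\in W}w$. *)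

(* Defs.v *)
From HB Require Import structures.
From mathcomp Require Import all_boot all_order all_algebra all_fingroup.
From mathcomp Require Import mxrepresentation.
From mathcomp Require Import boolp classical_sets reals complex.
From mathcomp Require Import monalg mpoly.

Set Implicit Arguments.
Unset Strict Implicit.
Unset Printing Implicit Defensive.

Import GRing.Theory.
Import Quotient.

Local Open Scope ring_scope.
Local Open Scope quotient_scope.

Section AlgebraQuotient.
Variables (K : fieldType) (A : lalgType K) (r : A -> Prop).

Inductive ideal_gen : A -> Prop :=
| Ideal_gen z of r z : ideal_gen z
| Ideal0 : ideal_gen 0
| IdealB z1 z2 of ideal_gen z1 & ideal_gen z2 : ideal_gen (z1 - z2)
| IdealMl a z of ideal_gen z : ideal_gen (a * z)
| IdealMr a z of ideal_gen z : ideal_gen (z * a).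

Definition ideal_pred : {pred A} := fun z => `[< ideal_gen z >].

Lemma ideal_pred_zmod : zmod_closed ideal_pred.
Proof.
split=> [|x y /asboolP hx /asboolP hy]; apply/asboolP; first exact: Ideal0.
exact: IdealB.
Qed.
HB.instance Definition _ := GRing.isZmodClosed.Build A ideal_pred ideal_pred_zmod.

Lemma ideal_predMl a z : z \in ideal_pred -> a * z \in ideal_pred.
Proof. by move=> /asboolP hz; apply/asboolP; apply: IdealMl. Qed.

Lemma ideal_predMr a z : z \in ideal_pred -> z * a \in ideal_pred.
Proof. by move=> /asboolP hz; apply/asboolP; apply: IdealMr. Qed.

Lemma ideal_predZ k z : z \in ideal_pred -> k *: z \in ideal_pred.
Proof. by move=> hz; rewrite -[z]mul1r scalerAl ideal_predMl. Qed.

Definition alg_quot : Type := {quot ideal_pred}.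
HB.instance Definition _ := GRing.Zmodule.on alg_quot.
HB.instance Definition _ := EqQuotient.on alg_quot.

Definition alg_pi (z : A) : alg_quot := \pi_{quot ideal_pred} z.

Lemma alg_piP x y : reflect (alg_pi x = alg_pi y) (x - y \in ideal_pred).
Proof. by rewrite idealrBE; apply: eqP. Qed.

Lemma alg_pi_zmod : zmod_morphism alg_pi.
Proof. by move=> x y; rewrite /alg_pi pi_is_zmod_morphism. Qed.
HB.instance Definition _ := GRing.isZmodMorphism.Build A alg_quot alg_pi alg_pi_zmod.

Lemma alg_quotW (P : alg_quot -> Prop) : (forall z, P (alg_pi z)) -> forall q, P q.
Proof. by move=> hP q; rewrite -[q]reprK; apply: hP. Qed.

Definition alg_quot_one : alg_quot := alg_pi 1.
Definition alg_quot_mul (p q : alg_quot) : alg_quot := alg_pi (generic_quotient.repr p * generic_quotient.repr q).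
Definition alg_quot_scale (k : K) (q : alg_quot) : alg_quot := alg_pi (k *: generic_quotient.repr q).

Lemma alg_repr z : generic_quotient.repr (alg_pi z) - z \in ideal_pred.
Proof. by apply/alg_piP; rewrite /alg_pi reprK. Qed.

Lemma alg_mulE x y : alg_quot_mul (alg_pi x) (alg_pi y) = alg_pi (x * y).
Proof.
apply/alg_piP; have := alg_repr y; have := alg_repr x.
move: (generic_quotient.repr (alg_pi x)) (generic_quotient.repr (alg_pi y)).
move=> x' y' hx hy.
have -> : x' * y' - x * y = (x' - x) * y' + x * (y' - y).
  by rewrite mulrBl mulrBr addrA subrK.
by apply: rpredD; [apply: ideal_predMr|apply: ideal_predMl].
Qed.

Lemma alg_scaleE k x : alg_quot_scale k (alg_pi x) = alg_pi (k *: x).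
Proof. by apply/alg_piP; rewrite -scalerBr ideal_predZ ?alg_repr. Qed.

Lemma alg_mulA : associative alg_quot_mul.
Proof.
elim/alg_quotW=> x; elim/alg_quotW=> y; elim/alg_quotW=> z.
by rewrite !alg_mulE mulrA.
Qed.
Lemma alg_mul1 : left_id alg_quot_one alg_quot_mul.
Proof. by elim/alg_quotW=> x; rewrite alg_mulE mul1r. Qed.
Lemma alg_mulr1 : right_id alg_quot_one alg_quot_mul.
Proof. by elim/alg_quotW=> x; rewrite alg_mulE mulr1. Qed.
Lemma alg_mulDl : left_distributive alg_quot_mul +%R.
Proof.
elim/alg_quotW=> x; elim/alg_quotW=> y; elim/alg_quotW=> z.
by rewrite -raddfD !alg_mulE mulrDl raddfD.
Qed.
Lemma alg_mulDr : right_distributive alg_quot_mul +%R.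
Proof.
elim/alg_quotW=> x; elim/alg_quotW=> y; elim/alg_quotW=> z.
by rewrite -raddfD !alg_mulE mulrDr raddfD.
Qed.
HB.instance Definition _ := GRing.Zmodule_isPzRing.Build alg_quot
  alg_mulA alg_mul1 alg_mulr1 alg_mulDl alg_mulDr.

Lemma alg_scaleA a b v :
  alg_quot_scale a (alg_quot_scale b v) = alg_quot_scale (a * b) v.
Proof. by elim/alg_quotW: v => v; rewrite !alg_scaleE scalerA. Qed.
Lemma alg_scale1 : left_id 1 alg_quot_scale.
Proof. by elim/alg_quotW=> x; rewrite alg_scaleE scale1r. Qed.
Lemma alg_scaleDr : right_distributive alg_quot_scale +%R.
Proof.
move=> k; elim/alg_quotW=> x; elim/alg_quotW=> y.
by rewrite -raddfD !alg_scaleE scalerDr raddfD.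
Qed.
Lemma alg_scaleDl v : {morph alg_quot_scale^~ v : a b / a + b}.
Proof. by elim/alg_quotW: v => v a b; rewrite !alg_scaleE scalerDl raddfD. Qed.
HB.instance Definition _ := GRing.Zmodule_isLmodule.Build K alg_quot
  alg_scaleA alg_scale1 alg_scaleDr alg_scaleDl.

Lemma alg_pi_monoid : monoid_morphism alg_pi.
Proof. by split=> // x y; rewrite -alg_mulE. Qed.
HB.instance Definition _ := GRing.isMonoidMorphism.Build A alg_quot alg_pi alg_pi_monoid.

Lemma alg_pi_scalable : scalable alg_pi.
Proof. by move=> k x; rewrite -alg_scaleE. Qed.
HB.instance Definition _ := GRing.isScalable.Build K A alg_quot *:%R alg_pi alg_pi_scalable.

End AlgebraQuotient.

Section ModuleQuotient.
Variables (A : pzRingType) (V : lmodType A) (r : V -> Prop).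

Inductive submod_gen : V -> Prop :=
| Submod_gen v of r v : submod_gen v
| Submod0 : submod_gen 0
| SubmodB u v of submod_gen u & submod_gen v : submod_gen (u - v)
| SubmodZ a v of submod_gen v : submod_gen (a *: v).

Definition submod_pred : {pred V} := fun v => `[< submod_gen v >].

Lemma submod_pred_zmod : zmod_closed submod_pred.
Proof.
split=> [|x y /asboolP hx /asboolP hy]; apply/asboolP; first exact: Submod0.
exact: SubmodB.
Qed.
HB.instance Definition _ := GRing.isZmodClosed.Build V submod_pred submod_pred_zmod.

Lemma submod_predZ a v : v \in submod_pred -> a *: v \in submod_pred.
Proof. by move=> /asboolP hv; apply/asboolP; apply: SubmodZ. Qed.

Definition mod_quot : Type := {quot submod_pred}.
HB.instance Definition _ := GRing.Zmodule.on mod_quot.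
HB.instance Definition _ := EqQuotient.on mod_quot.

Definition mod_pi (v : V) : mod_quot := \pi_{quot submod_pred} v.

Lemma mod_piP x y : reflect (mod_pi x = mod_pi y) (x - y \in submod_pred).
Proof. by rewrite idealrBE; apply: eqP. Qed.

Lemma mod_pi_zmod : zmod_morphism mod_pi.
Proof. by move=> x y; rewrite /mod_pi pi_is_zmod_morphism. Qed.
HB.instance Definition _ := GRing.isZmodMorphism.Build V mod_quot mod_pi mod_pi_zmod.

Lemma mod_quotW (P : mod_quot -> Prop) : (forall z, P (mod_pi z)) -> forall q, P q.
Proof. by move=> hP q; rewrite -[q]reprK; apply: hP. Qed.

Definition mod_quot_scale (a : A) (q : mod_quot) : mod_quot := mod_pi (a *: generic_quotient.repr q).

Lemma mod_scaleE a x : mod_quot_scale a (mod_pi x) = mod_pi (a *: x).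
Proof.
apply/mod_piP; rewrite -scalerBr submod_predZ //.
by apply/mod_piP; rewrite /mod_pi reprK.
Qed.

Lemma mod_scaleA a b v :
  mod_quot_scale a (mod_quot_scale b v) = mod_quot_scale (a * b) v.
Proof. by elim/mod_quotW: v => v; rewrite !mod_scaleE scalerA. Qed.
Lemma mod_scale1 : left_id 1 mod_quot_scale.
Proof. by elim/mod_quotW=> x; rewrite mod_scaleE scale1r. Qed.
Lemma mod_scaleDr : right_distributive mod_quot_scale +%R.
Proof.
move=> k; elim/mod_quotW=> x; elim/mod_quotW=> y.
by rewrite -raddfD !mod_scaleE scalerDr raddfD.
Qed.
Lemma mod_scaleDl v : {morph mod_quot_scale^~ v : a b / a + b}.
Proof. by elim/mod_quotW: v => v a b; rewrite !mod_scaleE scalerDl raddfD. Qed.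
HB.instance Definition _ := GRing.Zmodule_isLmodule.Build A mod_quot
  mod_scaleA mod_scale1 mod_scaleDr mod_scaleDl.

Lemma mod_pi_scalable : scalable mod_pi.
Proof. by move=> k x; rewrite -mod_scaleE. Qed.
HB.instance Definition _ := GRing.isScalable.Build A V mod_quot *:%R mod_pi mod_pi_scalable.

End ModuleQuotient.

(* Products in 'S_n are read from left to right, (s * t) i = t (s i), so the
   left permutation representation of 'S_n on row vectors is
   (w v)_i = v_(w i), that is col_perm w. *)
Section ReflectionRepresentation.
Variables (K : fieldType) (n : nat).

Definition coord_sum (v : 'rV[K]_n) : K^o := \sum_i v 0 i.

Lemma coord_sum_linear : linear coord_sum.
Proof.
move=> k u v; rewrite /coord_sum scaler_sumr -big_split.
by apply: eq_bigr => i _; rewrite !mxE.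
Qed.
HB.instance Definition _ :=
  GRing.isLinear.Build K 'rV[K]_n K^o *:%R coord_sum coord_sum_linear.

Definition hspace : {vspace 'rV[K]_n} := lker (linfun coord_sum).
Definition frakh : vectType K := subvs_of hspace.
Definition frakh_dual : vectType K := 'Hom(frakh, K^o).
Local Notation h := frakh.
Local Notation hdual := frakh_dual.

Lemma mem_hspace v : (v \in hspace) = (\sum_i v 0 i == 0).
Proof. by rewrite memv_ker lfunE. Qed.

(* vsproj hspace is the identity on hspace, and is only applied to
   vectors of hspace: see val_h_act and val_alpha_vee below. *)
Definition h_act (w : 'S_n) (y : h) : h := vsproj hspace (col_perm w (vsval y)).

Lemma val_h_act w y : vsval (h_act w y) = col_perm w (vsval y).
Proof.
rewrite vsprojK // mem_hspace.
have := subvsP y; rewrite mem_hspace (reindex_perm w) /=.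
by congr (_ == _); apply: eq_bigr => i _; rewrite mxE.
Qed.

Lemma h_actM w w' y : h_act (w * w')%g y = h_act w (h_act w' y).
Proof. by apply: val_inj; rewrite /= !val_h_act col_permM. Qed.

Lemma h_act_linear w : linear (h_act w).
Proof.
move=> k y1 y2; apply: val_inj; rewrite /= !val_h_act linearP /=.
by apply/rowP => i; rewrite !mxE.
Qed.
HB.instance Definition _ w := GRing.isLinear.Build K h h *:%R (h_act w) (h_act_linear w).

Definition hdual_act (w : 'S_n) (x : hdual) : hdual :=
  (x \o linfun (h_act w^-1))%VF.

Lemma hdual_actE w x y : hdual_act w x y = x (h_act w^-1 y).
Proof. by rewrite comp_lfunE lfunE. Qed.

Lemma dim_hspace : (0 < n)%N -> \dim hspace = n.-1.
Proof.
move=> n_gt0; have := limg_ker_dim (linfun coord_sum) fullv.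
suff -> : (linfun coord_sum @: fullv)%VS = fullv.
  by rewrite capfv !dimvf /dim /= mul1n addn1 => /(congr1 predn).
apply/eqP; rewrite eqEsubv subvf; apply/subvP => k _.
apply/memv_imgP; exists (k *: delta_mx 0 (Ordinal n_gt0)); rewrite ?memvf //.
rewrite lfunE /= /coord_sum (bigD1 (Ordinal n_gt0)) //= !mxE !eqxx mulr1.
by rewrite big1 ?addr0 // => l /negPf nl; rewrite !mxE nl mulr0.
Qed.

Definition hcoord (i : 'I_n) (y : h) : K^o := vsval y 0 i.

Lemma hcoord_linear i : linear (hcoord i).
Proof. by move=> k y1 y2; rewrite /hcoord linearP !mxE. Qed.
HB.instance Definition _ i := GRing.isLinear.Build K h K^o *:%R (hcoord i) (hcoord_linear i).

Definition hcoordX (i : 'I_n) : hdual := linfun (hcoord i).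

(* For the transposition s = tperm i j: alpha_s and alpha_s^vee. *)
Definition alpha (i j : 'I_n) : hdual := hcoordX i - hcoordX j.
Definition alpha_vee (i j : 'I_n) : h :=
  vsproj hspace (delta_mx 0 i - delta_mx 0 j).

Lemma val_alpha_vee i j : vsval (alpha_vee i j) = delta_mx 0 i - delta_mx 0 j.
Proof.
rewrite vsprojK // memv_ker lfunE /=; apply/eqP.
have E k : coord_sum (delta_mx 0 k) = 1.
  rewrite /coord_sum (bigD1 k) //= mxE !eqxx big1 /= ?addr0 // => l /negPf nl.
  by rewrite mxE nl andbF.
by rewrite linearB /= !E subrr.
Qed.

Lemma alphaE i j y : alpha i j y = vsval y 0 i - vsval y 0 j.
Proof. by rewrite /alpha add_lfunE opp_lfunE !lfunE. Qed.

Lemma alpha_alpha_vee i j : i != j -> alpha i j (alpha_vee i j) = 2.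
Proof.
move=> nij; rewrite alphaE val_alpha_vee !mxE !eqxx /= [j == i]eq_sym (negPf nij).
by rewrite subr0 sub0r opprK.
Qed.

Lemma tperm_alpha_vee i j : h_act (tperm i j) (alpha_vee i j) = - alpha_vee i j.
Proof.
apply: val_inj; rewrite /= val_h_act val_alpha_vee; apply/rowP => k.
rewrite !mxE /= opprB; case: tpermP => [->|->|/eqP/negPf -> /eqP/negPf ->].
- by rewrite !eqxx [j == i]eq_sym.
- by rewrite !eqxx [j == i]eq_sym.
- by rewrite subrr.
Qed.

Lemma tperm_alpha i j : hdual_act (tperm i j) (alpha i j) = - alpha i j.
Proof.
apply/lfunP => y; rewrite hdual_actE opp_lfunE !alphaE val_h_act tpermV !mxE.
by rewrite tpermL tpermR opprB.
Qed.

End ReflectionRepresentation.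

Section Cherednik.
Variables (K : fieldType) (n : nat) (c : K).

Local Notation h := (frakh K n).
Local Notation hdual := (frakh_dual K n).

Definition gens : choiceType := ('S_n + (h + hdual))%type.
Definition free_alg : lalgType K := {malg K[{fmonom gens}]}.

Definition free_gen (g : gens) : free_alg := mkmalgU (fmu g) 1.
Local Notation T w := (free_gen (inl w)).
Local Notation Y y := (free_gen (inr (inl y))).
Local Notation X x := (free_gen (inr (inr x))).

(* Rel_one .. Rel_conj_x present the smash product of K[S_n] with the tensor
   algebra of h + h^*; reflections are indexed by pairs i < j. *)
Inductive cherednik_rel : free_alg -> Prop :=
| Rel_one : cherednik_rel (T 1%g - 1)
| Rel_mul w w' : cherednik_rel (T (w * w')%g - T w * T w')
| Rel_lin_y k y y' : cherednik_rel (Y (k *: y + y') - (k *: Y y + Y y'))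
| Rel_lin_x k x x' : cherednik_rel (X (k *: x + x') - (k *: X x + X x'))
| Rel_conj_y w y : cherednik_rel (T w * Y y - Y (h_act w y) * T w)
| Rel_conj_x w x : cherednik_rel (T w * X x - X (hdual_act w x) * T w)
| Rel_comm_x x x' : cherednik_rel (X x * X x' - X x' * X x)
| Rel_comm_y y y' : cherednik_rel (Y y * Y y' - Y y' * Y y)
| Rel_cross y x : cherednik_rel
    ((Y y * X x - X x * Y y)
     - ((x y)%:A - c *: \sum_(i < n) \sum_(j < n | (i < j)%N)
           (alpha K i j y * x (alpha_vee K i j)) *: T (tperm i j))).

Definition cherednik : Type := alg_quot cherednik_rel.
HB.instance Definition _ := GRing.PzRing.on cherednik.
HB.instance Definition _ := GRing.Lmodule.on cherednik.

Definition Hgrp (w : 'S_n) : cherednik := alg_pi cherednik_rel (T w).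
Definition Hy (y : h) : cherednik := alg_pi cherednik_rel (Y y).
Definition Hx (x : hdual) : cherednik := alg_pi cherednik_rel (X x).

Section Standard.
Variables (d : nat) (tau : mx_representation K [set: 'S_n] d).

(* The left 'S_n-module afforded by tau: MathComp representations act on row
   vectors on the right. *)
Definition rep_act (w : 'S_n) (v : 'rV[K]_d) : 'rV[K]_d := v *m tau w^-1%g.

Lemma rep_actM w w' v : rep_act (w * w')%g v = rep_act w (rep_act w' v).
Proof. by rewrite /rep_act invMg repr_mxM ?inE // mulmxA. Qed.

(* 1 (x) v in H (x)_K K^d = H^d *)
Definition tens1 (v : 'rV[K]_d) : 'rV[cherednik]_d := \row_i (v 0 i *: (1 : cherednik)).

(* H (x)_(K[S_n] |x K[h^*]) tau is the quotient of H (x)_K tau by the elements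
   a b (x) v - a (x) b v; it suffices to take a = 1 and b = w, y, which
   generate K[S_n] |x K[h^*]. *)
Inductive balanced_rel : 'rV[cherednik]_d -> Prop :=
| Balanced_grp w v : balanced_rel (Hgrp w *: tens1 v - tens1 (rep_act w v))
| Balanced_y y v : balanced_rel (Hy y *: tens1 v - tens1 0).

Definition standard_module : Type := mod_quot balanced_rel.
HB.instance Definition _ := GRing.Lmodule.on standard_module.

End Standard.

Definition sym_idem : cherednik := (#|[set: 'S_n]|%:R^-1 : K) *: \sum_(w : 'S_n) Hgrp w.

(* Polynomials in the coordinates x_0, .., x_(n-1) map onto K[h], compatibly
   with evaluation at points of h; Hpoly f is the image of f in H. *)
Definition Hpoly (f : mpoly n K) : cherednik :=
  \sum_(m <- msupp f) mcoeff m f *: \prod_(i < n) Hx (hcoordX K i) ^+ m i.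

Definition poly_at (p : h) (f : mpoly n K) : K := f.@[fun i => vsval p 0 i].

Section Modules.
Variable M : lmodType cherednik.

Definition aspherical : Prop :=
  (exists u : M, u != 0) /\ (forall u : M, sym_idem *: u = 0).

(* p lies in the support iff the localization of M, as a K[h]-module, at the
   maximal ideal of p is nonzero, i.e., some u : M is not killed by any
   function that does not vanish at p. *)
Definition hsupport : set h := fun p =>
  exists u : M, forall f, poly_at p f != 0 -> Hpoly f *: u != 0.

End Modules.

End Cherednik.

Definition simple_module (A : pzRingType) (M : lmodType A) : Prop :=
  (exists u : M, u != 0) /\
  forall S : {pred M}, submod_closed S ->
    (forall u, u \in S -> u = 0) \/ (forall u, u \in S).

Definition irreducible_quotient (A : pzRingType) (M L : lmodType A) : Prop :=
  simple_module L /\ exists f : {linear M -> L}, forall u, exists v, f v = u.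

(* Main.v *)
(* Let -1 < c < 0 and let L be simple. If L has no invariants, averaging f u
   over S_n for all polynomials f shows that a product of roots kills L up to a
   power, so that the support lies in the reflection hyperplanes. Conversely,
   let u <> 0 be invariant, and choose an equivalence e on the indices such that
   g = prod_(i !~ j) (x_i - x_j) is not nilpotent on L while (x_i - x_j) g is
   nilpotent for i ~ j; it corresponds to a maximal stratum of the support. Any
   polynomial killing u vanishes on this stratum, so the support is h when e is
   trivial. Otherwise, after inverting g and dividing by the coordinates along
   the stratum at a generic point, L yields a finite-dimensional representation
   of the Cherednik algebra of the parabolic subgroup W' preserving the classes
   of e, and u shows that its W'-invariants are nonzero. This is impossible: the
   Euler element is a multiple of [sum Y_i^2, sum X_i^2], so its trace on the
   invariants is 0. But if v is an invariant eigenvector and d is the largest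
   degree such that some monomial of degree d in X does not kill v, then the sum
   of the reflections of W' acts by a scalar on the span of these X^a v. This
   scalar is at least -d, which forces the eigenvalue to be negative. *)
Require Import Defs.
From HB Require Import structures.
From mathcomp Require Import all_boot all_order all_algebra all_fingroup.
From mathcomp Require Import mxrepresentation ring.
From mathcomp Require Import boolp classical_sets reals complex.
From mathcomp Require Import monalg.

Set Implicit Arguments.
Unset Strict Implicit.
Unset Printing Implicit Defensive.

Import Order.TTheory GRing.Theory Num.Theory.
Local Open Scope ring_scope.

(** * Relations in the rational Cherednik algebra *)

(** Localization is avoided: inverting g becomes a statement up to a power of g inside [L], and
    quotients of [L] are predicates together with matrices of the induced operators. The functions
    with a power killing [L] stand for the radical ideal of the support. A symmetric polynomial
    killing one nonzero vector is among them, since commuting it with y costs one power and [L] is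
    simple; this is why a polynomial killing u is averaged over the group. Near the stratum, g y
    corrected by reflections differentiates along the stratum, so the ideal is stable under such
    derivations, and this forces its elements to vanish on the whole stratum. The return from finite
    dimension to u is a determinant: it kills u up to a factor, but both are nonzero at the generic
    point. The bound -d comes from a Casimir form that is a sum of squares. The condition -1 < c
    enters at the end: a degree d lowers the eigenvalue by d, while the reflections raise it by at
    most -c d. *)

Lemma sum_lt_half (K : fieldType) (n : nat) (V : lmodType K) (F : 'I_n -> 'I_n -> V) :
  (2 : K) != 0 -> (forall i j, F j i = F i j) -> (forall i, F i i = 0) ->
  \sum_(i < n) \sum_(j < n | (i < j)%N) F i j = 2^-1 *: \sum_(i < n) \sum_(j < n) F i j.
Proof.
move=> nz2 FC F0; have -> : \sum_(i < n) \sum_(j < n) F i j =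
   2 *: (\sum_(i < n) \sum_(j < n | (i < j)%N) F i j).
  rewrite scaler_nat mulr2n.
  have -> : \sum_(i < n) \sum_(j < n) F i j =
     \sum_(i < n) (\sum_(j < n | (i < j)%N) F i j + \sum_(j < n | (j < i)%N) F i j).
    apply: eq_bigr => i _; rewrite (bigID (fun j : 'I_n => (i < j)%N)) /=.
    congr (_ + _); rewrite (bigD1 i) ?ltnn //= F0 add0r; apply: eq_bigl => j.
    by rewrite -leqNgt ltn_neqAle andbC.
  rewrite big_split /=; congr (_ + _).
  rewrite (exchange_big_dep xpredT) //=; apply: eq_bigr => i _.
  by apply: eq_bigr => j _; rewrite FC.
by rewrite scalerA mulVf ?scale1r.
Qed.

Lemma malg_scalerAr (K : comNzRingType) (M : monomType) (k : K) (a b : {malg K[M]}) :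
  k *: (a * b) = a * (k *: b).
Proof.
apply/malgP => m; rewrite mcoeffZ (@mcoeffMlw _ _ (msupp a) (msupp b)) //.
rewrite (@mcoeffMlw _ _ (msupp a) (msupp b)) ?msuppZ_le //.
rewrite mulr_sumr; apply: eq_bigr => i _; rewrite mulr_sumr; apply: eq_bigr => j _.
by rewrite mcoeffZ mulrCA mulrnAr.
Qed.

Lemma sub_sum_lt_half (K : fieldType) (n : nat) (V : lmodType K) (F : 'I_n -> 'I_n -> V)
    (u : V) (c : K) :
  (2 : K) != 0 -> (forall i j, F j i = F i j) -> (forall i, F i i = 0) ->
  u - c *: \sum_(i < n) \sum_(j < n | (i < j)%N) F i j =
  u - (c / 2) *: \sum_(i < n) \sum_(j < n) F i j.
Proof. by move=> nz2 FC F0; rewrite (sum_lt_half nz2 FC F0) scalerA. Qed.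

Section QuotientRelations.
Variables (K : fieldType) (A : lalgType K) (r : A -> Prop).
Local Notation pi := (alg_pi r).

Lemma alg_quot_piZ (k : K) z : pi (k *: z) = k *: pi z.
Proof. exact: linearZ. Qed.

Lemma alg_quot_piB a b : pi (a - b) = pi a - pi b.
Proof. exact: raddfB. Qed.

Lemma alg_quot_scalerAl (k : K) (a b : alg_quot r) : k *: (a * b) = (k *: a) * b.
Proof.
elim/alg_quotW: a => a; elim/alg_quotW: b => b.
by rewrite -rmorphM -!alg_quot_piZ -rmorphM scalerAl.
Qed.

Lemma alg_quot_scalerAr : (forall (k : K) (a b : A), k *: (a * b) = a * (k *: b)) ->
  forall (k : K) (a b : alg_quot r), k *: (a * b) = a * (k *: b).
Proof.
move=> Ar k a b; elim/alg_quotW: a => a; elim/alg_quotW: b => b.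
by rewrite -rmorphM -!alg_quot_piZ -rmorphM Ar.
Qed.

Lemma alg_quot_relB z z' : r (z - z') -> pi z = pi z'.
Proof. by move=> rz; apply/alg_piP/asboolP; apply: Ideal_gen. Qed.

Lemma alg_quot_rel1 z : r (z - 1) -> pi z = 1.
Proof. by move/alg_quot_relB->; rewrite rmorph1. Qed.

Lemma alg_quot_rel_mul1 z a b : r (z - a * b) -> pi z = pi a * pi b.
Proof. by move/alg_quot_relB->; rewrite rmorphM. Qed.

Lemma alg_quot_rel_linear (k : K) z a b :
  r (z - (k *: a + b)) -> pi z = k *: pi a + pi b.
Proof. by move/alg_quot_relB->; rewrite raddfD /= alg_quot_piZ. Qed.

Lemma alg_quot_rel_mul a b b' a' : r (a * b - b' * a') -> pi a * pi b = pi b' * pi a'.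
Proof. by move/alg_quot_relB; rewrite !rmorphM. Qed.

Lemma alg_quot_rel_cross (I : finType) (P : rel I) (a b : A) (k l : K)
    (s : I -> I -> K) (t : I -> I -> A) :
  r ((a * b - b * a) - (k%:A - l *: \sum_i \sum_(j | P i j) s i j *: t i j)) ->
  pi a * pi b - pi b * pi a = k *: (1 : alg_quot r) -
    l *: \sum_i \sum_(j | P i j) s i j *: pi (t i j).
Proof.
move/alg_quot_relB; rewrite alg_quot_piB [X in _ = X]alg_quot_piB !rmorphM /= => ->.
rewrite !alg_quot_piZ rmorph1; congr (_ - _ *: _); rewrite raddf_sum; apply: eq_bigr => i _.
by rewrite raddf_sum; apply: eq_bigr => j _; rewrite /= alg_quot_piZ.
Qed.

End QuotientRelations.

(** Elements of the quotient are linear combinations of words in the generators, and a word acts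
    letter by letter; so stability under scalars and generators suffices. *)
Lemma free_quot_closed (K : fieldType) (I : choiceType) (r : {malg K[{fmonom I}]} -> Prop)
    (L : lmodType (alg_quot r)) (P : L -> Prop) :
  P 0 -> (forall u v, P u -> P v -> P (u + v)) ->
  (forall (k : K) u, P u -> P ((k *: (1 : alg_quot r)) *: u)) ->
  (forall (g : I) u, P u -> P (alg_pi r (mkmalgU (fmu g) 1) *: u)) ->
  forall (a : alg_quot r) u, P u -> P (a *: u).
Proof.
move=> P0 PD PZ Pg; elim/alg_quotW => z u Pu.
rewrite [z]monalgE raddf_sum scaler_suml; elim/big_ind: _ => // m _.
have -> : mkmalgU m (mcoeff m z) = mcoeff m z *: mkmalgU m 1 :> {malg K[{fmonom I}]}.
  by apply/malgP => k; rewrite mcoeffZ !mcoeffU mulrnAr mulr1.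
rewrite /= alg_quot_piZ -[alg_pi r (mkmalgU m 1)]mul1r alg_quot_scalerAl -scalerA.
apply: PZ; have -> : m = FMonom (fmonom_val m) by case: m.
elim: (fmonom_val m) => [|g s IH] {m}.
  have -> : mkmalgU (FMonom [::]) 1 = 1 :> {malg K[{fmonom I}]} by rewrite -(fmE [::]).
  by rewrite rmorph1 scale1r.
have -> : mkmalgU (FMonom (g :: s)) 1 =
    mkmalgU (fmu g) 1 * mkmalgU (FMonom s) 1 :> {malg K[{fmonom I}]}.
  rewrite malgM_def fgmulUU mulr1; congr mkmalgU.
  by rewrite /mmul /= fmmulE fmuE.
by rewrite rmorphM -scalerA; apply: Pg.
Qed.

Section CherednikAlgebra.
Variables (K : fieldType) (n : nat) (c : K).
Local Notation H := (cherednik n c).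
Local Notation h := (frakh K n).
Local Notation hdual := (frakh_dual K n).

Lemma cherednik_scalerAl (k : K) (a b : H) : k *: (a * b) = (k *: a) * b.
Proof. exact: alg_quot_scalerAl. Qed.

Lemma cherednik_scalerAr (k : K) (a b : H) : k *: (a * b) = a * (k *: b).
Proof. exact: (alg_quot_scalerAr (@malg_scalerAr K _)). Qed.

Lemma Hgrp1 : Hgrp c 1%g = 1 :> H.
Proof. exact: (alg_quot_rel1 (@Rel_one K n c)). Qed.

Lemma HgrpM w w' : Hgrp c (w * w')%g = Hgrp c w * Hgrp c w' :> H.
Proof. exact: (alg_quot_rel_mul1 (Rel_mul c w w')). Qed.

Lemma Hx_linear (k : K) x x' : Hx c (k *: x + x') = k *: (Hx c x : H) + Hx c x' :> H.
Proof. exact: (alg_quot_rel_linear (Rel_lin_x c k x x')). Qed.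
HB.instance Definition _ := GRing.isLinear.Build K hdual H *:%R (@Hx K n c) Hx_linear.

Lemma Hgrp_Hy w y : Hgrp c w * Hy c y = Hy c (h_act w y) * Hgrp c w :> H.
Proof. exact: (alg_quot_rel_mul (Rel_conj_y c w y)). Qed.

Lemma Hgrp_Hx w x : Hgrp c w * Hx c x = Hx c (hdual_act w x) * Hgrp c w :> H.
Proof. exact: (alg_quot_rel_mul (Rel_conj_x c w x)). Qed.

Lemma HxC x x' : Hx c x * Hx c x' = Hx c x' * Hx c x :> H.
Proof. exact: (alg_quot_rel_mul (Rel_comm_x c x x')). Qed.

Lemma Hcross y x : Hy c y * Hx c x - Hx c x * Hy c y = (x y : K) *: (1 : H) -
  c *: \sum_(i < n) \sum_(j < n | (i < j)%N)
     (alpha K i j y * x (alpha_vee K i j) : K) *: (Hgrp c (tperm i j) : H) :> H.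
Proof. exact: (alg_quot_rel_cross (Rel_cross c y x)). Qed.

Lemma alphaC i j : alpha K j i = - alpha K i j :> hdual.
Proof. by rewrite /alpha opprB. Qed.

Lemma alpha_veeC i j : alpha_vee K j i = - alpha_vee K i j :> h.
Proof. by apply: val_inj; rewrite /= !val_alpha_vee opprB. Qed.

(** Summing over all ordered pairs avoids the order on the indices, which permutations do not
    preserve; this is the origin of c / 2 throughout. *)
Lemma Hcross2 y x : (2 : K) != 0 -> Hy c y * Hx c x - Hx c x * Hy c y = (x y : K) *: (1 : H) -
  (c / 2) *: \sum_(i < n) \sum_(j < n)
     (alpha K i j y * x (alpha_vee K i j) : K) *: (Hgrp c (tperm i j) : H) :> H.
Proof.
move=> nz2; apply: etrans (Hcross y x) _.
refine (@sub_sum_lt_half K n H (fun i j => (alpha K i j y * x (alpha_vee K i j) : K) *: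
  (Hgrp c (tperm i j) : H)) _ c nz2 _ _) => [i j|i] /=.
  by rewrite alphaC alpha_veeC tpermC linearN opp_lfunE mulrNN.
by rewrite /alpha subrr zero_lfunE mul0r scale0r.
Qed.

Lemma cherednik_closed (L : lmodType H) (P : L -> Prop) :
  P 0 -> (forall u v, P u -> P v -> P (u + v)) ->
  (forall (k : K) u, P u -> P ((k *: (1 : H)) *: u)) ->
  (forall w u, P u -> P (Hgrp c w *: u)) -> (forall y u, P u -> P (Hy c y *: u)) ->
  (forall x u, P u -> P (Hx c x *: u)) -> forall (a : H) u, P u -> P (a *: u).
Proof.
move=> P0 PD PZ Pg Py Px.
apply: (@free_quot_closed K _ (@cherednik_rel K n c) L P P0 PD PZ) => -[w|[y|x]] u.
- exact: Pg.
- exact: Py.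
- exact: Px.
Qed.

End CherednikAlgebra.

(* mpoly shadows the monalg lemmas used above. *)
From mathcomp Require Import ssrcomplements mpoly.

(** * Polynomials evaluated at commuting elements of an algebra quotient *)

Section PolynomialEvaluation.
Variables (K : fieldType) (A : lalgType K) (r : A -> Prop) (n : nat).
Local Notation Q := (alg_quot r).
Variable x : 'I_n -> Q.
Hypothesis quot_scalerAr : forall (k : K) (a b : Q), k *: (a * b) = a * (k *: b).
Hypothesis xC : forall i j, x i * x j = x j * x i.

Let mon (m : 'X_{1..n}) : Q := \prod_(i < n) x i ^+ m i.
Let ev (f : mpoly n K) : Q := \sum_(m <- mpoly.msupp f) mpoly.mcoeff m f *: mon m.

Lemma prod_powM m1 m2 : mon (m1 + m2)%MM = mon m1 * mon m2.
Proof.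
have comm s i k : x i ^+ k * \prod_(j <- s) x j ^+ m1 j = (\prod_(j <- s) x j ^+ m1 j) * x i ^+ k.
  elim: s => [|j s IHs]; first by rewrite big_nil mul1r mulr1.
  have cij l : x i * x j ^+ l = x j ^+ l * x i.
    by elim: l => [|l IHl]; rewrite ?expr0 ?mul1r ?mulr1 // exprS mulrA xC -!mulrA IHl.
  have cijk : x i ^+ k * x j ^+ m1 j = x j ^+ m1 j * x i ^+ k.
    elim: k {IHs} => [|k IHk]; rewrite ?expr0 ?mul1r ?mulr1 //.
    by rewrite exprS -mulrA IHk mulrA cij -mulrA.
  by rewrite big_cons mulrA cijk -!mulrA IHs.
rewrite /mon; elim: (index_enum _) => [|i s IH]; first by rewrite !big_nil mulr1.
rewrite !big_cons mnmDE exprD IH -!mulrA; congr (_ * _).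
by rewrite !mulrA comm.
Qed.

Lemma prod_powU i : mon U_(i)%MM = x i.
Proof.
rewrite /mon; elim: (index_enum _) (index_enum_uniq 'I_n) (mem_index_enum i) => //= j s IH.
case/andP=> js us; rewrite inE big_cons mnm1E => /orP[/eqP eij|si].
  rewrite eij eqxx expr1 big_seq big1 ?mulr1 // => k ks.
  by rewrite mnm1E; case: eqP => [ejk|]; rewrite ?expr0 // ejk ks in js.
rewrite IH //; case: eqP => [eij|_]; last by rewrite expr0 mul1r.
by rewrite -eij si in js.
Qed.

Lemma prod_pow0 : mon 0%MM = 1.
Proof. by rewrite /mon big1 // => i _; rewrite mnm0E expr0. Qed.

Lemma evE k f : (msize f <= k)%N ->
  ev f = \sum_(m : 'X_{1..n < k}) mpoly.mcoeff m f *: mon m.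
Proof.
move=> le_fk; rewrite /ev (big_mksub 'X_{1..n < k}) ?msupp_uniq //=; last first.
  by move=> m /msize_mdeg_lt /leq_trans; apply.
by rewrite big_rmcond //= => m /memN_msupp_eq0 ->; rewrite scale0r.
Qed.

Lemma evD f g : ev (f + g) = ev f + ev g.
Proof.
set k := maxn (msize (f + g)) (maxn (msize f) (msize g)).
rewrite !(@evE k) ?leq_max ?leqnn ?orbT //.
by rewrite -big_split /=; apply: eq_bigr => m _; rewrite mpoly.mcoeffD scalerDl.
Qed.

Lemma evZ a f : ev (a *: f) = a *: ev f.
Proof.
set k := maxn (msize (a *: f)) (msize f).
rewrite !(@evE k) ?leq_max ?leqnn ?orbT // scaler_sumr.
by apply: eq_bigr => m _; rewrite mpoly.mcoeffZ scalerA.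
Qed.

Lemma evX m : ev 'X_[m] = mon m.
Proof. by rewrite /ev msuppX big_seq1 mcoeffX eqxx scale1r. Qed.

Lemma evM f g : ev (f * g) = ev f * ev g.
Proof.
elim/mpolyind: f => [|a m f _ _ IH].
  by rewrite mul0r /ev msupp0 !big_nil mul0r.
rewrite mulrDl !evD mulrDl IH; congr (_ + _).
rewrite -scalerAl !evZ -alg_quot_scalerAl evX; congr (_ *: _) => {IH}.
elim/mpolyind: g => [|b m' g _ _ IH].
  by rewrite mulr0 /ev msupp0 !big_nil mulr0.
rewrite mulrDr !evD mulrDr IH; congr (_ + _).
by rewrite -scalerAr !evZ -quot_scalerAr -mpolyXD !evX prod_powM.
Qed.

Lemma ev1 : ev 1 = 1.
Proof. by rewrite -mpolyX0 evX prod_pow0. Qed.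

Lemma evXU i : ev 'X_i = x i.
Proof. by rewrite evX prod_powU. Qed.

End PolynomialEvaluation.

Section HpolyMorphism.
Variables (K : fieldType) (n : nat) (c : K).
Local Notation H := (cherednik n c).

Lemma HpolyD f g : Hpoly c (f + g) = Hpoly c f + Hpoly c g :> H.
Proof. exact: (@evD K _ _ n (fun i => Hx c (hcoordX K i))). Qed.

Lemma HpolyZ (a : K) f : Hpoly c (a *: f) = a *: (Hpoly c f : H) :> H.
Proof. exact: (@evZ K _ _ n (fun i => Hx c (hcoordX K i))). Qed.

Lemma HpolyM (f g : mpoly n K) : Hpoly c (f * g) = Hpoly c f * Hpoly c g :> H.
Proof.
apply: (@evM K _ _ n (fun i => Hx c (hcoordX K i))); first exact: cherednik_scalerAr.
by move=> i j; exact: HxC.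
Qed.

Lemma Hpoly1 : Hpoly c (1 : mpoly n K) = 1 :> H.
Proof. exact: (@ev1 K _ _ n (fun i => Hx c (hcoordX K i))). Qed.

Lemma HpolyX i : Hpoly c ('X_i : mpoly n K) = Hx c (hcoordX K i) :> H.
Proof. exact: (@evXU K _ _ n (fun i => Hx c (hcoordX K i))). Qed.

End HpolyMorphism.

(** * Cherednik actions on modules over the polynomial ring *)

Lemma mpoly_generator_ind (K : comNzRingType) (n : nat) (P : mpoly n K -> Prop) :
  (forall k, P k%:MP) -> (forall f g, P f -> P g -> P (f + g)) ->
  (forall i f, P f -> P ('X_i * f)) -> forall f, P f.
Proof.
move=> PC PD PX; elim/mpolyind => [|k m f _ _ Pf]; first by rewrite -(mpolyC0 n K).
apply: PD => //; rewrite -mul_mpolyC mpolyXE_id mulrC.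
elim/big_rec: _ => [|i g _ IH]; first by rewrite mul1r.
by elim: (m i) => [|l IHl]; rewrite ?expr0 ?mul1r // exprS -!mulrA; apply: PX; rewrite mulrA.
Qed.

Section Directional.
Variables (K : comNzRingType) (n : nat).
Implicit Type f g : mpoly n K.

Definition dirderiv (v : 'rV[K]_n) f := \sum_j v 0 j *: mderiv j f.

Lemma dirderivD v f g : dirderiv v (f + g) = dirderiv v f + dirderiv v g.
Proof.
by rewrite -big_split /=; apply: eq_bigr => j _; rewrite mderivD scalerDr.
Qed.

Lemma dirderivM v f g : dirderiv v (f * g) = dirderiv v f * g + f * dirderiv v g.
Proof.
rewrite mulr_suml mulr_sumr -big_split /=; apply: eq_bigr => j _.
by rewrite mderivM scalerDr scalerAl scalerAr.
Qed.

Lemma dirderivC v k : dirderiv v k%:MP = 0.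
Proof. by rewrite /dirderiv big1 // => j _; rewrite mderivC scaler0. Qed.

Lemma dirderivXU v i : dirderiv v 'X_i = (v 0 i)%:MP.
Proof.
rewrite /dirderiv (bigD1 i) //= big1 ?addr0 => [|j /negPf ji].
  have E : (U_(i) - U_(i))%MM = 0%MM :> 'X_{1..n} by apply/mnmP => k; rewrite mnmBE mnm0E subnn.
  by rewrite mderivX mnm1E eqxx E mpolyX0 scale1r -mul_mpolyC mulr1.
by rewrite mderivX mnm1E eq_sym ji scale0r scaler0.
Qed.

End Directional.

(* The value of the coordinate x_j on the coroot of the reflection (i k). *)
Definition xcoroot (K : pzRingType) (n : nat) (j i k : 'I_n) : K := (j == i)%:R - (j == k)%:R.

Section Operators.
Variables (K : numFieldType) (n : nat) (c : K) (L : lmodType (mpoly n K)).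
Local Notation Kx := (mpoly n K).
Local Notation V := 'rV[K]_n.
Variables (T : 'S_n -> L -> L) (Y : V -> L -> L).
Implicit Types (f g : Kx) (u : L) (v : V) (w : 'S_n).

(* The action of a rational Cherednik algebra: C[x_1, .., x_n] acts through its
   quotient C[h], and Y v is only constrained when v lies in h. *)
Record cherednik_action : Prop := CherednikAction {
  actTD : forall w u u', T w (u + u') = T w u + T w u';
  actYD : forall v u u', Y v (u + u') = Y v u + Y v u';
  actT1 : forall u, T 1%g u = u;
  actTM : forall w w' u, T (w * w')%g u = T w (T w' u);
  actTf : forall w f u, T w (f *: u) = msym w^-1%g f *: T w u;
  actYZ : forall v k u, Y v (k%:MP *: u) = k%:MP *: Y v u;
  actTY : forall w v u, \sum_i v 0 i = 0 -> T w (Y v u) = Y (col_perm w v) (T w u);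
  actYX : forall v j u, \sum_i v 0 i = 0 -> Y v ('X_j *: u) =
    'X_j *: Y v u + (v 0 j)%:MP *: u -
    (c / 2)%:MP *: \sum_p ((v 0 p.1 - v 0 p.2) * xcoroot K j p.1 p.2)%:MP *: T (tperm p.1 p.2) u;
  act_sumX : forall u, (\sum_i 'X_i : Kx) *: u = 0 }.

Hypothesis act : cherednik_action.

Lemma actT0 w : T w 0 = 0.
Proof. by apply: (@addIr _ (T w 0)); rewrite -(actTD act) !add0r. Qed.
Lemma actY0 v : Y v 0 = 0.
Proof. by apply: (@addIr _ (Y v 0)); rewrite -(actYD act) !add0r. Qed.
Lemma actT_sum w (I : Type) (r : seq I) P (F : I -> L) :
  T w (\sum_(i <- r | P i) F i) = \sum_(i <- r | P i) T w (F i).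
Proof. exact: (big_morph _ (actTD act w) (actT0 w)). Qed.
Lemma actY_sum v (I : Type) (r : seq I) P (F : I -> L) :
  Y v (\sum_(i <- r | P i) F i) = \sum_(i <- r | P i) Y v (F i).
Proof. exact: (big_morph _ (actYD act v) (actY0 v)). Qed.

Lemma msymXU w i : msym w 'X_i = 'X_(w i) :> Kx.
Proof.
rewrite msymX; congr mpolyX; apply/mnmP => j; rewrite !mnmE; congr nat_of_bool.
by rewrite -(inj_eq (@perm_inj _ w)) permKV.
Qed.

Lemma msymC w (k : K) : msym w k%:MP = k%:MP :> Kx.
Proof. by rewrite -[k%:MP]mulr1 mul_mpolyC msymZ msym1. Qed.

(** By induction on f: each reflection met in the commutator of [Y v] with ['X_j] moves past f by
    permuting its variables. The coefficients q depend on v and f but not on u. *)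
Lemma actY_poly v f : \sum_i v 0 i = 0 ->
  exists q : 'S_n -> Kx, forall u, Y v (f *: u) = f *: Y v u + \sum_w q w *: T w u.
Proof.
move=> v0; elim/mpoly_generator_ind: f => [k|f g [q qP] [q' q'P]|j f [q qP]].
- exists (fun=> 0) => u; rewrite (actYZ act) big1 ?addr0 // => w _.
  by rewrite scale0r.
- exists (fun w => q w + q' w) => u; rewrite scalerDl (actYD act) qP q'P scalerDl addrACA.
  by congr (_ + _); rewrite -big_split; apply: eq_bigr => w _; rewrite scalerDl.
exists (fun w => 'X_j * q w + (if w == 1%g then (v 0 j)%:MP * f else 0) -
  \sum_(p : 'I_n * 'I_n | w == tperm p.1 p.2)
     (c / 2 * ((v 0 p.1 - v 0 p.2) * xcoroot K j p.1 p.2))%:MP * msym w^-1%g f) => u.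
rewrite -scalerA (actYX act) // qP scalerDr scalerA -!addrA; congr (_ + _).
transitivity (\sum_w ('X_j * q w) *: T w u + \sum_w (if w == 1%g then (v 0 j)%:MP * f else 0) *: T w u
   - \sum_w (\sum_(p : 'I_n * 'I_n | w == tperm p.1 p.2)
     (c / 2 * ((v 0 p.1 - v 0 p.2) * xcoroot K j p.1 p.2))%:MP * msym w^-1%g f) *: T w u); last first.
  by rewrite -big_split -sumrB; apply: eq_bigr => w _; rewrite /= scalerBl scalerDl.
rewrite -addrA scaler_sumr; congr (_ + (_ - _)).
- by apply: eq_bigr => w _; rewrite scalerA.
- rewrite (bigD1 1%g) //= big1 ?addr0 => [|w /negPf ->]; last by rewrite scale0r.
  by rewrite eqxx (actT1 act) scalerA.
under [RHS]eq_bigr => w _ do rewrite scaler_suml.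
rewrite scaler_sumr (exchange_big_dep xpredT) //=; apply: eq_bigr => p _.
by rewrite (big_pred1 (tperm p.1 p.2)) // (actTf act) !scalerA [(c / 2 * _)%:MP]mpolyCM.
Qed.

Definition symmetric_poly f := forall w, msym w f = f.

Lemma act_symmetric f w u : symmetric_poly f -> T w (f *: u) = f *: T w u.
Proof. by move=> sf; rewrite (actTf act) sf. Qed.

(** Since f commutes with every [T w], it commutes with its own commutator with [Y v]. Powers of f
    are then differentiated as usual, and moving [Y v] past f^(k+1) leaves a factor f^k on u. *)
Lemma actY_symmetric_exp v f k u : \sum_i v 0 i = 0 -> symmetric_poly f ->
  f ^+ k *: u = 0 -> f ^+ k.+1 *: Y v u = 0.
Proof.
move=> v0 sf fu; have [q qP] := actY_poly f v0.
have E j u' : Y v (f ^+ j *: u') =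
    f ^+ j *: Y v u' + (f ^+ j.-1 *: \sum_w q w *: T w u') *+ j.
  elim: j u' => [|j IH] u'; first by rewrite !expr0 !scale1r mulr0n addr0.
  rewrite exprSr -scalerA IH qP scalerDr !scalerA -exprSr -addrA; congr (_ + _).
  rewrite mulrSr addrC /= -!scaler_nat; congr (_ + _).
  case: j {IH} => [|j] /=; first by rewrite !scale0r.
  congr (_ *: _); rewrite exprSr -!scalerA; congr (_ *: _).
  rewrite scaler_sumr; apply: eq_bigr => w _.
  by rewrite act_symmetric // !scalerA mulrC.
have := E k.+1 u; rewrite exprS -scalerA fu scaler0 actY0 /=.
rewrite (_ : _ *: \sum_w _ = 0) ?mul0rn ?addr0 // scaler_sumr big1 // => w _.
rewrite scalerA mulrC -scalerA -act_symmetric ?fu ?actT0 ?scaler0 //.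
by move=> w'; rewrite rmorphXn /= sf.
Qed.

(** * The radical of the annihilator *)

Section Nilpotent.

(** The exponent is uniform in u, so these f form the radical of the annihilator of [L], a
    substitute for the ideal of the support. *)
Definition nilp f := exists k, forall u, f ^+ k *: u = 0.

Lemma nilpM f g : nilp f -> nilp (g * f).
Proof. by case=> k fk; exists k => u; rewrite exprMn -scalerA fk scaler0. Qed.

Lemma nilp_exp f k : nilp (f ^+ k.+1) -> nilp f.
Proof. by case=> j fj; exists (k.+1 * j)%N => u; rewrite exprM fj. Qed.

Lemma nilpD f g : nilp f -> nilp g -> nilp (f + g).
Proof.
case=> k fk [l gl]; exists (k + l)%N => u; rewrite exprDn scaler_suml big1 // => i _.
rewrite -mulr_natl; case: (leqP l i) => [li|/ltnW li].
  by rewrite -[in g ^+ _](subnK li) exprD -!scalerA gl !scaler0.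
by rewrite -addnBA // [(k + (l - i))%N]addnC exprD mulrAC -!scalerA fk !scaler0.
Qed.

Lemma nilp0 : nilp 0.
Proof. by exists 1%N => u; rewrite expr1 scale0r. Qed.

Lemma nilp_sum (I : Type) (r : seq I) (P : pred I) (F : I -> Kx) :
  (forall i, P i -> nilp (F i)) -> nilp (\sum_(i <- r | P i) F i).
Proof. by move=> nF; elim/big_ind: _ => //; [apply: nilp0|apply: nilpD]. Qed.

Lemma nilpN f : nilp f -> nilp (- f).
Proof. by move/(nilpM (-1)); rewrite mulN1r. Qed.

Lemma nilpZ k f : nilp f -> nilp (k *: f).
Proof. by move/(nilpM k%:MP); rewrite mul_mpolyC. Qed.

(** In characteristic 0 the radical of an ideal stable under a derivation is stable too; here the
    ideal is the annihilator of [L]. *)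
Lemma nilp_derivation (D : Kx -> Kx) f :
  (forall f g, D (f * g) = D f * g + f * D g) ->
  (forall f, (forall u, f *: u = 0) -> forall u, D f *: u = 0) ->
  nilp f -> nilp (D f).
Proof.
move=> DM Dann [k fk].
have D1 : D 1 = 0.
  by have := DM 1 1; rewrite !mulr1 mul1r => /eqP; rewrite addrC -subr_eq subrr => /eqP.
have DX h j : D (h ^+ j) = (h ^+ j.-1 * D h) *+ j.
  elim: j => [|j IH]; first by rewrite expr0 D1.
  rewrite exprS DM IH; case: j {IH} => [|j] /=.
    by rewrite !expr0 mulr0 addr0 mulr1 mul1r.
  by rewrite mulrnAr mulrA -exprS [D h * _]mulrC -mulrS.
have nz j u : j.+1%:R%:MP *: u = 0 -> u = 0.
  move=> /(congr1 (fun x => (j.+1%:R^-1)%:MP *: x)).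
  by rewrite scaler0 scalerA -mpolyCM mulVf ?pnatr_eq0 // scale1r.
(* Apply D to f^(j+1) (D f)^l and multiply by D f: the term containing D (D f) is a multiple of the
   original product, and what remains is (j+1) f^j (D f)^(l+2). So each factor f can be traded for
   two factors D f. *)
have step j l : (forall u, (f ^+ j.+1 * D f ^+ l) *: u = 0) ->
    forall u, (f ^+ j * D f ^+ l.+2) *: u = 0.
  move=> H u; have := Dann _ H (D f *: u); rewrite DM !DX /= -[_ *+ j.+1]mulr_natl -[_ *+ l]mulr_natl => E.
  apply: (nz j); rewrite -[RHS]E scalerDl [X in _ = _ + X](_ : _ = 0) ?addr0.
    by rewrite !scalerA mpolyC_nat; congr (_ *: _); rewrite !exprS; ring.
  have := H ((l%:R * D (D f)) *: u); rewrite !scalerA => E'; rewrite -[RHS]E'.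
  congr (_ *: _); case: l {H E E'} => [|l] /=; first by rewrite !mul0r !mulr0 !mul0r.
  by rewrite !exprS; ring.
have nil j : (j <= k)%N -> forall u, (f ^+ (k - j) * D f ^+ (j.*2)) *: u = 0.
  elim: j => [|j IH] jk u; first by rewrite subn0 expr0 mulr1 fk.
  by rewrite doubleS; apply: step => u'; rewrite subnSK //; apply: IH; apply: ltnW.
by exists k.*2 => u; have := nil k (leqnn k) u; rewrite subnn expr0 mul1r.
Qed.

End Nilpotent.

Section Strata.
Variable e : rel 'I_n.

(** It is nonzero at the points whose coordinates at i and k differ whenever e i k fails. The
    product runs over ordered pairs, so that invariance under permutations preserving e involves no
    signs. *)
Definition gprod : Kx := \prod_(p : 'I_n * 'I_n | ~~ e p.1 p.2) ('X_(p.1) - 'X_(p.2)).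
Definition gprodD1 (q : 'I_n * 'I_n) : Kx :=
  \prod_(p : 'I_n * 'I_n | ~~ e p.1 p.2 && (p != q)) ('X_(p.1) - 'X_(p.2)).

(* g y corrected so that, away from g = 0, it acts as an element of the
   Cherednik algebra of the parabolic subgroup preserving the classes of e. *)
Definition Dunkl v u := gprod *: Y v u - (c / 2)%:MP *:
  \sum_(p : 'I_n * 'I_n | ~~ e p.1 p.2)
     ((v 0 p.1 - v 0 p.2)%:MP * gprodD1 p) *: T (tperm p.1 p.2) u.

Lemma DunklD v u u' : Dunkl v (u + u') = Dunkl v u + Dunkl v u'.
Proof.
rewrite /Dunkl (actYD act) scalerDr addrACA -opprD; congr (_ - _).
rewrite -scalerDr -big_split /=; congr (_ *: _); apply: eq_bigr => p _.
by rewrite (actTD act) scalerDr.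
Qed.

Lemma Dunkl0 v : Dunkl v 0 = 0.
Proof. by apply: (@addIr _ (Dunkl v 0)); rewrite -DunklD !add0r. Qed.

Lemma Dunkl_sum v (I : Type) (r : seq I) P (F : I -> L) :
  Dunkl v (\sum_(i <- r | P i) F i) = \sum_(i <- r | P i) Dunkl v (F i).
Proof. exact: (big_morph _ (DunklD v) (Dunkl0 v)). Qed.

Lemma DunklZ v k u : Dunkl v (k%:MP *: u) = k%:MP *: Dunkl v u.
Proof.
rewrite /Dunkl (actYZ act) scalerBr !scalerA [gprod * _]mulrC; congr (_ - _).
rewrite [k%:MP * _]mulrC -scalerA; congr (_ *: _); rewrite scaler_sumr; apply: eq_bigr => p _.
by rewrite (actTf act) msymC !scalerA mulrC.
Qed.

(** Moving ['X_j] past a reflection (i k) leaves a multiple of ['X_i - 'X_k]; with [gprodD1] this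
    completes [gprod], and the correction cancels the reflections outside e coming from [Y v]. *)
Lemma DunklX v j u : \sum_i v 0 i = 0 -> Dunkl v ('X_j *: u) = 'X_j *: Dunkl v u +
  gprod *: ((v 0 j)%:MP *: u - (c / 2)%:MP *: \sum_(p : 'I_n * 'I_n | e p.1 p.2)
      ((v 0 p.1 - v 0 p.2) * xcoroot K j p.1 p.2)%:MP *: T (tperm p.1 p.2) u).
Proof.
move=> v0; rewrite /Dunkl (actYX act) // (bigID (fun p => e p.1 p.2)) /=.
set S1 := \sum_(p | _) _; set S2 := \sum_(p | ~~ _) _.
set S3 := \sum_(p | ~~ _) _; set S4 := \sum_(p | _) _.
have -> : S3 = 'X_j *: S4 - gprod *: S2.
  rewrite !scaler_sumr -sumrB; apply: eq_bigr => -[i k] /= eik.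
  rewrite (actTf act) tpermV msymXU !scalerA -scalerBl; congr (_ *: _).
  have -> : gprod = gprodD1 (i, k) * ('X_i - 'X_k).
    by rewrite /gprod (bigD1 (i, k)) //= mulrC.
  rewrite /xcoroot mpolyCM [(_%:R - _%:R)%:MP]mpolyCB !mpolyC_nat; case: tpermP => [->|->|/eqP/negPf ji /eqP/negPf jk].
  - by rewrite eqxx; case: (i =P k) => [->|_]; rewrite ?subrr /=; ring.
  - by rewrite eqxx eq_sym; case: (i =P k) => [->|_]; rewrite ?subrr /=; ring.
  by rewrite ji jk /=; ring.
rewrite !scalerBr !scalerDr !scalerA [gprod * 'X_j]mulrC [_ * 'X_j]mulrC [_ * gprod]mulrC.
rewrite [(c / 2)%:MP * gprod]mulrC opprB addrA opprD addrA subrK [RHS]addrACA -[LHS]addrA.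
by congr (_ + _); rewrite addrC.
Qed.

(** If v is constant on the classes, the remaining reflections enter with coefficient v_i - v_k = 0,
    and [Dunkl v] differentiates coefficients like g times a vector field. *)
Lemma Dunkl_flat v f u : \sum_i v 0 i = 0 -> (forall i k, e i k -> v 0 i = v 0 k) ->
  Dunkl v (f *: u) = f *: Dunkl v u + (gprod * dirderiv v f) *: u.
Proof.
move=> v0 ve; elim/mpoly_generator_ind: f u => [k|f g IHf IHg|j f IH] u.
- by rewrite DunklZ dirderivC mulr0 scale0r addr0.
- by rewrite !scalerDl DunklD IHf IHg dirderivD mulrDr scalerDl addrACA.
rewrite -(scalerA 'X_j f u) DunklX // IH [\sum_(p | _) _]big1 => [|p ep]; last first.
  by rewrite (ve _ _ ep) subrr mul0r scale0r.
rewrite scaler0 subr0 dirderivM dirderivXU !scalerA scalerDr !scalerA -addrA -scalerDl.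
by congr (_ + _ *: _); ring.
Qed.

End Strata.

End Operators.

Lemma mpoly_euler (K : comNzRingType) (n : nat) (f : mpoly n K) :
  \sum_i 'X_i * mderiv i f = \sum_(m <- msupp f) (mcoeff m f * (mdeg m)%:R) *: 'X_[m].
Proof.
rewrite {1}[f]mpolyE; under eq_bigr => i _ do rewrite raddf_sum mulr_sumr.
rewrite exchange_big; apply: eq_bigr => m _ /=.
under eq_bigr => i _ do rewrite mderivZ mderivX -scalerAr.
rewrite -scaler_sumr -scalerA; congr (_ *: _); rewrite mdegE natr_sum scaler_suml.
apply: eq_bigr => i _; rewrite -scalerAr; case: (posnP (m i)) => [->|mi].
  by rewrite !scale0r.
by rewrite -mpolyXD addmC submK //; apply/mnm_lepP => k; rewrite mnm1E; case: eqP => // <-.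
Qed.

Lemma msize_leP (K : comNzRingType) (n N : nat) (f : mpoly n K) :
  (forall m, m \in msupp f -> (mdeg m < N)%N) -> (msize f <= N)%N.
Proof. by move=> H; rewrite msizeE big_seq; apply/bigmax_leqP_seq => m _; apply: H. Qed.

Lemma msize_dirderiv (K : comNzRingType) (n N : nat) v (f : mpoly n K) :
  (msize f <= N.+1)%N -> (msize (dirderiv v f) <= N)%N.
Proof.
move=> fN; apply: msize_leP => m; rewrite mcoeff_msupp; apply: contraR; rewrite -leqNgt => Nm.
rewrite raddf_sum big1 // => j _; rewrite /= mcoeffZ mcoeff_deriv memN_msupp_eq0 ?mul0rn ?mulr0 //.
by apply: msize_mdeg_ge; rewrite (leq_trans fN) // mdegD mdeg1 addn1 ltnS.
Qed.

(** The Euler field multiplies the part of degree N by N, so the top part cancels. For a nonzero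
    polynomial [msize] is one more than the degree. *)
Lemma msize_euler (K : comNzRingType) (n N : nat) (f : mpoly n K) :
  (msize f <= N.+1)%N -> (msize (N%:R *: f - \sum_i 'X_i * mderiv i f) <= N)%N.
Proof.
move=> fN; rewrite mpoly_euler {1}[f]mpolyE scaler_sumr -sumrB.
apply: msize_leP => m; rewrite mcoeff_msupp; apply: contraR; rewrite -leqNgt => Nm.
rewrite raddf_sum big_seq big1 // => m' m'f.
rewrite /= scalerA -scalerBl mcoeffZ mcoeffX; case: eqP => [E|_]; rewrite ?mulr0 // mulr1.
have /eqP -> : mdeg m' == N.
  by rewrite eqn_leq {2}E Nm andbT -ltnS (leq_trans (msize_mdeg_lt m'f)).
by rewrite mulrC subrr.
Qed.

Lemma meval_dirderiv (K : comNzRingType) (n : nat) (p : 'rV[K]_n) (f : mpoly n K) :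
  (\sum_i 'X_i * mderiv i f).@[fun i => p 0 i] = (dirderiv p f).@[fun i => p 0 i].
Proof.
rewrite !raddf_sum; apply: eq_bigr => i _ /=.
by rewrite mevalM mevalXU mevalZ.
Qed.

Lemma meval_msym (K : numFieldType) (n : nat) (w : 'S_n) (f : mpoly n K) (p : 'I_n -> K) :
  (msym w f).@[p] = f.@[fun i => p (w i)].
Proof.
elim/mpoly_generator_ind: f => [k|f g IHf IHg|i f IH].
- by rewrite msymC !mevalC.
- by rewrite raddfD /= !mevalD IHf IHg.
by rewrite rmorphM /= msymXU !mevalM !mevalXU IH.
Qed.

(** * Strata in the support of a simple module *)

Section SimpleModule.
Variables (K : numFieldType) (n : nat) (c : K) (L : lmodType (mpoly n K)).
Local Notation Kx := (mpoly n K).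
Local Notation V := 'rV[K]_n.
Variables (T : 'S_n -> L -> L) (Y : V -> L -> L).
Hypothesis act : cherednik_action c T Y.
Variables (d : nat) (t : 'I_d -> L).
Hypothesis gen : forall u, exists P : 'I_d -> Kx, u = \sum_j P j *: t j.
Hypothesis simple : forall S : L -> Prop, S 0 -> (forall u v, S u -> S v -> S (u + v)) ->
  (forall f u, S u -> S (f *: u)) -> (forall w u, S u -> S (T w u)) ->
  (forall (v : V) u, \sum_i v 0 i = 0 -> S u -> S (Y v u)) ->
  forall u, S u -> u != 0 -> forall u', S u'.
Implicit Types (f g : Kx) (u : L) (v p : V) (w : 'S_n).
Local Notation nilp := (@nilp K n L).

Lemma nilp_local f : (forall u, exists k, f ^+ k *: u = 0) -> nilp f.
Proof.
move=> /choice[k fk]; exists (\max_j k (t j))%N => u.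
have [P ->] := gen u; rewrite scaler_sumr big1 // => j _.
rewrite scalerA mulrC -scalerA; set m := (\max_j _)%N.
have le : (k (t j) <= m)%N by apply: (@leq_bigmax _ (fun j => k (t j))).
by rewrite -(subnK le) exprD -scalerA fk !scaler0.
Qed.

(** The vectors killed by some power of f form a submodule: [T w] commutes with f, and [Y v] raises
    the exponent by one. Simplicity spreads this from u to all of [L], and finite generation makes
    the exponent uniform. *)
Lemma nilp_symmetric f u : symmetric_poly f -> u != 0 -> f *: u = 0 -> nilp f.
Proof.
move=> sf u0 fu; apply: nilp_local; apply: (simple _ _ _ _ _ _ u0).
- by exists 0%N; rewrite scaler0.
- move=> x y [k fx] [l fy]; exists (k + l)%N.
  by rewrite scalerDr exprD -[X in _ + X]scalerA fy scaler0 addr0 mulrC -scalerA fx scaler0.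
- by move=> h x [k fx]; exists k; rewrite scalerA mulrC -scalerA fx scaler0.
- move=> w x [k fx]; exists k; rewrite -(act_symmetric act) ?fx ?(actT0 act) //.
  by move=> w'; rewrite rmorphXn /= sf.
- by move=> v x v0 [k fx]; exists k.+1; apply: (actY_symmetric_exp act).
by exists 1%N; rewrite expr1.
Qed.

Section Stratum.
Variable e : rel 'I_n.
Hypothesis e_equiv : equivalence_rel e.
Hypothesis gprod_nnil : ~ nilp (gprod K e).
Hypothesis e_nil : forall i k, e i k -> nilp (('X_i - 'X_k) * gprod K e).

(** Functions that become nilpotent once g is inverted: they play the role of the ideal of the
    stratum. *)
Let nil f := nilp (gprod K e * f).

Let in_stratum p := \sum_i p 0 i = 0 /\ forall i k, e i k -> p 0 i = p 0 k.

Let nilM f g : nil f -> nil (g * f).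
Proof. by move=> nf; rewrite /nil mulrCA; apply: nilpM. Qed.

Let nil_sum (F : 'I_n -> Kx) (P : pred 'I_n) :
  (forall i, P i -> nil (F i)) -> nil (\sum_(i | P i) F i).
Proof. by move=> nF; rewrite /nil mulr_sumr; apply: nilp_sum. Qed.

Let nilD f g : nil f -> nil g -> nil (f + g).
Proof. by move=> nf ng; rewrite /nil mulrDr; apply: nilpD. Qed.

Let nilZ k f : nil f -> nil (k *: f).
Proof. by move=> nf; rewrite /nil -scalerAr; apply: nilpZ. Qed.

(** By [Dunkl_flat], g times the derivative along v is a commutator with [Dunkl v], so it preserves
    the annihilator and hence its radical. Applied to g f it also differentiates g; squaring
    isolates the term with the derivative of f. *)
Let nil_deriv v f : in_stratum v -> nil f -> nil (dirderiv v f).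
Proof.
case=> v0 ve nf; have := @nilp_derivation K n L (fun f => gprod K e * dirderiv v f) _ _ _ nf.
case=> [h h'|h hu u|k H]; first by rewrite dirderivM; ring.
  have := Dunkl_flat act h u v0 ve; rewrite !hu (Dunkl0 act) add0r => <- //.
have {k H} H : nilp (gprod K e * dirderiv v (gprod K e * f)) by exists k.
apply: (@nilp_exp _ _ _ _ 1).
have -> : (gprod K e * dirderiv v f) ^+ 2 = (dirderiv v f * (gprod K e * dirderiv v (gprod K e * f)))
  - (dirderiv v f * dirderiv v (gprod K e)) * (gprod K e * f) by rewrite dirderivM; ring.
by apply: nilpD; [apply: nilpM|apply/nilpN/nilpM].
Qed.

Let nil_diff i k : e i k -> nil ('X_i - 'X_k).
Proof. by move=> eik; rewrite /nil mulrC; apply: e_nil. Qed.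

Let nil_sumX f : nil ((\sum_i 'X_i) * f).
Proof. by exists 1%N => u; rewrite expr1 mulrCA -scalerA (act_sumX act). Qed.

Let cls i : K := #|e i|%:R.
Let avg k : V := \row_i (if e i k then (cls k)^-1 else 0).

Let e_refl i : e i i. Proof. exact: (e_equiv i i i).1. Qed.
Let e_left i j k : e i j -> e i k = e j k.
Proof. exact: (e_equiv i j k).2. Qed.
Let e_sym i j : e i j = e j i.
Proof. by apply/idP/idP => /e_left E; [rewrite -(E i)|rewrite -(E j)]. Qed.
Let cls_neq0 i : cls i != 0.
Proof. by rewrite pnatr_eq0 -lt0n; apply/card_gt0P; exists i; apply: e_refl. Qed.
Let n_neq0 (i : 'I_n) : n%:R != 0 :> K.
Proof. by rewrite pnatr_eq0 -lt0n; apply: leq_trans (ltn_ord i). Qed.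

(** Subtracting the constant vector 1 / n brings [avg k] into h; in the Euler field this correction
    is accompanied by the sum of all ['X_i], which acts by 0. *)
Let avg_stratum k : in_stratum (avg k - const_mx n%:R^-1).
Proof.
split=> [|i j eij]; last by rewrite !mxE (e_left _ eij).
transitivity (\sum_i avg k 0 i - \sum_(i < n) n%:R^-1).
  by rewrite -sumrB; apply: eq_bigr => i _; rewrite !mxE.
rewrite sumr_const card_ord -[_ *+ n]mulr_natl divff ?n_neq0 //.
under eq_bigr => i _ do rewrite mxE; rewrite -big_mkcond /= sumr_const.
rewrite (@eq_card _ _ (e k)) => [|i]; last by rewrite /in_mem /= e_sym.
by rewrite -[_ *+ _]mulr_natl divff ?subrr //; apply: cls_neq0.
Qed.

(* Up to the ideal of the stratum, the Euler field is a combination of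
   constant vector fields tangent to the stratum. *)
Let nil_euler f : nil f -> nil (\sum_i 'X_i * mderiv i f).
Proof.
move=> nf; have -> : \sum_i 'X_i * mderiv i f =
  \sum_i ('X_i - (cls i)^-1 *: \sum_(k | e i k) 'X_k) * mderiv i f +
  (\sum_k 'X_k * dirderiv (avg k - const_mx n%:R^-1) f +
  (\sum_k 'X_k) * dirderiv (const_mx n%:R^-1) f).
  have -> : \sum_k 'X_k * dirderiv (avg k - const_mx n%:R^-1) f =
      \sum_k 'X_k * dirderiv (avg k) f - (\sum_k 'X_k) * dirderiv (const_mx n%:R^-1) f.
    rewrite mulr_suml -sumrB; apply: eq_bigr => k _; rewrite -mulrBr /dirderiv -sumrB.
    by congr (_ * _); apply: eq_bigr => j _; rewrite -scalerBl !mxE.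
  rewrite subrK; under [X in _ = X + _]eq_bigr => i _ do rewrite mulrBl.
  rewrite sumrB -addrA -[LHS]addr0; congr (_ + _); apply/esym/eqP.
  rewrite addrC subr_eq0; apply/eqP.
  under eq_bigr => k _ do rewrite mulr_sumr; rewrite exchange_big; apply: eq_bigr => i _ /=.
  rewrite -scalerAl mulr_suml scaler_sumr [RHS]big_mkcond; apply: eq_bigr => k _.
  rewrite mxE; case: ifP => eik; last by rewrite scale0r mulr0.
  rewrite -scalerAr; congr (_^-1 *: _); rewrite /cls (@eq_card _ (e k) (e i)) // => j.
  by rewrite /in_mem /=; apply/esym/(e_left _ eik).
apply: nilD; last apply: nilD; last exact: nil_sumX; apply: nil_sum => i _.
  rewrite mulrC; apply: nilM.
  have -> : 'X_i - (cls i)^-1 *: \sum_(k | e i k) 'X_k =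
      (cls i)^-1 *: \sum_(k | e i k) ('X_i - 'X_k) :> Kx.
    rewrite sumrB scalerBr sumr_const -[_ *+ _]scaler_nat scalerA mulVf ?scale1r //.
  by apply/nilZ/nil_sum => k; apply: nil_diff.
by apply/nilM/nil_deriv => //; apply: avg_stratum.
Qed.

(** Induction on the degree N of f. With E the Euler field, N f - E f and the derivative of f along
    p are again in the ideal and of smaller degree, hence vanish at p; there E f equals the
    derivative along p, so N f(p) = 0. For N = 0, a nonzero constant would make g nilpotent. *)
Lemma nil_vanish f p : nilp (gprod K e * f) -> \sum_i p 0 i = 0 ->
  (forall i k, e i k -> p 0 i = p 0 k) -> f.@[fun i => p 0 i] = 0.
Proof.
move=> nf p0 pe; have pZ : in_stratum p by [].
move: nf; rewrite -/(nil f); move: {2}(msize f) (leqnn (msize f)) => N.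
elim: N f => [|N IH] f; first by rewrite leqn0 mmeasure_poly_eq0 => /eqP ->; rewrite meval0.
move=> fN nf; have nh : nil (N%:R *: f - \sum_i 'X_i * mderiv i f).
  by apply: nilD; [apply: nilZ|rewrite -scaleN1r; apply/nilZ/nil_euler].
have := IH _ (msize_euler fN) nh; rewrite mevalB mevalZ meval_dirderiv.
rewrite (IH _ (msize_dirderiv p fN)) ?subr0; last exact: nil_deriv.
move/eqP; rewrite mulf_eq0 pnatr_eq0 => /orP[/eqP N0|/eqP //].
rewrite {N IH nh}N0 in fN; rewrite (msize1_polyC fN) mevalC; apply/eqP/negPn/negP => f0.
case: gprod_nnil; have := nilZ (f@_0%MM)^-1 nf; rewrite /nil {2}(msize1_polyC fN).
by rewrite -mul_mpolyC -mpolyCM mulVf // mulr1.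
Qed.

(* Averaging f theta, with theta separating p from the rest of its orbit,
   gives a symmetric polynomial which kills u, hence is nilpotent. *)
Lemma invariant_vanish f u p : (forall w, T w u = u) -> u != 0 -> f *: u = 0 ->
  \sum_i p 0 i = 0 -> (forall i k, e i k -> p 0 i = p 0 k) -> f.@[fun i => p 0 i] = 0.
Proof.
move=> Tu u0 fu p0 pe.
pose theta : Kx := \prod_(w : 'S_n)
  if [pick i | p 0 (w i) != p 0 i] is Some i then 'X_i - (p 0 (w i))%:MP else 1.
pose F : Kx := \sum_w msym w (f * theta).
have sF : symmetric_poly F.
  move=> w; rewrite raddf_sum [RHS](reindex_inj (mulIg w)) /=.
  by apply: eq_bigr => w' _; rewrite msymMm.
have Fu : F *: u = 0.
  rewrite scaler_suml big1 // => w _; have := actTf act w^-1%g (f * theta) u.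
  by rewrite invgK Tu => <-; rewrite mulrC -scalerA fu scaler0 (actT0 act).
have := nil_vanish (nilpM _ (nilp_symmetric sF u0 Fu)) p0 pe.
rewrite /F raddf_sum /= (bigID (fun w : 'S_n => [forall i, p 0 (w i) == p 0 i])) /=.
rewrite [X in _ + X]big1 ?addr0 => [|w]; last first.
  rewrite negb_forall => /existsP[i wi]; rewrite meval_msym mevalM /theta rmorph_prod.
  rewrite (bigD1 w) //=; case: pickP => [k pk|/(_ i)]; last by rewrite wi.
  by rewrite mevalB mevalXU mevalC subrr mul0r mulr0.
rewrite (eq_bigr (fun=> (f * theta).@[fun i => p 0 i])) => [|w /forallP wp]; last first.
  by rewrite meval_msym; apply: meval_eq => i; apply/eqP.
rewrite sumr_const -mulr_natl => /eqP; rewrite mulf_eq0 pnatr_eq0 => /orP[/eqP/card0_eq/(_ 1%g)|].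
  by rewrite inE; case/negP; apply/forallP => i; rewrite perm1.
rewrite mevalM mulf_eq0 => /orP[/eqP //|]; rewrite /theta rmorph_prod prodf_seq_eq0.
case/hasP => w _ /=; case: pickP => [i pi|_]; last by rewrite rmorph1 oner_eq0.
by rewrite mevalB mevalXU mevalC subr_eq0 eq_sym (negPf pi).
Qed.

End Stratum.

(** Let S be a largest set of pairs whose product G of roots is not nilpotent, and e its complement.
    By maximality ('X_i - 'X_k) G is nilpotent when e i k; for a pair in S this would make G^2,
    hence G, nilpotent. Nilpotent functions form an ideal, whence the equivalence relation. *)
Lemma max_stratum u : u != 0 -> exists e : rel 'I_n, [/\ equivalence_rel e,
  ~ nilp (gprod K e) & forall i k, e i k -> nilp (('X_i - 'X_k) * gprod K e)].
Proof.
move=> u0; pose G (S : {set 'I_n * 'I_n}) : Kx := \prod_(p in S) ('X_(p.1) - 'X_(p.2)).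
have G0 : `[< ~ nilp (G finset.set0) >].
  apply/asboolP => -[k /(_ u)]; rewrite /G big_set0 expr1n scale1r => /eqP.
  by rewrite (negPf u0).
case: (@arg_maxnP _ finset.set0 (fun S => `[< ~ nilp (G S) >]) (fun S => #|S|) G0).
move=> S /asboolP nS maxS; pose e i k := (i, k) \notin S.
have GS : gprod K e = G S.
  by apply: eq_bigl => -[i k]; rewrite /e /= negbK.
have eP i k : reflect (nilp (('X_i - 'X_k) * G S)) (e i k).
  apply: (iffP idP) => [eik|nik]; last first.
    rewrite /e; apply/negP => ikS; apply: nS; apply: (@nilp_exp _ _ _ _ 1).
    rewrite [X in X ^+ 2](_ : G S = ('X_i - 'X_k) * \prod_(p in S | p != (i, k)) ('X_(p.1) - 'X_(p.2))).
      rewrite expr2 -mulrA; set h := \prod_(p in S | _) _.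
      have -> : ('X_i - 'X_k) * (h * (('X_i - 'X_k) * h)) = h * (('X_i - 'X_k) * G S).
        by rewrite [G S](bigD1 (i, k)) //= -/h; ring.
      exact: nilpM.
    by rewrite [LHS](bigD1 (i, k)).
  apply: contrapT => nik; have nG : ~ nilp (G ((i, k) |: S)) by rewrite /G big_setU1.
  have /= := maxS ((i, k) |: S) (asboolT nG).
  by rewrite leqNgt cardsU1 -/(e i k) eik ltnS leqnn.
exists e; rewrite GS; split=> // [i j k|i k /eP //]; split.
  by apply/eP; rewrite subrr mul0r; apply: nilp0.
have tr a b b' : e a b -> e b b' -> e a b'.
  move=> /eP ab /eP bb'; apply/eP; rewrite -(subrK 'X_b 'X_a) -addrA mulrDl.
  exact: nilpD.
have sy a b : e a b -> e b a.
  by move=> /eP ab; apply/eP; rewrite -opprB mulNr; apply: nilpN.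
by move=> eij; apply/idP/idP => [|/(tr _ _ _ eij)//]; apply/tr/sy.
Qed.

End SimpleModule.

(* If sum_w w f u = 0 for all f, then multiplying by prod_(w <> 1) (x_i - w x_i)
   (x_i not fixed by w, and the factors x_i acting before the sum) isolates
   the term of the identity. *)
Section NoInvariants.
Variables (K : numFieldType) (n : nat) (c : K) (L : lmodType (mpoly n K)).
Local Notation Kx := (mpoly n K).
Variables (T : 'S_n -> L -> L) (Y : 'rV[K]_n -> L -> L).
Hypothesis act : cherednik_action c T Y.
Hypothesis no_inv : forall u, \sum_w T w u = 0.

Let moved (w : 'S_n) : option 'I_n := [pick i | w i != i].
Let factor (w w' : 'S_n) : Kx := if moved w' is Some i then 'X_(w i) - 'X_(w' i) else 1.

Lemma sum_factor_act (s : seq 'S_n) u :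
  \sum_w (\prod_(w' <- s) factor w w') *: T w^-1%g u = 0.
Proof.
elim: s u => [|w' s IH] u.
  rewrite -[RHS](no_inv u) [RHS](reindex_inj invg_inj) /=.
  by apply: eq_bigr => w _; rewrite big_nil scale1r.
under eq_bigr => w _ do rewrite big_cons /factor.
case: (moved w') => [i|]; last by under eq_bigr => w _ do rewrite mul1r; apply: IH.
under eq_bigr => w _ do rewrite mulrBl scalerBl.
rewrite sumrB -[RHS](subrr 0); congr (_ - _).
  rewrite -[RHS](IH ('X_i *: u)); apply: eq_bigr => w _.
  by rewrite (actTf act) invgK msymXU scalerA mulrC.
rewrite -[RHS](scaler0 _ 'X_(w' i)) -[in RHS](IH u) scaler_sumr.
by apply: eq_bigr => w _; rewrite scalerA.
Qed.

Lemma no_invariants_nilp : nilp L (gprod K (fun i j : 'I_n => i == j)).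
Proof.
pose s := [seq w <- index_enum 'S_n | w != 1%g]; pose g := gprod K (fun i j : 'I_n => i == j).
(* For w' != 1 the root [factor 1 w'] joins two distinct indices, so it divides g; one factor g for
   each element of s is enough. *)
have [h hE] : exists h, g ^+ size s = h * \prod_(w' <- s) factor 1%g w'.
  elim: (s) => [|w s' [h IH]]; first by exists 1; rewrite expr0 big_nil mulr1.
  rewrite big_cons /factor /moved; case: pickP => [i wi|_]; last first.
    by exists (g * h); rewrite exprS IH mul1r mulrA.
  exists (gprodD1 K (fun i j => i == j) (i, w i) * h).
  rewrite exprS IH [g](bigD1 (i, w i)) ?perm1 /=; last by rewrite eq_sym.
  by rewrite -/(gprodD1 K (fun i j => i == j) (i, w i)) -/(moved _); ring.
exists (size s) => u; rewrite -/g hE -scalerA; have := sum_factor_act s u.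
rewrite (bigD1 1%g) //= invg1 (actT1 act) [X in _ + X]big1 ?addr0 => [->|w w1]; first by rewrite scaler0.
rewrite (big_rem w) /=; last by rewrite mem_filter w1 mem_index_enum.
rewrite /factor /moved; case: pickP => [i _|w0]; first by rewrite subrr mul0r scale0r.
by case/eqP: w1; apply/permP => i; rewrite perm1; apply/eqP/negbFE/w0.
Qed.

End NoInvariants.

(** * Finite-dimensional representations *)

Section ContentBound.
Variables (K : numClosedFieldType).

(** The form is the sum over the classes of |sum of F|^2. Summing over elements k instead of classes
    counts each class once per element, whence the weight 1 / N k. *)
Lemma equiv_hermitian_ge0 (I : finType) (E : rel I) (F : I -> K) : equivalence_rel E ->
  0 <= \sum_i \sum_(j | E i j) F i * (F j)^*.
Proof.
move=> eqE; have Er i : E i i := (eqE i i i).1; have El i j k : E i j -> E i k = E j k := (eqE i j k).2.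
have Es i j : E i j = E j i by apply/idP/idP => /El H; [rewrite -(H i)|rewrite -(H j)].
pose N k : K := #|E k|%:R.
have N0 k : N k != 0 by rewrite pnatr_eq0 -lt0n; apply/card_gt0P; exists k; apply: Er.
have -> : \sum_i \sum_(j | E i j) F i * (F j)^* =
   \sum_k (N k)^-1 * ((\sum_(i | E k i) F i) * (\sum_(i | E k i) F i)^*).
  under [RHS]eq_bigr => k _.
    rewrite rmorph_sum mulr_suml mulr_sumr.
    under eq_bigr => i ki do rewrite mulr_sumr mulr_sumr.
  over.
  rewrite [RHS](exchange_big_dep xpredT) //=; apply: eq_bigr => i _.
  rewrite [RHS](exchange_big_dep (fun j => E i j)) /=; last first.
    by move=> k j ki kj; rewrite -(El _ _ _ ki).
  apply: eq_bigr => j ij; under eq_bigl => k do rewrite -(Es i) -[E k j]Es -(El _ _ _ ij) andbb.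
  rewrite -mulr_suml (eq_bigr (fun=> (N i)^-1)) => [|k ik]; last first.
    by congr (_^-1); congr (_%:R); apply: eq_card => l; rewrite /in_mem /= -(El _ _ _ ik).
  by rewrite sumr_const -[_ *+ _]mulr_natl divff ?mul1r //; apply: N0.
apply: sumr_ge0 => k _; apply: mulr_ge0; first by rewrite invr_ge0 ler0n.
exact: mul_conjC_ge0.
Qed.

Variables (n D : nat).
Local Notation word := {ffun 'I_n -> 'I_D}.

(** A word is the exponent vector of a monomial, and also a basis vector of the n-th tensor power of
    K^D, on which the matrix units of gl_D act by replacing letters. *)
Definition word_perm (w : 'S_n) (a : word) : word := [ffun i => a (w i)].
Definition word_set (a : word) (i : 'I_n) (q : 'I_D) : word := [ffun k => if k == i then q else a k].
Definition word_degree (a : word) := (\sum_i a i)%N.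

Lemma word_permK i j : involutive (word_perm (tperm i j)).
Proof. by move=> a; apply/ffunP => k; rewrite !ffunE tpermK. Qed.

Lemma word_setK a i q : word_set (word_set a i q) i (a i) = a.
Proof. by apply/ffunP => k; rewrite !ffunE; case: eqP => [->|]. Qed.

(** Exchanging the letter at i with the spare letter is an involution. *)
Lemma sum_word_set i (G : word * 'I_D -> K) :
  \sum_x G (word_set x.1 i x.2, x.1 i) = \sum_x G x.
Proof.
rewrite [RHS](reindex_inj (h := fun x : word * 'I_D => (word_set x.1 i x.2, x.1 i))) //.
by apply: inv_inj => -[a q] /=; rewrite ffunE eqxx word_setK.
Qed.

Variable e : rel 'I_n.
Hypothesis e_equiv : equivalence_rel e.

Section Eigenvector.
Variable phi : word -> K.

(* The hermitian form of sum_(p < q) E_qp E_pq, where E_pq replaces in turn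
   each letter q by the smaller letter p. *)
Let casimir := \sum_(x : word * 'I_D) \sum_i \sum_(j | e i j && (x.1 i == x.1 j))
  ((x.1 i < x.2)%N%:R * phi (word_set x.1 i x.2)) * ((x.1 j < x.2)%N%:R * phi (word_set x.1 j x.2))^*.

Let casimir_ge0 : 0 <= casimir.
Proof.
apply: sumr_ge0 => x _; apply: (@equiv_hermitian_ge0 _ (fun i j => e i j && (x.1 i == x.1 j))
  (fun i => (x.1 i < x.2)%N%:R * phi (word_set x.1 i x.2))).
move=> i j k; rewrite (e_equiv i j k).1 eqxx; split=> // /andP[eij /eqP ->].
by rewrite ((e_equiv i j k).2 eij).
Qed.

(** The terms with i = j count, for each word, the letters below [a i], of which there are [a i],
    and add up to the degree. For i != j, replacing the letter in both places exchanges [a i] and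
    [a j], which is a transposition. *)
Let casimirE : casimir = \sum_(a : word) (word_degree a)%:R * (phi a * (phi a)^*) +
  \sum_i \sum_(j | e i j && (j != i)) \sum_(a : word | (a j < a i)%N) phi a * (phi (word_perm (tperm i j) a))^*.
Proof.
rewrite /casimir exchange_big /=.
have -> : \sum_(a : word) (word_degree a)%:R * (phi a * (phi a)^*) =
   \sum_i \sum_(a : word) (a i)%:R * (phi a * (phi a)^*).
  rewrite exchange_big /=; apply: eq_bigr => a _.
  by rewrite -mulr_suml natr_sum.
rewrite -big_split /=; apply: eq_bigr => i _.
under eq_bigr => x _ do rewrite (bigD1 i) ?(e_equiv i i i).1 ?eqxx //=.
rewrite big_split /=; congr (_ + _).
  transitivity (\sum_(x : word * 'I_D) (x.2 < x.1 i)%N%:R * (phi x.1 * (phi x.1)^*)).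
    rewrite -(sum_word_set i); apply: eq_bigr => -[a q] _ /=; rewrite ffunE eqxx.
    by case: ltnP => _ /=; rewrite ?mulr0n ?mulr1n ?mul0r // !mul1r word_setK.
  transitivity (\sum_(a : word) \sum_(q : 'I_D) (q < a i)%N%:R * (phi a * (phi a)^*)).
    by rewrite pair_bigA.
  apply: eq_bigr => a _; rewrite -mulr_suml -natr_sum; congr (_%:R * _).
  rewrite (eq_bigr (fun q : 'I_D => if (q < a i)%N then 1%N else 0%N)) => [|q _]; last by case: ifP.
  rewrite -big_mkcond -(big_ord_widen D (fun=> 1%N)) ?sum_nat_const ?card_ord ?muln1 //.
  exact: ltnW.
rewrite [LHS](exchange_big_dep (fun j => e i j && (j != i))) /=; last first.
  by move=> x j _ /andP[/andP[-> _] ->].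
apply: eq_bigr => j /andP[eij ji].
transitivity (\sum_(x : word * 'I_D | (x.2 == x.1 j) && (x.2 < x.1 i)%N)
    phi x.1 * (phi (word_set (word_set x.1 i x.2) j (x.1 i)))^*).
  rewrite big_mkcond [RHS]big_mkcond -(sum_word_set i); apply: eq_bigr => -[a q] _ /=.
  rewrite !ffunE eqxx (negPf ji) eij andbT /=; case: eqP => [aij|] //=.
  rewrite -aij; case: ltnP => _ /=; last by rewrite !mulr0n !mul0r.
  by rewrite !mulr1n !mul1r word_setK.
transitivity (\sum_(a : word) \sum_(q : 'I_D | (q == a j) && (q < a i)%N)
    phi a * (phi (word_set (word_set a i q) j (a i)))^*).
  by rewrite pair_big_dep.
rewrite [RHS]big_mkcond; apply: eq_bigr => a _.
rewrite big_mkcondl big_mkcond (bigD1 (a j)) //= eqxx big1 ?addr0 => [|q /negPf ->]; last first.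
  by case: ifP.
case: ifP => // _; congr (_ * (phi _)^*); apply/ffunP => k; rewrite !ffunE.
case: tpermP => [->|->|/eqP/negPf -> /eqP/negPf -> //].
  by rewrite eqxx eq_sym (negPf ji).
by rewrite eqxx.
Qed.

(** Let N be the squared norm of phi, U the part of the form of the reflections where [a j < a i],
    and E the part where [a i = a j]. Then s N = E + 2 U and casimir = d N + U, so (s + 2 d) N = E +
    2 casimir is nonnegative. The 2 d, in place of d, reflects ordered pairs. *)
Lemma content_lower_bound (s : K) (d : nat) :
  (forall a, \sum_i \sum_(j | e i j && (j != i)) phi (word_perm (tperm i j) a) = s * phi a) ->
  (forall a, word_degree a != d -> phi a = 0) -> (exists a, phi a != 0) ->
  0 <= s + (2 * d)%:R.
Proof.
move=> phi_eig phi_deg [a0 phi0].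
pose N := \sum_(a : word) phi a * (phi a)^*.
have N_gt0 : 0 < N.
  rewrite /N (bigD1 a0) //=; apply: ltr_pwDl; first by rewrite mul_conjC_gt0.
  by apply: sumr_ge0 => a _; apply: mul_conjC_ge0.
rewrite -(pmulr_lge0 _ N_gt0) mulrDl.
pose U := \sum_i \sum_(j | e i j && (j != i)) \sum_(a : word | (a j < a i)%N)
   phi a * (phi (word_perm (tperm i j) a))^*.
pose E := \sum_i \sum_(j | e i j && (j != i)) \sum_(a : word | a j == a i) phi a * (phi a)^*.
have cE : casimir = d%:R * N + U.
  rewrite casimirE /N mulr_sumr; congr (_ + _); apply: eq_bigr => a _.
  by case: (word_degree a =P d) => [->|/eqP/phi_deg ->]; rewrite // !mul0r !mulr0.
have sE : s * N = E + U + U.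
  have -> : s * N = \sum_i \sum_(j | e i j && (j != i)) \sum_(a : word) phi (word_perm (tperm i j) a) * (phi a)^*.
    rewrite mulr_sumr; under eq_bigr => a _ do rewrite mulrA -phi_eig mulr_suml.
    rewrite exchange_big /=; apply: eq_bigr => i _.
    by under eq_bigr => a _ do rewrite mulr_suml; rewrite exchange_big.
  have U1 : U = \sum_i \sum_(j | e i j && (j != i)) \sum_(a : word | (a i < a j)%N)
      phi (word_perm (tperm i j) a) * (phi a)^*.
    apply: eq_bigr => i _; apply: eq_bigr => j _.
    rewrite [RHS](reindex_inj (inv_inj (word_permK i j))) /=.
    by apply: eq_big => a; rewrite ?ffunE ?tpermL ?tpermR ?word_permK.
  have U2 : U = \sum_i \sum_(j | e i j && (j != i)) \sum_(a : word | (a j < a i)%N)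
      phi (word_perm (tperm i j) a) * (phi a)^*.
    rewrite U1 (exchange_big_dep xpredT) //=; apply: eq_bigr => i _.
    apply: eq_big => [j|j _]; last by rewrite tpermC.
    rewrite eq_sym; congr (_ && _); apply/idP/idP => [/(e_equiv _ _ _).2 H|/(e_equiv _ _ _).2 H].
      by rewrite -H (e_equiv j j j).1.
    by rewrite -H (e_equiv i i i).1.
  rewrite {1}U1 U2.
  rewrite -!big_split /=; apply: eq_bigr => i _; rewrite -!big_split /=; apply: eq_bigr => j _.
  rewrite (bigID (fun a : word => a j == a i)) /= -addrA; congr (_ + _).
    apply: eq_bigr => a /eqP aij; congr (phi _ * _); apply/ffunP => k; rewrite ffunE.
    by case: tpermP => [->|->|].
  rewrite (bigID (fun a : word => (a i < a j)%N)) /=; congr (_ + _); apply: eq_bigl => a.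
    by rewrite -val_eqE /=; case: ltngtP.
  by rewrite -val_eqE /=; case: ltngtP.
have -> : s * N + (2 * d)%:R * N = E + (casimir + casimir).
  by rewrite sE cE natrM; ring.
apply: addr_ge0; last by apply: addr_ge0.
apply: sumr_ge0 => i _; apply: sumr_ge0 => j _; apply: sumr_ge0 => a _.
exact: mul_conjC_ge0.
Qed.

End Eigenvector.
End ContentBound.

(** * The Euler element of the Cherednik algebra of a parabolic subgroup *)

Section LocalRelations.
Variables (K : numFieldType) (n : nat) (c : K) (A : algType K).
Variable e : rel 'I_n.
Hypothesis e_equiv : equivalence_rel e.
Variables (X Y : 'I_n -> A) (S : 'S_n -> A).
Local Notation pair := ('I_n * 'I_n)%type.
Local Notation coroot i p := (xcoroot K i p.1 p.2).
Local Notation refl p := (tperm p.1 p.2).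

Definition class_size i : K := #|e i|%:R.
(** The matrix of the orthogonal projection onto the vectors with zero sum on each class, the
    reflection representation of W'; it gives the pairing of [Y i] with [X j] there. *)
Definition proj_coef i j : K := (i == j)%:R - (if e i j then (class_size i)^-1 else 0).

Hypothesis YX : forall i j, Y i * X j - X j * Y i = (proj_coef i j)%:A -
  (c / 2) *: \sum_(p : pair | e p.1 p.2) (coroot i p * coroot j p) *: S (refl p).
Hypothesis XC : forall i j, X i * X j = X j * X i.
Hypothesis sumX : forall i, \sum_(j | e i j) X j = 0.
Hypothesis SX : forall (w : 'S_n) k, (forall i, e i (w i)) -> S w * X k = X (w^-1%g k) * S w.
Hypothesis SY : forall (w : 'S_n) k, (forall i, e i (w i)) -> S w * Y k = Y (w^-1%g k) * S w.

Definition sum_sqr := \sum_i X i * X i.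
Definition sum_sqrY := \sum_i Y i * Y i.
(** Twice the usual Euler element, so that each [X j] has weight 2. *)
Definition euler := \sum_i (X i * Y i + Y i * X i).
Definition sum_refl := \sum_(p : pair | e p.1 p.2 && (p.1 != p.2)) S (refl p).
(** The trace of the projection: n minus the number of classes, which is the rank of W'. *)
Definition corank : K := \sum_i proj_coef i i.

Lemma sum_delta (i : 'I_n) (F : 'I_n -> A) : \sum_j (j == i)%:R *: F j = F i.
Proof.
rewrite (bigD1 i) //= eqxx scale1r big1 ?addr0 // => j /negPf ->.
by rewrite scale0r.
Qed.

Lemma sum_coroot (p : pair) (F : 'I_n -> A) : \sum_j coroot j p *: F j = F p.1 - F p.2.
Proof.
rewrite -(sum_delta p.1) -(sum_delta p.2) -sumrB.
by apply: eq_bigr => j _; rewrite scalerBl.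
Qed.

Lemma class_size_eq i j : e i j -> class_size i = class_size j.
Proof. by move=> eij; congr (_%:R); apply: eq_card => k; rewrite /in_mem /= ((e_equiv i j k).2 eij). Qed.

Lemma e_symm i j : e i j = e j i.
Proof.
apply/idP/idP => [/(e_equiv _ _ _).2 H|/(e_equiv _ _ _).2 H].
  by rewrite -H (e_equiv i i i).1.
by rewrite -H (e_equiv j j j).1.
Qed.

Lemma sum_projX i : \sum_j proj_coef i j *: X j = X i.
Proof.
under eq_bigr => j _ do rewrite scalerBl eq_sym.
rewrite sumrB sum_delta -[RHS]subr0; congr (_ - _).
rewrite (bigID (e i)) /= [X in _ + X]big1 ?addr0 => [|j /negPf ->]; last by rewrite scale0r.
rewrite (eq_bigr (fun j => (class_size i)^-1 *: X j)) => [|j ->] //.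
by rewrite -scaler_sumr sumX scaler0.
Qed.

Lemma refl_preserve (p : pair) : e p.1 p.2 -> forall i, e i (refl p i).
Proof.
move=> ep i; case: tpermP => [->|->|_ _] //; last exact: (e_equiv i i i).1.
by rewrite e_symm.
Qed.

Lemma reflX_sub (p : pair) k : e p.1 p.2 ->
  S (refl p) * X k - X k * S (refl p) = - (coroot k p *: ((X p.1 - X p.2) * S (refl p))).
Proof.
move=> ep; rewrite (SX k (refl_preserve ep)) tpermV -mulrBl -scaleNr scalerAl; congr (_ * _).
rewrite /xcoroot; case: tpermP => [->|->|/eqP/negPf -> /eqP/negPf ->].
- by rewrite eqxx; case: eqP => [->|_]; rewrite ?subrr ?scaler0 // subr0 scaleN1r opprB.
- by rewrite eqxx eq_sym; case: eqP => [->|_]; rewrite ?subrr ?scaler0 // sub0r opprK scale1r.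
by rewrite !subrr oppr0 scale0r.
Qed.

Lemma refl_anticomm (p : pair) : e p.1 p.2 ->
  S (refl p) * (X p.1 - X p.2) + (X p.1 - X p.2) * S (refl p) = 0.
Proof.
move=> ep; rewrite mulrBr !(SX _ (refl_preserve ep)) tpermV tpermL tpermR.
by rewrite -mulrBl -mulrDl addrA subrK subrr mul0r.
Qed.

(** The reflection terms pair each reflection with its own root, and the two anticommute. *)
Lemma comm_Y_sum_sqr i : Y i * sum_sqr - sum_sqr * Y i = 2 *: X i.
Proof.
have -> : Y i * sum_sqr - sum_sqr * Y i =
    \sum_j ((Y i * X j - X j * Y i) * X j + X j * (Y i * X j - X j * Y i)).
  rewrite mulr_sumr mulr_suml -sumrB; apply: eq_bigr => j _.
  by rewrite mulrBl mulrBr !mulrA addrA subrK.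
have -> : 2 *: X i = \sum_j ((proj_coef i j)%:A * X j + X j * (proj_coef i j)%:A) :> A.
  rewrite big_split /= -[X i]sum_projX scaler_nat mulr2n; congr (_ + _); apply: eq_bigr => j _.
    by rewrite -scalerAl mul1r.
  by rewrite -scalerAr mulr1.
under eq_bigr => j _ do rewrite YX mulrBl mulrBr addrACA -opprD.
rewrite sumrB -[RHS]subr0; congr (_ - _).
transitivity ((c / 2) *: \sum_(p : pair | e p.1 p.2) coroot i p *:
   (S (refl p) * (X p.1 - X p.2) + (X p.1 - X p.2) * S (refl p))); last first.
  by rewrite big1 ?scaler0 // => p /refl_anticomm ->; rewrite scaler0.
under eq_bigr => j _ do rewrite -scalerAl -scalerAr -scalerDr mulr_suml mulr_sumr -big_split.
rewrite -scaler_sumr exchange_big; congr (_ *: _); apply: eq_bigr => p _ /=.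
rewrite -(sum_coroot p X) mulr_sumr mulr_suml -big_split scaler_sumr; apply: eq_bigr => j _ /=.
by rewrite -!scalerAl -!scalerAr -!scalerDr scalerA.
Qed.

(** One bracket of an sl_2 triple; it exhibits [euler] as a commutator. *)
Lemma comm_sl2 : sum_sqrY * sum_sqr - sum_sqr * sum_sqrY = 2 *: euler.
Proof.
rewrite mulr_suml mulr_sumr -sumrB scaler_sumr; apply: eq_bigr => i _.
transitivity (Y i * (Y i * sum_sqr - sum_sqr * Y i) + (Y i * sum_sqr - sum_sqr * Y i) * Y i).
  by rewrite mulrBl mulrBr !mulrA addrA subrK.
by rewrite comm_Y_sum_sqr -scalerAl -scalerAr -scalerDr addrC.
Qed.

(** A coroot has squared length 2, which absorbs the denominator of c / 2. *)
Lemma sum_commYX : \sum_i (Y i * X i - X i * Y i) = corank%:A - c *: sum_refl.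
Proof.
under eq_bigr => i _ do rewrite YX.
rewrite sumrB -scaler_suml; congr (_ - _); rewrite -scaler_sumr exchange_big /=.
rewrite scaler_sumr [sum_refl]big_mkcondr /= scaler_sumr; apply: eq_bigr => p ep.
rewrite -scaler_suml scalerA.
have -> : \sum_i coroot i p * coroot i p = if p.1 != p.2 then 2 else 0 :> K.
  rewrite /xcoroot (bigD1 p.1) //= eqxx; case: eqP => [<-|/eqP p12] /=.
    by rewrite subrr mul0r add0r big1 // => i /negPf ->; rewrite subrr mul0r.
  have p21 : p.2 != p.1 by rewrite eq_sym.
  rewrite subr0 mulr1 (bigD1 p.2) //= eqxx (negPf p21).
  rewrite sub0r mulrNN mulr1 big1 ?addr0 // => i /andP[/negPf -> /negPf ->].
  by rewrite subrr mul0r.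
case: ifP => _; last by rewrite mulr0 scale0r scaler0.
by rewrite mulfVK // pnatr_eq0.
Qed.

Lemma euler_XY : euler = 2 *: (\sum_i X i * Y i) + (corank%:A - c *: sum_refl).
Proof.
rewrite -sum_commYX sumrB scaler_nat mulr2n -addrA [X in _ = _ + X]addrC subrK.
by rewrite -big_split.
Qed.

Lemma euler_YX : euler = 2 *: (\sum_i Y i * X i) - (corank%:A - c *: sum_refl).
Proof.
rewrite -sum_commYX sumrB scaler_nat mulr2n opprB [RHS]addrC addrA subrK.
by rewrite -big_split.
Qed.

(** The reflections in the commutator of the sum of the X_i Y_i with [X j] cancel against those in
    the commutator of [sum_refl] with [X j]. *)
Lemma comm_euler_X j : euler * X j - X j * euler = 2 *: X j.
Proof.
have proj_symm i : proj_coef i j = proj_coef j i.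
  rewrite /proj_coef eq_sym e_symm; congr (_ - _); case: ifP => // eji.
  by rewrite (class_size_eq eji).
have comm1 : (\sum_i X i * Y i) * X j - X j * (\sum_i X i * Y i) =
   X j - (c / 2) *: \sum_(p : pair | e p.1 p.2) coroot j p *: ((X p.1 - X p.2) * S (refl p)).
  have -> : (\sum_i X i * Y i) * X j - X j * (\sum_i X i * Y i) =
     \sum_i X i * (Y i * X j - X j * Y i) + \sum_i (X i * X j - X j * X i) * Y i.
    rewrite mulr_suml mulr_sumr -sumrB -big_split; apply: eq_bigr => i _ /=.
    by rewrite mulrBr mulrBl !mulrA addrA subrK.
  rewrite [X in _ + X]big1 ?addr0 => [|i _]; last by rewrite XC subrr mul0r.
  under eq_bigr => i _ do rewrite YX mulrBr -scalerAr mulr1 proj_symm.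
  rewrite sumrB sum_projX; congr (_ - _).
  under eq_bigr => i _ do rewrite -scalerAr mulr_sumr.
  rewrite -scaler_sumr exchange_big; congr (_ *: _); apply: eq_bigr => p _ /=.
  rewrite -(sum_coroot p X) mulr_suml scaler_sumr; apply: eq_bigr => i _.
  by rewrite -scalerAr -scalerAl scalerA mulrC.
have comm2 : sum_refl * X j - X j * sum_refl =
   - \sum_(p : pair | e p.1 p.2) coroot j p *: ((X p.1 - X p.2) * S (refl p)).
  rewrite mulr_suml mulr_sumr -sumrB -sumrN big_mkcondr; apply: eq_bigr => p ep /=.
  rewrite reflX_sub //; case: eqP => [->|] //=.
  by rewrite subrr mul0r scaler0 oppr0.
rewrite euler_XY mulrDl mulrDr mulrBl mulrBr -!scalerAl -!scalerAr mulr1 mul1r.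
set a := \sum_i X i * Y i in comm1 *; set b := \sum_(p | _) _ in comm1 comm2.
transitivity (2 *: (a * X j - X j * a) - c *: (sum_refl * X j - X j * sum_refl)).
  rewrite !scalerBr opprD addrACA; congr (_ + _).
  by rewrite opprB addrC addrA subrK opprB.
by rewrite comm1 comm2 scalerBr scalerA mulrCA divff ?pnatr_eq0 // mulr1 scalerN opprK subrK.
Qed.

Lemma stab_comm_sum (w : 'S_n) (Z Z' : 'I_n -> A) :
  (forall k, S w * Z k = Z (w^-1%g k) * S w) -> (forall k, S w * Z' k = Z' (w^-1%g k) * S w) ->
  S w * (\sum_i Z i * Z' i) = (\sum_i Z i * Z' i) * S w.
Proof.
move=> wZ wZ'; rewrite mulr_sumr mulr_suml [RHS](reindex_inj (@perm_inj _ w^-1%g)) /=.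
by apply: eq_bigr => i _; rewrite mulrA wZ -mulrA wZ' mulrA.
Qed.

Lemma stab_comm_sum_sqr (w : 'S_n) : (forall i, e i (w i)) -> S w * sum_sqr = sum_sqr * S w.
Proof. by move=> ew; apply: stab_comm_sum => k; apply: SX. Qed.

Lemma stab_comm_euler (w : 'S_n) : (forall i, e i (w i)) -> S w * euler = euler * S w.
Proof.
move=> ew; rewrite /euler big_split mulrDl mulrDr; congr (_ + _).
  by apply: stab_comm_sum => k; [apply: SX|apply: SY].
by apply: stab_comm_sum => k; [apply: SY|apply: SX].
Qed.

End LocalRelations.

Lemma trace_le0 (K : numClosedFieldType) (r : nat) (B : 'M[K]_r.+1) :
  (forall a, eigenvalue B a -> a <= 0) -> \tr B <= 0.
Proof.
move=> neg; have [s sE] := closed_field_poly_normal (char_poly B).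
rewrite (monicP (char_poly_monic B)) scale1r in sE.
have szs : size s = r.+1.
  by apply: succn_inj; rewrite -(size_char_poly B) sE size_prod_XsubC.
have := char_poly_trace B (ltn0Sn r).
rewrite sE -{1}szs coefPn_prod_XsubC ?szs // => /oppr_inj <-.
rewrite big_seq; apply: sumr_le0 => a sa; apply: neg.
by rewrite eigenvalue_root_char sE root_prod_XsubC.
Qed.

(** Factor P = C R through its rank: idempotence forces R C = 1, and C R and R C have the same
    trace. *)
Lemma trace_idempotent (K : fieldType) (r : nat) (P : 'M[K]_r) :
  P *m P = P -> \tr P = (\rank P)%:R.
Proof.
move=> PP; move: (col_base P) (row_base P) (col_base_full P) (row_base_free P) (mulmx_base P).
move=> C R fC fR CR; rewrite -{1}CR mxtrace_mulC.
have -> : R *m C = 1%:M; last by rewrite mxtrace1.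
apply: (row_full_inj fC); apply: (row_free_inj fR).
by rewrite mulmx1 !mulmxA CR -mulmxA CR PP.
Qed.

Section ClassStabiliser.
Variables (n : nat) (e : rel 'I_n).
Hypothesis e_equiv : equivalence_rel e.

Definition stab (w : 'S_n) := [forall i, e i (w i)].

Lemma stab1 : stab 1%g.
Proof. by apply/forallP => i; rewrite perm1 (e_equiv i i i).1. Qed.

Lemma stabM w w' : stab w -> stab w' -> stab (w * w')%g.
Proof.
move=> /forallP sw /forallP sw'; apply/forallP => i; rewrite permM.
by rewrite ((e_equiv i (w i) _).2 (sw i)).
Qed.

Lemma stabV w : stab w -> stab w^-1%g.
Proof.
move=> /forallP sw; apply/forallP => i; rewrite (e_symm e_equiv).
by have := sw (w^-1%g i); rewrite permKV.
Qed.

End ClassStabiliser.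

(** * Vanishing of the invariants in finite dimension *)

Section FiniteDimensional.
Variables (K : numClosedFieldType) (n : nat) (c : K) (r : nat).
Local Notation A := 'M[K]_r.+1.
Variable e : rel 'I_n.
Hypothesis e_equiv : equivalence_rel e.
Variables (X Y : 'I_n -> A) (S : 'S_n -> A).
Local Notation stab := (stab e).

Hypothesis c_gtN1 : - 1 < c.
Hypothesis c_lt0 : c < 0.
Hypothesis XC : forall i j, X i * X j = X j * X i.
Hypothesis YX : forall i j, Y i * X j - X j * Y i = (proj_coef K e i j)%:A -
  (c / 2) *: \sum_(p : 'I_n * 'I_n | e p.1 p.2)
     (xcoroot K i p.1 p.2 * xcoroot K j p.1 p.2) *: S (tperm p.1 p.2).
Hypothesis sumX : forall i, \sum_(j | e i j) X j = 0.
Hypothesis SX : forall (w : 'S_n) k, (forall i, e i (w i)) -> S w * X k = X (w^-1%g k) * S w.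
Hypothesis SY : forall (w : 'S_n) k, (forall i, e i (w i)) -> S w * Y k = Y (w^-1%g k) * S w.
Hypothesis SM : forall w w', stab w -> stab w' -> S (w * w')%g = S w * S w'.
Variable N : nat.
Hypothesis X_nil : forall s : seq 'I_n, size s = N -> \prod_(i <- s) X i = 0.
Hypothesis e_nontrivial : exists i j, e i j && (i != j).

Definition stab_avg : A := (#|[set w | stab w]|%:R)^-1 *: \sum_(w | stab w) S w.

Let card_stab : #|[set w | stab w]|%:R != 0 :> K.
Proof. by rewrite pnatr_eq0 -lt0n; apply/card_gt0P; exists 1%g; rewrite inE (stab1 e_equiv). Qed.

Let S_avg w : stab w -> S w * stab_avg = stab_avg.
Proof.
move=> sw; rewrite -scalerAr mulr_sumr; congr (_ *: _).
rewrite [RHS](reindex_inj (mulgI w)) /=; apply: eq_big => [w'|w' sw'].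
  apply/idP/idP => [|sww']; first exact: (stabM e_equiv).
  by rewrite -(mulKg w w'); apply: (stabM e_equiv) => //; apply: (stabV e_equiv).
by rewrite SM.
Qed.

Let avg_idem : stab_avg * stab_avg = stab_avg.
Proof.
rewrite {1}/stab_avg -scalerAl mulr_suml (eq_bigr (fun=> stab_avg)) => [|w]; last exact: S_avg.
by rewrite sumr_const -scaler_nat scalerA cardsE mulVf ?scale1r // -cardsE.
Qed.

Let avg_comm (Z : A) : (forall w : 'S_n, (forall i, e i (w i)) -> S w * Z = Z * S w) ->
  stab_avg * Z = Z * stab_avg.
Proof.
move=> SZ; rewrite -scalerAl -scalerAr mulr_sumr mulr_suml; congr (_ *: _).
by apply: eq_bigr => w /forallP sw; apply: SZ.
Qed.

Let H := euler X Y.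
Let kappa := corank K e.

(** The average commutes with [sum_sqr X], so its product with the commutator giving [euler] is
    again a commutator. *)
Let trace_avg_euler : \tr (stab_avg * H) = 0.
Proof.
have E := comm_sl2 e_equiv YX sumX SX.
have cE : stab_avg * sum_sqr X = sum_sqr X * stab_avg.
  by apply: avg_comm => w ew; apply: (stab_comm_sum_sqr SX).
have /eqP : 2 * \tr (stab_avg * H) = 0.
  rewrite -mxtraceZ scalerAr -E mulrBr linearB /=.
  by rewrite [X in _ - \tr X]mulrA cE mulrA -[X in _ - \tr X]mulrA [X in _ - X]mxtrace_mulC subrr.
by rewrite mulf_eq0 pnatr_eq0 => /eqP.
Qed.

Let proj_ge0 i : 0 <= proj_coef K e i i.
Proof.
rewrite /proj_coef eqxx (e_equiv i i i).1 subr_ge0 invf_le1 ?ler1n ?ltr0n //;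
  by apply/card_gt0P; exists i; apply: (e_equiv i i i).1.
Qed.

Let kappa_gt0 : 0 < kappa.
Proof.
have [i [j /andP[eij ij]]] := e_nontrivial.
rewrite /kappa /corank (bigD1 i) //=; apply: ltr_pwDl; last by apply: sumr_ge0 => k _; apply: proj_ge0.
rewrite /proj_coef eqxx (e_equiv i i i).1 subr_gt0.
have lt1 : (1 < #|e i|)%N.
  rewrite (cardD1 i) (cardD1 j) !inE /in_mem /= (e_equiv i i i).1 eij eq_sym ij.
  by [].
by rewrite invf_lt1 ?ltr1n ?ltr0n // (ltn_trans _ lt1).
Qed.

Let mon (s : seq 'I_n) : A := \prod_(i <- s) X i.

Let mon_cat s s' : mon (s ++ s') = mon s * mon s'.
Proof. by rewrite /mon big_cat. Qed.

Let mon_comm s s' : mon s * mon s' = mon s' * mon s.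
Proof.
have X_mon i s1 : X i * mon s1 = mon s1 * X i.
  elim: s1 => [|j s1 IH]; first by rewrite /mon big_nil mulr1 mul1r.
  by rewrite /mon big_cons mulrA XC -!mulrA -/(mon s1) IH.
elim: s => [|i s IH]; first by rewrite /mon big_nil mulr1 mul1r.
by rewrite /mon big_cons -/(mon s) -mulrA IH mulrA X_mon mulrA.
Qed.

Let mon_perm s s' : perm_eq s s' -> mon s = mon s'.
Proof.
move=> ss'; apply: (catCA_perm_ind _ ss' (P := fun s1 => mon s = mon s1)) => // s1 s2 s3 ->.
by rewrite !mon_cat !mulrA mon_comm.
Qed.

Let S_mon (w : 'S_n) s : (forall i, e i (w i)) -> S w * mon s = mon (map w^-1%g s) * S w.
Proof.
move=> ew; elim: s => [|i s IH]; first by rewrite /mon !big_nil mulr1 mul1r.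
by rewrite /mon /= !big_cons -/(mon s) mulrA SX // -mulrA IH mulrA.
Qed.

Let euler_mon s : H * mon s = mon s * H + (2 * (size s)%:R) *: mon s.
Proof.
elim: s => [|i s IH]; first by rewrite /mon big_nil mulr1 mul1r mulr0 scale0r addr0.
have := comm_euler_X e_equiv YX XC sumX SX i; move/eqP; rewrite subr_eq => /eqP E.
rewrite /mon big_cons -/(mon s) mulrA E mulrDl -!mulrA IH mulrDr -scalerAl -scalerAr mulrA.
by rewrite addrCA -scalerDl; congr (_ + _ *: _); rewrite /= -[(size s).+1]add1n natrD; ring.
Qed.

Let letters d (a : {ffun 'I_n -> 'I_d}) := flatten [seq nseq (a i) i | i <- enum 'I_n].

Let count_letters d (a : {ffun 'I_n -> 'I_d}) i : count_mem i (letters a) = a i.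
Proof.
rewrite count_flatten -map_comp sumnE big_map big_enum /= (bigD1 i) //= count_nseq /= eqxx mul1n.
by rewrite big1 ?addn0 // => j /negPf ji; rewrite count_nseq /= ji.
Qed.

Let perm_letters d (a a' : {ffun 'I_n -> 'I_d}) (w : 'S_n) : (forall i, a' i = a (w i) :> nat) ->
  perm_eq (map w^-1%g (letters a)) (letters a').
Proof.
move=> aa'; apply/allP => i _ /=; rewrite count_map count_letters aa'.
rewrite -(count_letters a); apply/eqP/eq_count => j /=.
by rewrite -(inj_eq (@perm_inj _ w)) permKV.
Qed.

Let size_letters d (a : {ffun 'I_n -> 'I_d}) : size (letters a) = word_degree a.
Proof.
rewrite size_flatten /shape -map_comp sumnE big_map big_enum /=.
by apply: eq_bigr => i _; rewrite size_nseq.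
Qed.

(** Let d be the largest degree in which some monomial does not kill v. Every [X i] kills the
    vectors X^b v of degree d, so [euler] reduces there to -kappa + c [sum_refl], while its
    eigenvalue is a + 2 d. Thus [sum_refl] acts by s = (a + 2 d + kappa) / c, and s >= -2 d with c <
    0 gives a + kappa <= -2 d (1 + c). *)
Let euler_bound (v : 'cV[K]_r.+1) a : v != 0 -> stab_avg *m v = v -> H *m v = a *: v ->
  a <= - kappa.
Proof.
move=> v0 Pv Hv.
have Sv w : stab w -> S w *m v = v by move=> sw; rewrite -Pv mulmxA -[S w *m _]/(S w * _) S_avg.
pose kill d := `[< forall s : seq 'I_n, size s = d -> mon s *m v = 0 >].
have exk : exists d, kill d by exists N; apply/asboolP => s sN; rewrite /mon X_nil // mul0mx.
(* The least degree in which all monomials kill v is d + 1; it is not 0, since the empty monomial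
   fixes v. *)
case: (ex_minnP exk) => -[|d] /asboolP kd mind.
  by have := kd [::] erefl; rewrite /mon big_nil mul1mx => v0'; rewrite v0' eqxx in v0.
have [s0 s0d ms0] : exists2 s : seq 'I_n, size s = d & mon s *m v != 0.
  apply: contrapT => nex; have := mind d; rewrite ltnn => H0; suff: false by []; apply: H0.
  apply/asboolP => s sd; apply/eqP/negPn/negP => ms.
  by apply: nex; exists s.
have [j0 mj0] : exists j, (mon s0 *m v) j 0 != 0.
  apply: contrapT => nex; case/eqP: ms0; apply/colP => j; rewrite [RHS]mxE; apply/eqP/negPn/negP => nz.
  by apply: nex; exists j.
have refl_sum s : size s = d ->
    c *: (sum_refl e S *m (mon s *m v)) = (a + 2 * d%:R + kappa) *: (mon s *m v).
  move=> sd; have E1 : H *m (mon s *m v) = (a + 2 * d%:R) *: (mon s *m v).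
    rewrite mulmxA -[H *m mon s]/(H * mon s) euler_mon mulmxDl -mulmxA Hv sd.
    by rewrite -scalemxAr -scalemxAl -scalerDl.
  have : H *m (mon s *m v) = - (kappa *: (mon s *m v)) + c *: (sum_refl e S *m (mon s *m v)).
    rewrite {1}/H (euler_YX YX) mulmxBl -scalemxAl mulmx_suml big1 => [|i _]; last first.
      rewrite -[Y i * X i]/(Y i *m X i) -!mulmxA [X i *m _]mulmxA.
      rewrite -[X i *m mon s]/(X i * mon s); have := kd (i :: s); rewrite /mon big_cons /= sd.
      by move=> ->; rewrite ?mulmx0.
    by rewrite scaler0 sub0r mulmxBl opprB -!scalemxAl mul1mx addrC.
  by move=> E2; rewrite scalerDl -E1 E2 addrAC addNr add0r.
(* A coordinate j0 at which some X^b v of degree d is nonzero turns these vectors into a scalar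
   function of the exponents. The exponents are at most d, hence the alphabet ['I_d.+1]. *)
pose phi (b : {ffun 'I_n -> 'I_d.+1}) : K :=
  if word_degree b == d then (mon (letters b) *m v) j0 0 else 0.
have deg_perm b (w : 'S_n) : word_degree (word_perm w b) = word_degree b.
  rewrite /word_degree [RHS](reindex_inj (@perm_inj _ w)) /=.
  by apply: eq_bigr => i _; rewrite ffunE.
have phi_eig b : \sum_i \sum_(j | e i j && (j != i)) phi (word_perm (tperm i j) b) =
    ((a + 2 * d%:R + kappa) / c) * phi b.
  have nc : c != 0 by rewrite lt_eqF.
  rewrite /phi; case: (word_degree b =P d) => [bd|/eqP bd]; last first.
    rewrite mulr0 big1 // => i _; rewrite big1 // => j _.
    by rewrite deg_perm (negPf bd).
  have E : c * (sum_refl e S *m (mon (letters b) *m v)) j0 0 =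
      (a + 2 * d%:R + kappa) * (mon (letters b) *m v) j0 0.
    have szb : size (letters b) = d by rewrite size_letters.
    by have := congr1 (fun M : 'cV_r.+1 => M j0 0) (refl_sum _ szb); rewrite [LHS]mxE [RHS]mxE.
  rewrite mulrAC -E mulrAC divff // mul1r {E}.
  rewrite /sum_refl mulmx_suml summxE pair_big_dep /=.
  apply: eq_big => [p|p /andP[ep _]]; first by rewrite [p.2 == _]eq_sym.
  rewrite deg_perm bd eqxx mulmxA -[S _ *m mon _]/(S _ * mon _) S_mon; last first.
    exact: (refl_preserve e_equiv ep).
  rewrite -mulmxA Sv; last by apply/forallP; apply: (refl_preserve e_equiv ep).
  congr ((_ *m v) j0 0); apply/esym/mon_perm/perm_letters => i.
  by rewrite ffunE.
have phi_deg b : word_degree b != d -> phi b = 0 by rewrite /phi => /negPf ->.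
have exphi : exists b, phi b != 0.
  pose b : {ffun 'I_n -> 'I_d.+1} := [ffun i => inord (count_mem i s0)].
  have bE i : b i = count_mem i s0 :> nat.
    by rewrite ffunE inordK // ltnS -s0d count_size.
  have s0b : perm_eq s0 (letters b).
    by apply/allP => i _ /=; rewrite count_letters bE.
  by exists b; rewrite /phi -size_letters -(perm_size s0b) s0d eqxx -(mon_perm s0b).
have := content_lower_bound e_equiv phi_eig phi_deg exphi.
rewrite -(nmulr_lle0 _ c_lt0) mulrDl divfK ?lt_eqF // natrM => le0.
have : a + kappa + 2 * d%:R * (1 + c) <= 0 by apply: le_trans le0; rewrite le_eqVlt; apply/orP; left; apply/eqP; ring.
have pos : 0 <= 2 * d%:R * (1 + c).
  by rewrite !mulr_ge0 ?ler0n // -(opprK 1) addrC subr_ge0 ltW.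
by move=> le; rewrite -subr_le0 opprK; apply: le_trans le; rewrite lerDl.
Qed.

(** The trace of [stab_avg] (euler + kappa) is kappa times the rank of [stab_avg]. A nonzero
    eigenvalue of this product has an invariant eigenvector, so [euler_bound] makes it at most 0. As
    kappa > 0, the rank is 0. *)
Lemma no_invariants_fd : stab_avg = 0.
Proof.
have avg_euler : stab_avg * H = H * stab_avg.
  by apply: avg_comm => w ew; apply: (stab_comm_euler SX SY ew).
have tr : \tr (stab_avg * (H + kappa%:A)) = kappa * \tr stab_avg.
  by rewrite mulrDr linearD /= trace_avg_euler add0r -scalerAr mulr1 mxtraceZ.
have le0 : kappa * \tr stab_avg <= 0.
  rewrite -tr -mxtrace_tr; apply: trace_le0 => a /eigenvalueP[u uE u0].
  have vE : (stab_avg * (H + kappa%:A)) *m u^T = a *: u^T.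
    by rewrite -[LHS]trmxK trmx_mul trmxK uE linearZ.
  have [->//|a0] := eqVneq a 0.
  have Pv : stab_avg *m u^T = u^T.
    apply: (scalerI a0); rewrite scalemxAr -vE mulmxA.
    by rewrite -[stab_avg *m _]/(stab_avg * _) mulrA avg_idem.
  have : H *m u^T = (a - kappa) *: u^T.
    rewrite scalerBl -vE mulrDr mulmxDl avg_euler -[H * _]/(H *m _) -mulmxA Pv.
    by rewrite -scalerAr mulr1 -scalemxAl Pv addrK.
  move/euler_bound; rewrite trmx_eq0 => /(_ u0 Pv).
  by rewrite lerBlDr addNr.
have := trace_idempotent avg_idem; move: le0; rewrite pmulr_rle0 // => le0 rk.
by apply/eqP; rewrite -mxrank_eq0 -(lern0 K) -rk.
Qed.

End FiniteDimensional.

(** * Localization along a stratum *)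

Section StratumOperators.
Variables (K : numFieldType) (n : nat) (c : K) (L : lmodType (mpoly n K)).
Local Notation Kx := (mpoly n K).
Local Notation V := 'rV[K]_n.
Variables (T : 'S_n -> L -> L) (Y : V -> L -> L).
Hypothesis act : cherednik_action c T Y.
Variable e : rel 'I_n.
Hypothesis e_equiv : equivalence_rel e.
Implicit Types (f : Kx) (u l : L) (v : V) (w : 'S_n).
Local Notation g := (gprod K e).
Local Notation D := (Dunkl c T Y e).

Definition stab_inv f := forall w, stab e w -> msym w f = f.

(** A coordinate along the stratum, whereas ['X_i - block_avg i] is transverse to it. *)
Definition block_avg i : Kx := (class_size K e i)^-1 *: \sum_(k | e i k) 'X_k.
(** The projection of the i-th basis vector to the reflection representation of W': a direction
    transverse to the stratum. *)
Definition proj_vec i : V := \row_j proj_coef K e i j.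

Lemma class_size_neq0 i : class_size K e i != 0.
Proof. by rewrite pnatr_eq0 -lt0n; apply/card_gt0P; exists i; apply: (e_equiv i i i).1. Qed.

Lemma stab_e w : stab e w -> forall i, e i (w i).
Proof. by move/forallP. Qed.

Lemma stab_e2 w i j : stab e w -> e (w i) (w j) = e i j.
Proof.
move=> /forallP sw; rewrite -((e_equiv _ _ (w j)).2 (sw i)) !(e_symm e_equiv i).
by rewrite ((e_equiv _ _ i).2 (sw j)).
Qed.

Lemma stab_refl i j : e i j -> stab e (tperm i j).
Proof. by move=> eij; apply/forallP; apply: (@refl_preserve _ e e_equiv (i, j)). Qed.

Lemma stab_inv_gprod : stab_inv g.
Proof.
move=> w sw; rewrite /gprod rmorph_prod /=.
rewrite [RHS](reindex_inj (h := fun p : 'I_n * 'I_n => (w p.1, w p.2))) /=; last first.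
  by move=> [i j] [i' j'] [/perm_inj -> /perm_inj ->].
apply: eq_big => [p|p _]; first by rewrite stab_e2.
by rewrite rmorphB /= !msymXU.
Qed.

Lemma stab_invM f f' : stab_inv f -> stab_inv f' -> stab_inv (f * f').
Proof. by move=> sf sf' w sw; rewrite rmorphM /= sf ?sf'. Qed.

Lemma stab_invX f k : stab_inv f -> stab_inv (f ^+ k).
Proof. by move=> sf w sw; rewrite rmorphXn /= sf. Qed.

Lemma stab_invC k : stab_inv k%:MP.
Proof. by move=> w _; rewrite msymC. Qed.

Lemma stab_invD f f' : stab_inv f -> stab_inv f' -> stab_inv (f + f').
Proof. by move=> sf sf' w sw; rewrite rmorphD /= sf ?sf'. Qed.

Lemma block_avg_eq i j : e i j -> block_avg i = block_avg j.
Proof.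
move=> eij; rewrite /block_avg (class_size_eq K e_equiv eij); congr (_ *: _).
by apply: eq_bigl => k; rewrite ((e_equiv i j k).2 eij).
Qed.

Lemma stab_inv_block_avg i : stab_inv (block_avg i).
Proof.
move=> w sw; rewrite /block_avg msymZ [msym w _]raddf_sum /=; congr (_ *: _).
rewrite [RHS](reindex_inj (@perm_inj _ w)) /=; apply: eq_big => [k|k _]; last by rewrite msymXU.
by rewrite !(e_symm e_equiv i) ((e_equiv _ _ i).2 (stab_e sw k)).
Qed.

Lemma actT_stab f w u : stab_inv f -> stab e w -> T w (f *: u) = f *: T w u.
Proof. by move=> sf sw; rewrite (actTf act) sf // (stabV e_equiv). Qed.

Lemma Dunkl_equivariant v w u : \sum_i v 0 i = 0 -> stab e w ->
  T w (D v u) = D (col_perm w v) (T w u).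
Proof.
move=> v0 sw; rewrite /Dunkl -scaleN1r -mpolyC1 -mpolyCN scalerA -mpolyCM.
rewrite -[- (_ *: _) in RHS]scaleN1r -mpolyC1 -mpolyCN [in RHS]scalerA -mpolyCM.
rewrite (actTD act) (actT_stab _ stab_inv_gprod) // (actTY act) //; congr (_ + _).
rewrite (actT_stab _ (stab_invC _)) //; congr (_ *: _); rewrite (actT_sum act).
rewrite [RHS](reindex_inj (h := fun p : 'I_n * 'I_n => (w^-1%g p.1, w^-1%g p.2))) /=; last first.
  by move=> [i j] [i' j'] [/perm_inj -> /perm_inj ->].
have svw := stabV e_equiv sw.
apply: eq_big => [p|[i j] eij /=]; first by rewrite stab_e2.
rewrite !mxE !permKV (actTf act) -!(actTM act) rmorphM /= msymC.
have -> : msym w^-1 (gprodD1 K e (i, j)) = gprodD1 K e (w^-1%g i, w^-1%g j).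
  rewrite /gprodD1 rmorph_prod /=.
  rewrite [RHS](reindex_inj (h := fun p : 'I_n * 'I_n => (w^-1%g p.1, w^-1%g p.2))) /=; last first.
    by move=> [k l] [k' l'] [/perm_inj -> /perm_inj ->].
  apply: eq_big => [[k l]|p _]; first by rewrite stab_e2 //= !xpair_eqE !(inj_eq perm_inj).
  by rewrite rmorphB /= !msymXU.
congr (_ *: T _ u); apply/permP => k; rewrite !permM.
case: (tpermP i j (w k)) => [wk|wk|/eqP/negPf wi /eqP/negPf wj].
- by rewrite -[k](permK w) wk tpermL permKV.
- by rewrite -[k](permK w) wk tpermR permKV.
by rewrite tpermD // eq_sym -(inj_eq (@perm_inj _ w)) permKV ?wi ?wj.
Qed.

Lemma sum_class_proj_coef i j : \sum_(k | e j k) proj_coef K e i k = 0.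
Proof.
rewrite sumrB; case eij : (e j i); last first.
  rewrite big1 ?sub0r => [|k ejk]; last first.
    by case: eqP => // eik; rewrite eik ejk in eij.
  rewrite big1 ?oppr0 // => k ejk; case: ifP => // eik.
  by rewrite ((e_equiv j k i).2 ejk) (e_symm e_equiv) eik in eij.
rewrite (bigD1 i) //= eqxx big1 ?addr0 => [|k /andP[_ /negPf ki]]; last by rewrite eq_sym ki.
rewrite (eq_bigr (fun=> (class_size K e i)^-1)) => [|k ejk]; last first.
  by rewrite -((e_equiv j i k).2 eij) ejk.
rewrite sumr_const -(class_size_eq K e_equiv eij); apply/eqP; rewrite subr_eq0 eq_sym.
by rewrite -[X in X == _]mulr_natl; apply/eqP/(divff (class_size_neq0 j)).
Qed.

Lemma proj_vec_sum i : \sum_j proj_vec i 0 j = 0.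
Proof.
rewrite (bigID (e i)) /= [X in X + _](_ : _ = 0); last first.
  by rewrite -[RHS](sum_class_proj_coef i i); apply: eq_bigr => j _; rewrite mxE.
rewrite add0r big1 // => j nij; rewrite mxE /proj_coef (negPf nij) subr0.
by case: eqP nij => // <-; rewrite (e_equiv i i i).1.
Qed.

Lemma proj_vec_coroot i (p : 'I_n * 'I_n) : e p.1 p.2 ->
  proj_vec i 0 p.1 - proj_vec i 0 p.2 = xcoroot K i p.1 p.2.
Proof.
move=> ep; rewrite !mxE /proj_coef.
by rewrite !(e_symm e_equiv i) ((e_equiv _ _ i).2 ep) opprB addrA subrK.
Qed.

Lemma proj_vec_perm i w : stab e w -> col_perm w (proj_vec i) = proj_vec (w^-1%g i).
Proof.
move=> sw; apply/rowP => j; rewrite !mxE /proj_coef -[in RHS](inj_eq (@perm_inj _ w)) permKV.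
have -> : e (w^-1%g i) j = e i (w j) by rewrite -(stab_e2 _ _ sw) permKV.
by rewrite (class_size_eq K e_equiv (stab_e (stabV e_equiv sw) i)).
Qed.

Lemma sum_class_coroot j (p : 'I_n * 'I_n) : e p.1 p.2 ->
  \sum_(k | e j k) xcoroot K k p.1 p.2 = 0.
Proof.
move=> ep; rewrite sumrB.
have sumd i : \sum_(k | e j k) (k == i)%:R = (e j i)%:R :> K.
  rewrite big_mkcond (bigD1 i) //= eqxx big1 ?addr0 => [|k /negPf ->]; last by case: ifP.
  by case: ifP.
by rewrite !sumd !(e_symm e_equiv j) ((e_equiv _ _ j).2 ep) subrr.
Qed.

(** Both [proj_vec] and the coroots of W' have zero sum on every class, so both parts of the
    commutator vanish. Hence the transverse operators act on the fibres over the stratum. *)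
Lemma Dunkl_block_avg i j u :
  D (proj_vec i) (block_avg j *: u) = block_avg j *: D (proj_vec i) u.
Proof.
rewrite /block_avg -mul_mpolyC -!scalerA (DunklZ act); congr (_ *: _).
rewrite !scaler_suml (Dunkl_sum act).
under eq_bigr => k _ do rewrite (DunklX act) ?proj_vec_sum //.
rewrite big_split /= -[RHS]addr0; congr (_ + _).
rewrite -scaler_sumr sumrB -scaler_suml -scaler_sumr exchange_big /=.
rewrite -rmorph_sum /= [X in X%:MP](_ : _ = 0); last first.
  by rewrite -[RHS](sum_class_proj_coef i j); apply: eq_bigr => k _; rewrite mxE.
rewrite mpolyC0 scale0r sub0r big1 ?scaler0 ?oppr0 ?scaler0 // => p ep.
by rewrite -scaler_suml -rmorph_sum /= -mulr_sumr sum_class_coroot // mulr0 mpolyC0 scale0r.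
Qed.

(** As in [actY_poly], but only permutations in W' occur, and these fix g. *)
Lemma Dunkl_poly v f : \sum_i v 0 i = 0 -> exists q : 'S_n -> Kx,
  forall u, D v (f *: u) = f *: D v u + \sum_(w | stab e w) q w *: T w u.
Proof.
move=> v0; elim/mpoly_generator_ind: f => [k|f f' [q qP] [q' q'P]|j f [q qP]].
- by exists (fun=> 0) => u; rewrite (DunklZ act) big1 ?addr0 // => w _; rewrite scale0r.
- exists (fun w => q w + q' w) => u; rewrite scalerDl (DunklD act) qP q'P scalerDl addrACA.
  by congr (_ + _); rewrite -big_split; apply: eq_bigr => w _; rewrite scalerDl.
exists (fun w => 'X_j * q w + (if w == 1%g then g * ((v 0 j)%:MP * f) else 0) -
  \sum_(p : 'I_n * 'I_n | e p.1 p.2 && (w == tperm p.1 p.2))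
     g * ((c / 2)%:MP * (((v 0 p.1 - v 0 p.2) * xcoroot K j p.1 p.2)%:MP * msym w^-1%g f))) => u.
rewrite -scalerA (DunklX act) // qP; set Du := D v u.
rewrite scalerDr scalerA -!addrA; congr (_ + _); rewrite scalerBr.
transitivity (\sum_(w | stab e w) ('X_j * q w) *: T w u +
   \sum_(w | stab e w) (if w == 1%g then g * ((v 0 j)%:MP * f) else 0) *: T w u
   - \sum_(w | stab e w) (\sum_(p : 'I_n * 'I_n | e p.1 p.2 && (w == tperm p.1 p.2))
     g * ((c / 2)%:MP * (((v 0 p.1 - v 0 p.2) * xcoroot K j p.1 p.2)%:MP * msym w^-1%g f))) *: T w u);
   last first.
  by rewrite -big_split -sumrB; apply: eq_bigr => w _; rewrite /= scalerBl scalerDl.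
rewrite -addrA; congr (_ + (_ - _)).
- by rewrite scaler_sumr; apply: eq_bigr => w _; rewrite scalerA.
- rewrite (bigD1 1%g) ?(stab1 e_equiv) //= [X in _ + X]big1 ?addr0 => [|w /andP[_ /negPf ->]]; last first.
    by rewrite scale0r.
  by rewrite eqxx (actT1 act) !scalerA !mulrA.
under [RHS]eq_bigr => w _ do rewrite scaler_suml.
rewrite [RHS](exchange_big_dep (fun p : 'I_n * 'I_n => e p.1 p.2)) /=; last first.
  by move=> w p _ /andP[].
rewrite scalerA scaler_sumr; apply: eq_bigr => p ep.
rewrite (big_pred1 (tperm p.1 p.2)) => [|w]; last first.
  by rewrite ep /= andb_idl // => /eqP ->; apply: stab_refl.
by rewrite (actTf act) !scalerA !mulrA.
Qed.

(** Since W' fixes g, the commutator with g^(k+1) contains g^k as a factor. So vectors that are zero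
    up to a power of g stay so under the transverse operators, with one more power. *)
Lemma Dunkl_gprod v : \sum_i v 0 i = 0 -> exists q : 'S_n -> Kx, forall k u,
  g ^+ k.+1 *: D v u = D v (g ^+ k.+1 *: u) -
     (\sum_(w | stab e w) q w *: T w (g ^+ k *: u)) *+ k.+1.
Proof.
move=> v0; have [q qP] := Dunkl_poly g v0; exists q.
elim=> [|k IH] u; first by rewrite expr0 scale1r expr1 qP mulr1n addrK.
have gq u' : g *: (\sum_(w | stab e w) q w *: T w u') = \sum_(w | stab e w) q w *: T w (g *: u').
  rewrite scaler_sumr; apply: eq_bigr => w sw.
  by rewrite (actT_stab _ stab_inv_gprod) // !scalerA mulrC.
rewrite exprS -scalerA IH scalerBr -scalerMnr gq -(scalerA g (g ^+ k.+1)) qP.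
by rewrite [g *: (g ^+ k *: u)]scalerA -exprS [in RHS]mulrS opprD addrA addrK.
Qed.

End StratumOperators.

(** * Finite-dimensional quotients in coordinates *)

Section QuotientCoordinates.
Variables (K : fieldType) (n : nat) (L : lmodType (mpoly n K)) (R : L -> Prop).
Local Notation Kx := (mpoly n K).
Hypothesis R0 : R 0.
Hypothesis RD : forall u v, R u -> R v -> R (u + v).
Hypothesis RZ : forall (f : Kx) u, R u -> R (f *: u).

Let spans Q (m : 'I_Q -> L) :=
  forall u, exists a : 'I_Q -> K, R (u - \sum_q (a q)%:MP *: m q).

Let RN u : R u -> R (- u).
Proof. by rewrite -scaleN1r; apply: RZ. Qed.

(** A spanning family of minimal size is independent modulo R, so coefficients are well defined
    modulo R, and [kap] identifies the quotient with K^r. *)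
Lemma quotient_coordinates Q (m : 'I_Q -> L) : spans m ->
  exists r (kap : L -> 'cV[K]_r), [/\ forall u v, kap (u + v) = kap u + kap v,
    forall k u, kap (k%:MP *: u) = k *: kap u, forall u, kap u = 0 <-> R u &
    forall x, exists u, kap u = x].
Proof.
move=> mS; have exQ : exists Q', `[< exists m' : 'I_Q' -> L, spans m' >].
  by exists Q; apply/asboolP; exists m.
case: (ex_minnP exQ) => r /asboolP[b bS] rmin {Q m mS exQ}.
have indep (a : 'I_r -> K) : R (\sum_q (a q)%:MP *: b q) -> forall q, a q = 0.
  move=> Ra q0; apply/eqP/negPn/negP => aq0.
  case: r b bS rmin a Ra q0 aq0 => [|r] b bS rmin a Ra q0 aq0; first by case: q0 aq0.
  suff /rmin : `[< exists m' : 'I_r -> L, spans m' >] by rewrite ltnn.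
  apply/asboolP; exists (b \o lift q0) => u; have [x Rx] := bS u.
  exists (fun q => x (lift q0 q) - x q0 / a q0 * a (lift q0 q)).
  have -> : u - \sum_q (x (lift q0 q) - x q0 / a q0 * a (lift q0 q))%:MP *: (b \o lift q0) q =
      (u - \sum_q (x q)%:MP *: b q) + (x q0 / a q0)%:MP *: \sum_q (a q)%:MP *: b q.
    rewrite -addrA; congr (_ + _); rewrite !(bigD1_ord q0) //= scalerDr scalerA -mpolyCM divfK //.
    rewrite opprD addrACA addNr add0r scaler_sumr -sumrN -[in RHS]sumrN -big_split.
    by apply: eq_bigr => q _; rewrite mpolyCB mpolyCM scalerBl opprB scalerA /= addrC.
  by apply: RD => //; apply: RZ.
have [kap kapP] := choice bS.
have uniq (a a' : 'I_r -> K) u : R (u - \sum_q (a q)%:MP *: b q) ->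
    R (u - \sum_q (a' q)%:MP *: b q) -> forall q, a q = a' q.
  move=> Ra Ra' q; apply/eqP; rewrite -subr_eq0; apply/eqP.
  apply: (indep (fun q => a q - a' q)); have := RD Ra' (RN Ra).
  rewrite opprB addrC addrA subrK -sumrB.
  by under eq_bigr => i _ do rewrite -scalerBl -mpolyCB.
exists r, (fun u => \col_q kap u q); split.
- move=> u v; apply/colP => q; rewrite !mxE.
  apply: (uniq _ (fun q => kap u q + kap v q) (u + v)); first exact: kapP.
  under eq_bigr => i _ do rewrite mpolyCD scalerDl.
  by rewrite big_split opprD addrACA; apply: RD; apply: kapP.
- move=> k u; apply/colP => q; rewrite !mxE.
  apply: (uniq _ (fun q => k * kap u q) (k%:MP *: u)); first exact: kapP.
  under eq_bigr => i _ do rewrite mpolyCM -scalerA.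
  by rewrite -scaler_sumr -scalerBr; apply/RZ/kapP.
- move=> u; split=> [/colP ku|Ru].
    have := kapP u; rewrite big1 ?subr0 // => q _.
    by have := ku q; rewrite !mxE => ->; rewrite mpolyC0 scale0r.
  apply/colP => q; rewrite !mxE; apply: (uniq _ (fun=> 0) u); first exact: kapP.
  by rewrite big1 ?subr0 // => i _; rewrite mpolyC0 scale0r.
move=> x; exists (\sum_q (x q 0)%:MP *: b q); apply/colP => q; rewrite mxE.
apply: (uniq _ (fun q => x q 0) (\sum_q (x q 0)%:MP *: b q)); first exact: kapP.
by rewrite subrr.
Qed.

Section Operators.
Variables (r : nat) (kap : L -> 'cV[K]_r).
Hypothesis kapD : forall u v, kap (u + v) = kap u + kap v.
Hypothesis kapZ : forall k u, kap (k%:MP *: u) = k *: kap u.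
Hypothesis kap0 : forall u, kap u = 0 <-> R u.
Hypothesis kap_surj : forall x, exists u, kap u = x.

Lemma kapB u v : kap (u - v) = kap u - kap v.
Proof. by rewrite kapD -scaleN1r -mpolyC1 -mpolyCN kapZ scaleN1r. Qed.

Lemma kap_sum (I : Type) (s : seq I) (P : pred I) (F : I -> L) :
  kap (\sum_(i <- s | P i) F i) = \sum_(i <- s | P i) kap (F i).
Proof. by apply: (big_morph kap kapD); apply/kap0. Qed.

Lemma quotient_operator (O : L -> L) : (forall u v, O (u + v) = O u + O v) ->
  (forall k u, O (k%:MP *: u) = k%:MP *: O u) -> (forall u, R u -> R (O u)) ->
  exists M : 'M[K]_r, forall u, kap (O u) = M *m kap u.
Proof.
move=> OD OZ OR; have [sec secK] := choice kap_surj.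
have O0 : O 0 = 0 by apply: (@addIr _ (O 0)); rewrite -OD !add0r.
have OS (I : Type) (s : seq I) (P : pred I) F :
  O (\sum_(i <- s | P i) F i) = \sum_(i <- s | P i) O (F i) by apply: (big_morph O OD O0).
have ON u : O (- u) = - O u by apply/eqP; rewrite -addr_eq0 -OD addNr O0.
exists (\matrix_(i, j) kap (O (sec (delta_mx j 0))) i 0) => u.
have Ru : R (u - \sum_j (kap u j 0)%:MP *: sec (delta_mx j 0)).
  apply/kap0; rewrite kapB kap_sum; apply/eqP; rewrite subr_eq0; apply/eqP.
  rewrite {1}[kap u]matrix_sum_delta; apply: eq_bigr => j _.
  by rewrite big_ord1 kapZ secK.
have := (kap0 _).2 (OR _ Ru); rewrite OD ON kapB => /eqP; rewrite subr_eq0 => /eqP ->.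
rewrite OS kap_sum; apply/colP => i; rewrite summxE !mxE; apply: eq_bigr => j _.
by rewrite OZ kapZ !mxE mulrC.
Qed.

Lemma quotient_operator_eq (M M' : 'M[K]_r) :
  (forall u, M *m kap u = M' *m kap u) -> M = M'.
Proof.
move=> E; apply/trmx_inj/row_matrixP => i; apply: trmx_inj.
have [u uE] := kap_surj (delta_mx i 0); have := E u; rewrite uE => H.
by rewrite !rowE !trmx_mul !trmxK !trmx_delta.
Qed.

End Operators.
End QuotientCoordinates.

Section Generators.
Variables (K : numFieldType) (n : nat) (L : lmodType (mpoly n K)).
Local Notation Kx := (mpoly n K).
Variables (d : nat) (t : 'I_d -> L).
Hypothesis gen : forall u, exists P : 'I_d -> Kx, u = \sum_j P j *: t j.
Variables (z : 'I_n -> Kx) (M : nat).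

Let eta i : Kx := 'X_i - z i.
(** Words of at most M letters; [None] marks an empty place, so that the words form a finite
    type. *)
Let Wd := {ffun 'I_M -> option 'I_n}.
Let ew (s : Wd) : Kx := \prod_i odflt 1 (omap eta (s i)).

(** Write ['X_i] = z i + eta i. Multiplication by eta i lengthens a word until R absorbs it, and z i
    only changes the coefficient within C. Two choices of C are made later: the constants, with z i
    evaluated at a point, and the invariants of W'. *)
Lemma finite_generators : exists Q (m : 'I_Q -> L),
  forall (C : Kx -> Prop) (R : L -> Prop),
  (forall k, C k%:MP) -> (forall f f', C f -> C f' -> C (f + f')) ->
  R 0 -> (forall u v, R u -> R v -> R (u + v)) -> (forall f u, R u -> R (f *: u)) ->
  (forall i f l, C f -> exists2 f', C f' & R ((z i * f - f') *: l)) ->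
  (forall (s : seq 'I_n) l, size s = M.+1 -> R ((\prod_(i <- s) eta i) *: l)) ->
  forall u, exists2 f : 'I_Q -> Kx, forall q, C (f q) & R (u - \sum_q f q *: m q).
Proof.
pose I := ('I_d * Wd)%type; pose m0 (q : I) : L := ew q.2 *: t q.1.
exists #|{: I}|, (m0 \o enum_val) => C R Ck CD R0 RD RZ Cz etaR u.
pose Sp u := exists2 f : I -> Kx, forall q, C (f q) & R (u - \sum_q f q *: m0 q).
suff [f Cf Rf] : Sp u.
  exists (f \o enum_val) => [q|]; first exact: Cf.
  by rewrite (reindex (@enum_val _ {: I})) in Rf; last exact/onW_bij/enum_val_bij.
have SpD u1 u2 : Sp u1 -> Sp u2 -> Sp (u1 + u2).
  move=> [f1 C1 R1] [f2 C2 R2]; exists (fun q => f1 q + f2 q) => [q|]; first exact: CD.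
  by under eq_bigr => q _ do rewrite scalerDl; rewrite big_split opprD addrACA; apply: RD.
have C0 : C 0 by rewrite -(mpolyC0 n K).
have Sp0 : Sp 0.
  by exists (fun=> 0) => //; rewrite big1 ?subr0 // => q _; rewrite scale0r.
have SpR u1 : R u1 -> Sp u1.
  by exists (fun=> 0) => //; rewrite big1 ?subr0 // => q _; rewrite scale0r.
have Spm f q : C f -> Sp (f *: m0 q).
  move=> Cf; exists (fun q' => if q' == q then f else 0) => [q'|]; first by case: ifP.
  rewrite (bigD1 q) //= eqxx big1 ?addr0 ?subrr // => q' /negPf ->.
  by rewrite scale0r.
have Sp_sum (J : finType) (F : J -> L) : (forall j, Sp (F j)) -> Sp (\sum_j F j).
  by move=> SF; elim/big_ind: _.
have etam i q : (exists q', eta i *: m0 q = m0 q') \/ R (eta i *: m0 q).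
  case: q => j s; case: (pickP [pred k | s k == None]) => [k /eqP sk|full].
    left; exists (j, [ffun k' => if k' == k then Some i else s k']).
    rewrite /m0 /= scalerA; congr (_ *: _); rewrite /ew (bigD1 k) //= [RHS](bigD1 k) //=.
    rewrite sk ffunE eqxx /= mul1r; congr (_ * _); apply: eq_bigr => k' /negPf kk'.
    by rewrite ffunE kk'.
  right; rewrite /m0 /= scalerA.
  have -> : ew s = \prod_(i' <- [seq odflt i (s k) | k <- enum 'I_M]) eta i'.
    rewrite big_map big_enum; apply: eq_bigr => k _.
    by have := full k; rewrite /=; case: (s k).
  have := etaR (i :: [seq odflt i (s k) | k <- enum 'I_M]) (t j).
  by rewrite big_cons /= size_map size_enum_ord; apply.
have SpX i u1 : Sp u1 -> Sp ('X_i *: u1).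
  move=> [f Cf Rf]; have -> : 'X_i *: u1 = 'X_i *: (u1 - \sum_q f q *: m0 q) +
     (\sum_q f q *: (eta i *: m0 q) + \sum_q (z i * f q) *: m0 q).
    rewrite -big_split /= scalerBr -addrA -[LHS]addr0; congr (_ + _); apply/esym/eqP.
    rewrite addrC subr_eq0 scaler_sumr; apply/eqP; apply: eq_bigr => q _.
    by rewrite !scalerA -scalerDl /eta; congr (_ *: _); ring.
  apply: (SpD _ _); first by apply/SpR/RZ.
  apply: (SpD _ _); apply: Sp_sum => q.
    by case: (etam i q) => [[q' ->]|Rq]; [apply: Spm|apply/SpR/RZ].
  have [f' Cf' Rf'] := Cz i (f q) (m0 q) (Cf q).
  by rewrite -[_ *: _](subrK (f' *: m0 q)) -scalerBl; apply: SpD; [apply: SpR|apply: Spm].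
have [P ->] := gen u; apply: Sp_sum => j.
elim/mpoly_generator_ind: (P j) => [k|f f' Sf Sf'|i f Sf].
- have -> : k%:MP *: t j = k%:MP *: m0 (j, [ffun=> None]).
    by rewrite /m0 /ew big1 ?scale1r // => i _; rewrite ffunE.
  exact: Spm.
- by rewrite scalerDl; apply: SpD.
by rewrite -scalerA; apply: SpX.
Qed.

End Generators.

(** The adjugate trick: adj B times B is the scalar matrix det B. *)
Lemma det_annihilates (R : comNzRingType) (L : lmodType R) (Q : nat) (B : 'M[R]_Q) (w : 'I_Q -> L) :
  (forall q, \sum_q' B q q' *: w q' = 0) -> forall q, \det B *: w q = 0.
Proof.
move=> Bw q; transitivity (\sum_q' ((\adj B *m B) q q') *: w q').
  rewrite mul_adj_mx (bigD1 q) //= !mxE eqxx mulr1n big1 ?addr0 // => q' qq'.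
  by rewrite !mxE eq_sym (negPf qq') mulr0n scale0r.
under eq_bigr => q' _ do rewrite mxE scaler_suml.
rewrite exchange_big big1 // => q' _ /=.
under eq_bigr => q'' _ do rewrite -scalerA.
by rewrite -scaler_sumr Bw scaler0.
Qed.

(** The number of a chosen representative of each class separates the classes in characteristic 0;
    subtracting the mean moves the point into h. *)
Lemma exists_generic_point (K : numFieldType) (n : nat) (e : rel 'I_n) : equivalence_rel e ->
  exists b : 'rV[K]_n, \sum_i b 0 i = 0 /\ forall i j, e i j = (b 0 i == b 0 j).
Proof.
case: n e => [|n'] e eqE; first by exists 0; split=> [|[]//]; rewrite big_ord0.
pose rep i := odflt i [pick j | e i j].
have repE i j : e i j = (rep i == rep j).
  have e_rep k : e k (rep k).
    by rewrite /rep; case: pickP => //= _; apply: (eqE k k k).1.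
  apply/idP/eqP => [eij|rij].
    rewrite /rep (eq_pick (Q := e j)) => [|k]; last exact: (eqE i j k).2.
    by case: pickP => //= /(_ j); rewrite (eqE j j j).1.
  by rewrite ((eqE _ _ j).2 (e_rep i)) rij (e_symm eqE).
pose s : K := \sum_i (rep i)%:R.
exists (\row_i ((rep i)%:R - s / n'.+1%:R)); split=> [|i j]; last first.
  by rewrite !mxE (inj_eq (addIr _)) eqr_nat repE.
under eq_bigr => i _ do rewrite mxE.
rewrite sumrB sumr_const card_ord -[_ *+ _]mulr_natr.
by rewrite divfK ?subrr // pnatr_eq0.
Qed.

(** * Invariant vectors and a nontrivial stratum *)

Section NontrivialStratum.
Variables (K : numClosedFieldType) (n : nat) (c : K) (L : lmodType (mpoly n K)).
Local Notation Kx := (mpoly n K).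
Local Notation V := 'rV[K]_n.
Variables (T : 'S_n -> L -> L) (Y : V -> L -> L).
Hypothesis c_gtN1 : - 1 < c.
Hypothesis c_lt0 : c < 0.
Hypothesis act : cherednik_action c T Y.
Variables (d : nat) (t : 'I_d -> L).
Hypothesis gen : forall u, exists P : 'I_d -> Kx, u = \sum_j P j *: t j.
Hypothesis simple : forall S : L -> Prop, S 0 -> (forall u v, S u -> S v -> S (u + v)) ->
  (forall f u, S u -> S (f *: u)) -> (forall w u, S u -> S (T w u)) ->
  (forall (v : V) u, \sum_i v 0 i = 0 -> S u -> S (Y v u)) ->
  forall u, S u -> u != 0 -> forall u', S u'.
Variable e : rel 'I_n.
Hypothesis e_equiv : equivalence_rel e.
Local Notation g := (gprod K e).
Local Notation D := (Dunkl c T Y e).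
Hypothesis gprod_nnil : ~ nilp L g.
Hypothesis e_nil : forall i k, e i k -> nilp L (('X_i - 'X_k) * g).
Hypothesis e_nontrivial : exists i j, e i j && (i != j).
Implicit Types (f : Kx) (u l : L) (v : V) (w : 'S_n).

Let z := @block_avg K n e.
Let eta i : Kx := 'X_i - z i.

Let etaE i : eta i = (class_size K e i)^-1 *: \sum_(k | e i k) ('X_i - 'X_k).
Proof.
rewrite sumrB scalerBr sumr_const -[_ *+ _]scaler_nat scalerA mulVf ?scale1r //.
exact: class_size_neq0.
Qed.

(** Each eta i g is nilpotent, being a combination of the ('X_i - 'X_j) g with j in the class of i.
    If k bounds the exponents, a word of more than n k letters repeats some letter k times. *)
Lemma eta_words_nilpotent : exists M k, forall (s : seq 'I_n) l, size s = M.+1 ->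
  (g ^+ k * \prod_(i <- s) eta i) *: l = 0.
Proof.
have nil i : nilp L (eta i * g).
  rewrite etaE -scalerAl mulr_suml; apply/nilpZ/nilp_sum => k; exact: e_nil.
have [k0 k0P] := choice nil; pose k := (\max_i k0 i)%N.
exists (n * k)%N, k => s l sz.
have [i ki] : exists i, (k <= count_mem i s)%N.
  apply/existsP; apply: contraT; rewrite negb_exists => /forallP lt.
  have : (size s <= n * k)%N.
    rewrite -sum1_size (partition_big id xpredT) //= -[X in (_ <= X * _)%N]card_ord -sum_nat_const.
    apply: leq_sum => i _; rewrite sum1_count.
    by have := lt i; rewrite -ltnNge => /ltnW.
  by rewrite sz ltnn.
have [h hE] : exists h, \prod_(i <- s) eta i = eta i ^+ k * h.
  exists (eta i ^+ (count_mem i s - k) * \prod_(j <- s | j != i) eta j).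
  rewrite (bigID (pred1 i)) /= mulrA -exprD subnKC //; congr (_ * _).
  rewrite (eq_bigr (fun=> eta i)) => [|j /eqP -> //].
  by rewrite big_const_seq iter_mulr mulr1.
rewrite hE mulrCA mulrA -exprMn mulrC -scalerA.
have lek : (k0 i <= k)%N by rewrite /k (leq_bigmax i).
by rewrite -(subnK lek) exprD -scalerA k0P !scaler0.
Qed.

Section GenericPoint.
Variable b : V.
Hypothesis b0 : \sum_i b 0 i = 0.
Hypothesis bE : forall i j, e i j = (b 0 i == b 0 j).
Local Notation ev f := (f.@[fun i => b 0 i]).

Let zeta i : Kx := z i - (b 0 i)%:MP.
(** [L] modulo [J] is the fibre over the point b of the stratum; [P] saturates [J] with respect to
    g, so [L] modulo [P] embeds in this fibre localized at g. *)
Let J l := exists f : 'I_n -> L, l = \sum_i zeta i *: f i.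
Let P l := exists N, J (g ^+ N *: l).

Let J0 : J 0.
Proof. by exists (fun=> 0); rewrite big1 // => i _; rewrite scaler0. Qed.

Let JD l l' : J l -> J l' -> J (l + l').
Proof.
case=> f -> [f' ->]; exists (fun i => f i + f' i); rewrite -big_split.
by apply: eq_bigr => i _; rewrite scalerDr.
Qed.

Let JZ h l : J l -> J (h *: l).
Proof.
case=> f ->; exists (fun i => h *: f i); rewrite scaler_sumr.
by apply: eq_bigr => i _; rewrite !scalerA mulrC.
Qed.

Let JN l : J l -> J (- l).
Proof. by rewrite -scaleN1r; apply: JZ. Qed.

Let J_sum (I : finType) (pr : pred I) (F : I -> L) :
  (forall i, pr i -> J (F i)) -> J (\sum_(i | pr i) F i).
Proof. by move=> JF; elim/big_ind: _. Qed.

Let stab_inv_zeta i : stab_inv e (zeta i).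
Proof.
by move=> w sw; rewrite raddfB /= (stab_inv_block_avg K e_equiv) // msymC.
Qed.

Let JT w l : stab e w -> J l -> J (T w l).
Proof.
move=> sw [f ->]; exists (fun i => T w (f i)); rewrite (actT_sum act).
by apply: eq_bigr => i _; rewrite (actT_stab act e_equiv).
Qed.

Let Dzeta i j l : D (proj_vec K e i) (zeta j *: l) = zeta j *: D (proj_vec K e i) l.
Proof.
rewrite !scalerBl -![- (_ *: _)]scaleN1r -mpolyC1 -mpolyCN (DunklD act) (DunklZ act) (DunklZ act).
by rewrite (Dunkl_block_avg act e_equiv).
Qed.

Let JDunkl i l : J l -> J (D (proj_vec K e i) l).
Proof.
case=> f ->; exists (fun j => D (proj_vec K e i) (f j)); rewrite (Dunkl_sum act).
by apply: eq_bigr => j _; rewrite Dzeta.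
Qed.

Let J_exp N N' l : (N <= N')%N -> J (g ^+ N *: l) -> J (g ^+ N' *: l).
Proof. by move=> le; rewrite -(subnK le) exprD -scalerA; apply: JZ. Qed.

Let JP l : J l -> P l.
Proof. by exists 0%N; rewrite expr0 scale1r. Qed.

Let PD l l' : P l -> P l' -> P (l + l').
Proof.
case=> N JN' [N' JN'']; exists (maxn N N'); rewrite scalerDr.
by apply: JD; [apply: J_exp JN'|apply: J_exp JN'']; rewrite ?leq_maxl ?leq_maxr.
Qed.

Let PZ h l : P l -> P (h *: l).
Proof. by case=> N JN'; exists N; rewrite scalerA mulrC -scalerA; apply: JZ. Qed.

Let PT w l : stab e w -> P l -> P (T w l).
Proof.
move=> sw [N JN']; exists N; rewrite -(actT_stab act e_equiv) //; first exact: JT.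
exact/stab_invX/(stab_inv_gprod K e_equiv).
Qed.

Let PDunkl i l : P l -> P (D (proj_vec K e i) l).
Proof.
case=> N JN'; have [q qP] := Dunkl_gprod act e_equiv (proj_vec_sum K e_equiv i).
exists N.+1; rewrite qP; apply: JD; first by apply/JDunkl/J_exp/JN'.
by apply: JN; rewrite -scaler_nat; apply/JZ/J_sum => w sw; apply/JZ/JT.
Qed.

Let Pg l : P (g *: l) -> P l.
Proof. by case=> N; rewrite scalerA -exprSr => JN'; exists N.+1. Qed.

Let kill_P M k : (forall (s : seq 'I_n) l, size s = M.+1 -> (g ^+ k * \prod_(i <- s) eta i) *: l = 0) ->
  forall (s : seq 'I_n) l, size s = M.+1 -> P ((\prod_(i <- s) eta i) *: l).
Proof. by move=> kl s l sz; exists k; rewrite scalerA kl. Qed.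

(** [L] modulo [P] is finite-dimensional: z i acts there by b_i, and long words in the eta i vanish.
    Then [no_invariants_fd] applies to eta, [T] and the inverse of g times [Dunkl]. *)
Lemma stab_sum_P l : P (\sum_(w | stab e w) T w l).
Proof.
have [M [k kl]] := eta_words_nilpotent; have etaP := kill_P kl.
have [Q [m mP]] := finite_generators gen z M.
have span u : exists a : 'I_Q -> K, P (u - \sum_q (a q)%:MP *: m q).
  have [||||||f fC Pf] := mP (fun f => exists a : K, f = a%:MP) P _ _ _ _ _ _ etaP u.
  - by move=> a; exists a.
  - by move=> f f' [a ->] [a' ->]; exists (a + a'); rewrite mpolyCD.
  - exact: (JP J0).
  - exact: PD.
  - exact: PZ.
  - move=> i f l' [a ->]; exists (b 0 i * a)%:MP; first by exists (b 0 i * a).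
    rewrite mpolyCM -mulrBl; apply: JP; rewrite -scalerA.
    exists (fun i' => if i' == i then a%:MP *: l' else 0).
    by rewrite (bigD1 i) //= eqxx big1 ?addr0 // => i' /negPf ->; rewrite scaler0.
  have [a aE] := choice fC; exists a; by under eq_bigr => q _ do rewrite -aE.
have [r [kap [kapD kapZ kap0 kap_surj]]] := quotient_coordinates (JP J0) PD PZ span.
case: r kap kapD kapZ kap0 kap_surj => [|r] kap kapD kapZ kap0 kap_surj.
  by apply/kap0; rewrite [LHS]flatmx0.
have op := quotient_operator (JP J0) kapD kapZ kap0 kap_surj.
have opeq := quotient_operator_eq kap_surj.
have kapS := kap_sum (JP J0) kapD kap0; have kapB' := kapB kapD kapZ.
have scalD (f : Kx) u u' : f *: (u + u') = f *: u + f *: u' by rewrite scalerDr.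
have scalZ (f : Kx) a u : f *: (a%:MP *: u) = a%:MP *: (f *: u) by rewrite !scalerA mulrC.
have [X XE] := choice (fun i => op _ (scalD (eta i)) (scalZ (eta i)) (PZ (eta i))).
have [G GE] := op _ (scalD g) (scalZ g) (PZ g).
have [E EE] := choice (fun i => op _ (DunklD act e (proj_vec K e i)) (DunklZ act e (proj_vec K e i))
  (@PDunkl i)).
have TE w : exists M' : 'M[K]_r.+1, stab e w -> forall u, kap (T w u) = M' *m kap u.
  have [sw|nsw] := boolP (stab e w); last by exists 0.
  have TZ a u : T w (a%:MP *: u) = a%:MP *: T w u by rewrite (actTf act) msymC.
  by have [M' M'E] := op (T w) (actTD act w) TZ (fun u => PT sw (l := u)); exists M'.
have [S SE] := choice TE.
(* [P] is saturated, so g acts injectively on the quotient, hence invertibly in finite dimension. *)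
have Gu : G \in unitmx.
  rewrite -unitmx_tr -row_free_unit; apply: inj_row_free => x xG.
  have [u uE] := kap_surj x^T; apply: trmx_inj; rewrite trmx0 -uE; apply/kap0/Pg/kap0.
  by rewrite GE uE; apply: trmx_inj; rewrite trmx_mul trmxK trmx0.
pose Y' i : 'M[K]_r.+1 := invmx G *m E i.
have mulE (A B : 'M[K]_r.+1) u : (A * B) *m kap u = A *m (B *m kap u) by rewrite mulmxA.
have GY i : G * Y' i = E i by rewrite /Y' -[G * _]/(G *m _) mulmxA mulmxV // mul1mx.
have GC (A : 'M[K]_r.+1) : G * A = A * G -> invmx G * A = A * invmx G.
  move=> GA; rewrite -[LHS]mulr1 -[1 in LHS](mulmxV Gu) -[G *m _]/(G * _) !mulrA -[_ * A * G]mulrA.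
  by rewrite -GA mulrA -[invmx G * G]/(invmx G *m G) mulVmx // mul1r.
have GX i : G * X i = X i * G.
  by apply: opeq => u; rewrite !mulE -XE -GE -GE -XE !scalerA mulrC.
have XC i j : X i * X j = X j * X i.
  by apply: opeq => u; rewrite !mulE -!XE !scalerA mulrC.
have sumX i : \sum_(j | e i j) X j = 0.
  apply: opeq => u; rewrite mulmx_suml mul0mx; under eq_bigr => j _ do rewrite -XE.
  rewrite -kapS -scaler_suml -[RHS](_ : kap 0 = 0); last by apply/kap0/JP.
  congr kap; rewrite (_ : \sum_(j | e i j) eta j = 0) ?scale0r // sumrB.
  rewrite [X in _ - X](eq_bigr (fun=> z i)) => [|j eij]; last exact/esym/(block_avg_eq K e_equiv eij).
  rewrite sumr_const /z /block_avg -[_ *+ _]scaler_nat scalerA.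
  by rewrite divff ?scale1r ?subrr // class_size_neq0.
have SX w i : (forall j, e j (w j)) -> S w * X i = X (w^-1%g i) * S w.
  move/forallP => sw; apply: opeq => u; rewrite !mulE -XE -SE // -SE // -XE (actTf act).
  congr (kap (_ *: _)); rewrite /eta raddfB /= msymXU; congr (_ - _).
  rewrite (stab_inv_block_avg K e_equiv) ?(stabV e_equiv) //; apply: (block_avg_eq K e_equiv).
  exact: (stab_e (stabV e_equiv sw)).
have SG w : stab e w -> S w * G = G * S w.
  move=> sw; apply: opeq => u; rewrite !mulE -GE -SE // -SE // -GE.
  by rewrite (actT_stab act e_equiv) //; apply: (stab_inv_gprod K e_equiv).
have SY w i : (forall j, e j (w j)) -> S w * Y' i = Y' (w^-1%g i) * S w.
  move/forallP => sw; rewrite /Y' -[invmx G *m E i]/(invmx G * E i).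
  rewrite -[invmx G *m E _]/(invmx G * E _) mulrA -GC ?SG // -!mulrA; congr (_ * _).
  apply: opeq => u; rewrite !mulE -EE -SE // -SE // -EE (Dunkl_equivariant act e_equiv) //.
    by rewrite (proj_vec_perm K e_equiv).
  exact: proj_vec_sum.
have SM w w' : stab e w -> stab e w' -> S (w * w')%g = S w * S w'.
  move=> sw sw'; apply: opeq => u; rewrite mulE -!SE //; first by rewrite (actTM act).
  exact: (stabM e_equiv).
have X_nil (s : seq 'I_n) : size s = M.+1 -> \prod_(i <- s) X i = 0.
  move=> sz; apply: opeq => u; rewrite mul0mx; have -> : (\prod_(i <- s) X i) *m kap u =
      kap ((\prod_(i <- s) eta i) *: u).
    elim: (s) => [|i s' IH]; first by rewrite !big_nil mul1mx scale1r.
    by rewrite !big_cons mulE IH -XE scalerA.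
  by apply/kap0/etaP.
have YX i j : Y' i * X j - X j * Y' i = (proj_coef K e i j)%:A -
  (c / 2) *: \sum_(p : 'I_n * 'I_n | e p.1 p.2)
     (xcoroot K i p.1 p.2 * xcoroot K j p.1 p.2) *: S (tperm p.1 p.2).
  (* The commutator of [Dunkl] with ['X_j] carries a factor g, which [invmx G] removes; [block_avg]
     commutes with [Dunkl]. *)
  have EX : E i * X j - X j * E i = G * ((proj_coef K e i j)%:A -
      (c / 2) *: \sum_(p : 'I_n * 'I_n | e p.1 p.2)
     (xcoroot K i p.1 p.2 * xcoroot K j p.1 p.2) *: S (tperm p.1 p.2)).
    apply: opeq => u; rewrite mulmxBl !mulE -XE -EE -EE -XE -kapB'.
    rewrite /eta scalerBl -scaleN1r -mpolyC1 -mpolyCN (DunklD act) (DunklZ act).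
    rewrite (Dunkl_block_avg act e_equiv) mpolyCN mpolyC1 scaleN1r.
    rewrite (DunklX act) ?proj_vec_sum // scalerBl opprB /z addrA subrK addrAC subrr add0r.
    rewrite GE; congr (_ *m _); rewrite kapB' !kapZ kapS mulmxBl -!scalemxAl mul1mx mxE.
    congr (_ - _ *: _); rewrite mulmx_suml; apply: eq_bigr => p ep.
    rewrite kapZ SE; last exact: (stab_refl e_equiv).
    by rewrite (proj_vec_coroot K e_equiv) // -scalemxAl.
  have Yl A : Y' i * A = invmx G * (E i * A) by rewrite [RHS]mulrA.
  have Yr : X j * Y' i = invmx G * (X j * E i) by rewrite [RHS]mulrA (GC _ (GX j)) -mulrA.
  by rewrite Yl Yr -mulrBr EX mulrA -[invmx G * G]/(invmx G *m G) mulVmx // mul1r.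
have /eqP := no_invariants_fd e_equiv c_gtN1 c_lt0 XC YX sumX SX SY SM X_nil e_nontrivial.
rewrite scaler_eq0 invr_eq0 pnatr_eq0 cards_eq0 => /orP[/eqP/finset.setP/(_ 1%g)|/eqP sumS].
  by rewrite !inE (stab1 e_equiv).
apply/kap0; rewrite kapS; under eq_bigr => w sw do rewrite SE //.
by rewrite -mulmx_suml sumS mul0mx.
Qed.

(** A determinant argument in the manner of Nakayama. Up to powers of g, the sums over W' of the
    generators satisfy a square linear system whose matrix B at b is h g^N times the identity, with
    h the order of W'. Hence det B h g^k kills u without vanishing at b, against
    [invariant_vanish]. *)
Lemma no_invariant_vector u : (forall w, T w u = u) -> u = 0.
Proof.
move=> Tu; apply/eqP/negPn/negP => u0.
have [M [k kl]] := eta_words_nilpotent.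
have [Q [m mP]] := finite_generators gen z M.
pose sm l := \sum_(w | stab e w) T w l.
(* The coefficients are invariant under W', so the sum over W' is linear over them. *)
have span l : exists2 f : 'I_Q -> Kx, forall q, stab_inv e (f q) &
    g ^+ k *: l = \sum_q f q *: (g ^+ k *: m q).
  have [|||||||f fC Pf] := mP (stab_inv e) (fun l => g ^+ k *: l = 0) _ _ _ _ _ _ _ l.
  - exact: stab_invC.
  - exact: stab_invD.
  - exact: scaler0.
  - by move=> x y x0 y0; rewrite scalerDr x0 y0 addr0.
  - by move=> f x x0; rewrite scalerA mulrC -scalerA x0 scaler0.
  - move=> i f x sf; exists (z i * f); last by rewrite subrr scale0r scaler0.
    exact: (stab_invM (stab_inv_block_avg K e_equiv i)).
  - by move=> s x sz; rewrite scalerA kl.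
  exists f => //; move: Pf; rewrite scalerBr => /eqP; rewrite subr_eq0 => /eqP ->.
  by rewrite scaler_sumr; apply: eq_bigr => q _; rewrite !scalerA mulrC.
have smZ f l : stab_inv e f -> sm (f *: l) = f *: sm l.
  move=> sf; rewrite /sm scaler_sumr; apply: eq_bigr => w sw.
  exact: (actT_stab act e_equiv).
have sm_sum (I : finType) (F : I -> L) : sm (\sum_i F i) = \sum_i sm (F i).
  by rewrite /sm exchange_big; apply: eq_bigr => w _; rewrite (actT_sum act).
pose h : Kx := (#|[set w | stab e w]|%:R)%:MP.
have sm_sm l : sm (sm l) = h *: sm l.
  rewrite {1}/sm (eq_bigr (fun=> sm l)) => [|w sw]; last first.
    rewrite /sm (actT_sum act) [RHS](reindex_inj (mulgI w)) /=.
    apply: eq_big => [w'|w' _]; last by rewrite (actTM act).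
    apply/idP/idP => [|sww']; first exact: (stabM e_equiv).
    by rewrite -(mulKg w w'); apply: (stabM e_equiv) => //; apply: (stabV e_equiv).
  by rewrite sumr_const -cardsE /h mpolyC_nat scaler_nat.
have sg j : stab_inv e (g ^+ j) by exact/stab_invX/(stab_inv_gprod K e_equiv).
have [N0 N0P] := choice (fun q => stab_sum_P (m q)).
pose N := (\max_q N0 q)%N.
have JN' q : J (g ^+ N *: sm (m q)) by apply: J_exp (N0P q); rewrite /N (leq_bigmax q).
have [F FE] := choice JN'.
have [p pP] : exists p : 'I_Q -> 'I_n -> 'I_Q -> Kx, forall q i, (forall q', stab_inv e (p q i q')) /\
    g ^+ k *: F q i = \sum_q' p q i q' *: (g ^+ k *: m q').
  have [p pP] := choice (fun qi : 'I_Q * 'I_n => let: ex_intro2 f sf E := span (F qi.1 qi.2) in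
    ex_intro (fun f : 'I_Q -> Kx => (forall q', stab_inv e (f q')) /\
    g ^+ k *: F qi.1 qi.2 = \sum_q' f q' *: (g ^+ k *: m q')) f (conj sf E)).
  by exists (fun q i => p (q, i)) => q i; apply: (pP (q, i)).
pose wv q := g ^+ k *: sm (m q).
(* [stab_sum_P] puts g^N [sm (m q)] in the span of the zeta i; summing over W' once more costs the
   factor h. The second term vanishes at b because the zeta i do. *)
pose B : 'M[Kx]_Q := \matrix_(q, q') ((h * g ^+ N) *+ (q == q') - \sum_i zeta i * p q i q').
have Bw q : \sum_q' B q q' *: wv q' = 0.
  under eq_bigr => q' _ do rewrite mxE scalerBl.
  rewrite sumrB (bigD1 q) //= eqxx mulr1n big1 ?addr0 => [|q' qq']; last first.
    by rewrite eq_sym (negPf qq') mulr0n scale0r.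
  apply/eqP; rewrite subr_eq0; apply/eqP.
  have -> : (h * g ^+ N) *: wv q = \sum_i zeta i *: sm (g ^+ k *: F q i).
    rewrite /wv -!scalerA [g ^+ N *: _]scalerA mulrC -scalerA -smZ // !scalerA mulrC -!scalerA.
    rewrite -sm_sm smZ // FE sm_sum scaler_sumr; apply: eq_bigr => i _.
    rewrite smZ; last exact: stab_inv_zeta.
    by rewrite smZ // !scalerA mulrC.
  under [RHS]eq_bigr => q' _ do rewrite scaler_suml.
  rewrite exchange_big; apply: eq_bigr => i _ /=.
  rewrite (pP q i).2 sm_sum scaler_sumr; apply: eq_bigr => q' _.
  rewrite smZ; last exact: (pP q i).1.
  by rewrite smZ // scalerA.
have [f sf fE] := span u.
have smu : sm u = h *: u.
  rewrite /sm (eq_bigr (fun=> u)) => [|w _]; last exact: Tu.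
  by rewrite sumr_const -cardsE /h mpolyC_nat scaler_nat.
have kill : (\det B * (h * g ^+ k)) *: u = 0.
  have E : (h * g ^+ k) *: u = \sum_q f q *: wv q.
    rewrite mulrC -scalerA -smu -smZ // fE sm_sum; apply: eq_bigr => q _.
    by rewrite smZ // smZ.
  rewrite -scalerA E scaler_sumr big1 // => q _.
  by rewrite scalerA mulrC -scalerA (det_annihilates Bw) scaler0.
have ev_z i : ev (z i) = b 0 i.
  rewrite /z /block_avg mevalZ rmorph_sum /= (eq_bigr (fun=> b 0 i)) => [|j eij]; last first.
    by rewrite mevalXU; apply/esym/eqP; rewrite -bE.
  rewrite sumr_const -[_ *+ _]mulr_natl mulrA mulVf ?mul1r //.
  exact: (class_size_neq0 K e_equiv).
have ev_g : ev g != 0.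
  rewrite /gprod rmorph_prod; apply/prodf_neq0 => x nx.
  by rewrite /= mevalB !mevalXU subr_eq0 -bE.
have ev_h : ev h != 0.
  rewrite mevalC pnatr_eq0 -lt0n; apply/card_gt0P; exists 1%g.
  by rewrite inE (stab1 e_equiv).
have be i j : e i j -> b 0 i = b 0 j by rewrite bE => /eqP.
have := invariant_vanish act gen simple e_equiv gprod_nnil e_nil Tu u0 kill b0 be.
rewrite mevalM mevalM rmorphXn /= -det_map_mx.
have -> : map_mx (meval (fun i => b 0 i)) B = (ev h * ev g ^+ N)%:M.
  apply/matrixP => q q'; rewrite !mxE mevalB raddfMn /= mevalM rmorphXn /=.
  rewrite [X in _ - X](_ : _ = 0) ?subr0 // rmorph_sum big1 // => i _ /=.
  by rewrite mevalM mevalB ev_z mevalC subrr mul0r.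
apply/eqP; rewrite det_scalar mulf_neq0 ?expf_neq0 ?mulf_neq0 ?expf_neq0 //.
Qed.

End GenericPoint.
Lemma nontrivial_stratum_no_invariant u : (forall w, T w u = u) -> u = 0.
Proof.
have [b [b0 bE]] := exists_generic_point K e_equiv.
exact: (no_invariant_vector b0 bE).
Qed.

End NontrivialStratum.

(** * Asphericity and support *)

Section AsphericalSupport.
Variables (K : numClosedFieldType) (n : nat) (c : K) (L : lmodType (mpoly n K)).
Local Notation Kx := (mpoly n K).
Local Notation V := 'rV[K]_n.
Variables (T : 'S_n -> L -> L) (Y : V -> L -> L).
Hypothesis c_gtN1 : - 1 < c.
Hypothesis c_lt0 : c < 0.
Hypothesis act : cherednik_action c T Y.
Variables (d : nat) (t : 'I_d -> L).
Hypothesis gen : forall u, exists P : 'I_d -> Kx, u = \sum_j P j *: t j.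
Hypothesis simple : forall S : L -> Prop, S 0 -> (forall u v, S u -> S v -> S (u + v)) ->
  (forall f u, S u -> S (f *: u)) -> (forall w u, S u -> S (T w u)) ->
  (forall (v : V) u, \sum_i v 0 i = 0 -> S u -> S (Y v u)) ->
  forall u, S u -> u != 0 -> forall u', S u'.

(** At a point with distinct coordinates the product of the roots is nonzero, so if a power of it
    kills [L], the point lies outside the support. Conversely, if a sum over the group is nonzero,
    it is an invariant vector, e must be trivial, and [invariant_vanish] applies at every point of
    h. *)
Lemma no_invariants_iff_proper_support :
  (forall u : L, \sum_w T w u = 0) <->
  ~ (forall p : V, \sum_i p 0 i = 0 ->
       exists u : L, forall f : Kx, f.@[fun i => p 0 i] != 0 -> f *: u != 0).
Proof.
split=> [noinv full|proper u0].
  have eqE : equivalence_rel (fun i j : 'I_n => i == j).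
    by move=> i j k; split=> // /eqP ->.
  have [b [b0 bE]] := exists_generic_point K eqE.
  have [u uP] := full b b0; have [k gk] := no_invariants_nilp act noinv.
  have := uP (gprod K (fun i j : 'I_n => i == j) ^+ k).
  rewrite gk eqxx rmorphXn /= expf_neq0 => [/(_ isT) //|].
  rewrite /gprod rmorph_prod; apply/prodf_neq0 => x nx.
  by rewrite /= mevalB !mevalXU subr_eq0 -bE.
apply/eqP/negPn/negP; set u := \sum_w T w u0 => nu.
have Tu w : T w u = u.
  rewrite /u (actT_sum act) [RHS](reindex_inj (mulgI w)) /=.
  by apply: eq_bigr => w' _; rewrite (actTM act).
have [e [eE nnil enil]] := max_stratum nu.
have [e_nontriv|e_triv] := pselect (exists i j, e i j && (i != j)).
  case/eqP: nu.
  exact: (nontrivial_stratum_no_invariant c_gtN1 c_lt0 act gen simple eE nnil enil e_nontriv).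
apply: proper => p p0; exists u => f; apply: contra => /eqP fu; apply/eqP.
apply: (invariant_vanish act gen simple eE nnil enil Tu nu fu p0) => i j eij.
by case: (eqVneq i j) => [->//|ij]; case: e_triv; exists i, j; rewrite eij.
Qed.

End AsphericalSupport.

(** * Modules over a ring with the Cherednik presentation *)

Section PresentedModule.
Variables (K : numClosedFieldType) (n : nat) (c : K) (A : pzRingType).
Local Notation Kx := (mpoly n K).
Local Notation V := 'rV[K]_n.

(* The generators and relations of the rational Cherednik algebra, in an
   abstract ring: x_1, .., x_n generate the image of C[h], and cy v is only
   constrained when v lies in h. *)
Record cherednik_presentation := CherednikPresentation {
  csc : K -> A;
  cpoly : Kx -> A;
  cgrp : 'S_n -> A;
  cy : V -> A;
  csc_central : forall k a, a * csc k = csc k * a;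
  cpolyD : {morph cpoly : f g / f + g};
  cpolyM : {morph cpoly : f g / f * g};
  cpoly1 : cpoly 1 = 1;
  cpolyC : forall k, cpoly k%:MP = csc k;
  cgrp1 : cgrp 1%g = 1;
  cgrpM : forall w w', cgrp (w * w')%g = cgrp w * cgrp w';
  cgrpX : forall w i, cgrp w * cpoly 'X_i = cpoly 'X_(w^-1%g i) * cgrp w;
  cgrpY : forall w (v : V), \sum_i v 0 i = 0 -> cgrp w * cy v = cy (col_perm w v) * cgrp w;
  cyX : forall (v : V) j, \sum_i v 0 i = 0 -> cy v * cpoly 'X_j - cpoly 'X_j * cy v =
    csc (v 0 j) - csc (c / 2) *
      \sum_p csc ((v 0 p.1 - v 0 p.2) * xcoroot K j p.1 p.2) * cgrp (tperm p.1 p.2);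
  csumX : cpoly (\sum_i 'X_i) = 0;
  cclosed : forall (L : lmodType A) (P : L -> Prop), P 0 ->
    (forall u v, P u -> P v -> P (u + v)) -> (forall k u, P u -> P (csc k *: u)) ->
    (forall w u, P u -> P (cgrp w *: u)) ->
    (forall (v : V) u, \sum_i v 0 i = 0 -> P u -> P (cy v *: u)) ->
    (forall i u, P u -> P (cpoly 'X_i *: u)) -> forall a u, P u -> P (a *: u) }.

Variable D : cherednik_presentation.

(* The presentation is a phantom argument: it selects the module structure. *)
Definition poly_restr (D' : cherednik_presentation) (L : lmodType A) : Type := L.

Section Instance.
Variable L : lmodType A.
HB.instance Definition _ := GRing.Zmodule.on (poly_restr D L).

Definition poly_scale (f : Kx) (u : poly_restr D L) : poly_restr D L := cpoly D f *: (u : L).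

Lemma poly_scaleA f g u : poly_scale f (poly_scale g u) = poly_scale (f * g) u.
Proof. by rewrite /poly_scale scalerA cpolyM. Qed.
Lemma poly_scale1 : left_id 1 poly_scale.
Proof. by move=> u; rewrite /poly_scale cpoly1 scale1r. Qed.
Lemma poly_scaleDr : right_distributive poly_scale +%R.
Proof. by move=> f u v; rewrite /poly_scale scalerDr. Qed.
Lemma poly_scaleDl u : {morph poly_scale^~ u : f g / f + g}.
Proof. by move=> f g; rewrite /poly_scale cpolyD scalerDl. Qed.
HB.instance Definition _ := GRing.Zmodule_isLmodule.Build Kx (poly_restr D L)
  poly_scaleA poly_scale1 poly_scaleDr poly_scaleDl.

Local Notation LL := (poly_restr D L).

Definition grp_op (w : 'S_n) (u : LL) : LL := cgrp D w *: (u : L).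
Definition y_op (v : V) (u : LL) : LL := cy D v *: (u : L).

Lemma poly_restrE f (u : LL) : f *: u = cpoly D f *: (u : L) :> L.
Proof. by []. Qed.

Lemma csc_restr k (u : L) : csc D k *: u = k%:MP *: (u : LL) :> L.
Proof. by rewrite poly_restrE cpolyC. Qed.

Lemma grp_op_poly w f (u : LL) : grp_op w (f *: u) = msym w^-1%g f *: grp_op w u.
Proof.
elim/mpoly_generator_ind: f u => [k|f g IHf IHg|i f IH] u.
- by rewrite msymC /grp_op !poly_restrE cpolyC !scalerA csc_central.
- by rewrite msymD !scalerDl -IHf -IHg; apply: (scalerDr (cgrp D w) (_ : L)).
rewrite msymM msymXU -!scalerA -IH.
change (cgrp D w *: (cpoly D 'X_i *: (f *: u : L)) =
  cpoly D 'X_(w^-1%g i) *: (cgrp D w *: (f *: u : L)) :> L).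
by rewrite !scalerA cgrpX.
Qed.

Lemma restr_action : cherednik_action c grp_op y_op.
Proof.
split.
- by move=> w u v; apply: (scalerDr (cgrp D w) (u : L)).
- by move=> w u v; apply: (scalerDr (cy D w) (u : L)).
- by move=> u; rewrite /grp_op cgrp1 scale1r.
- by move=> w w' u; rewrite /grp_op cgrpM scalerA.
- exact: grp_op_poly.
- by move=> v k u; rewrite /y_op !poly_restrE cpolyC !scalerA csc_central.
- by move=> w v u v0; rewrite /grp_op /y_op !scalerA cgrpY.
- move=> v j u v0.
  suff E : cy D v *: (cpoly D 'X_j *: (u : L)) = cpoly D 'X_j *: (cy D v *: (u : L)) +
      cpoly D (v 0 j)%:MP *: (u : L) - cpoly D (c / 2)%:MP *: \sum_p
      cpoly D ((v 0 p.1 - v 0 p.2) * xcoroot K j p.1 p.2)%:MP *: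
        (cgrp D (tperm p.1 p.2) *: (u : L)) by exact: E.
  rewrite !scalerA; have /eqP := cyX D j v0; rewrite subr_eq => /eqP ->.
  rewrite addrC -addrA scalerDl; congr (_ + _); rewrite scalerBl !cpolyC -scalerA.
  congr (_ - _ *: _); rewrite scaler_suml; apply: eq_bigr => p _.
  by rewrite cpolyC scalerA.
by move=> u; rewrite poly_restrE csumX scale0r.
Qed.

End Instance.

Variables (L : lmodType A) (d : nat) (t : 'I_d -> L) (rho : 'S_n -> 'I_d -> 'I_d -> K).
Hypothesis L_simple : simple_module L.
Hypothesis gen : forall u, exists a : 'I_d -> A, u = \sum_j a j *: t j.
Hypothesis t_grp : forall w j, cgrp D w *: t j = \sum_l csc D (rho w j l) *: t l.
Hypothesis t_y : forall (v : V) j, \sum_i v 0 i = 0 -> cy D v *: t j = 0.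

Local Notation LL := (poly_restr D L).

Let act := restr_action L.

(** The span of the t j over the polynomials is stable under the [cy D v]: these kill each t j, and
    commuting them with a polynomial leaves only group elements. *)
Lemma presented_generators (u : LL) : exists P : 'I_d -> Kx, u = \sum_j P j *: (t j : LL).
Proof.
pose Sp (u : L) := exists P : 'I_d -> Kx, u = \sum_j P j *: (t j : LL).
have Sp0 : Sp 0 by exists (fun=> 0); rewrite big1 // => j _; rewrite scale0r.
have SpD x y : Sp x -> Sp y -> Sp (x + y).
  move=> [P ->] [P' ->]; exists (fun j => P j + P' j).
  by rewrite -[LHS]big_split; apply: eq_bigr => j _; rewrite scalerDl.
have SpZ f x : Sp x -> Sp (f *: (x : LL)).
  move=> [P ->]; exists (fun j => f * P j); rewrite scaler_sumr.
  by apply: eq_bigr => j _; rewrite scalerA.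
have Sp_sum (I : finType) (F : I -> L) : (forall i, Sp (F i)) -> Sp (\sum_i F i).
  by move=> SF; elim/big_ind: _.
have Spt j : Sp (t j).
  exists (fun i => if i == j then 1 else 0).
  rewrite (bigD1 j) //= eqxx scale1r big1 ?addr0 // => i /negPf ->.
  by rewrite scale0r.
have SpT w x : Sp x -> Sp (cgrp D w *: x).
  move=> [P ->]; rewrite -[_ *: _]/(grp_op w _) (actT_sum act); apply: (Sp_sum _ _) => j.
  rewrite (actTf act); apply: (SpZ _ _); rewrite /grp_op t_grp; apply: (Sp_sum _ _) => l.
  by rewrite csc_restr; apply: (SpZ _ _).
have [a ->] := gen u; apply: (Sp_sum _ _) => j; apply: (@cclosed D L Sp) => //.
- by move=> k x Sx; rewrite csc_restr; apply: (SpZ _ _).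
- move=> v x v0 [P ->]; rewrite -[_ *: _]/(y_op v _) (actY_sum act); apply: (Sp_sum _ _) => i.
  have [q qP] := actY_poly act (P i) v0; rewrite qP; apply: (SpD _ _).
    by rewrite /y_op t_y // scaler0.
  by apply: (Sp_sum _ _) => w; apply: (SpZ _ _); apply: SpT.
by move=> i x Sx; apply: (SpZ _ _).
Qed.

Lemma presented_simple (S : LL -> Prop) : S 0 -> (forall u v, S u -> S v -> S (u + v)) ->
  (forall (f : Kx) u, S u -> S (f *: u)) -> (forall w u, S u -> S (grp_op w u)) ->
  (forall (v : V) u, \sum_i v 0 i = 0 -> S u -> S (y_op v u)) ->
  forall u, S u -> u != 0 -> forall u', S u'.
Proof.
move=> S0 SD SZ ST SY u Su u0; pose S' : {pred L} := fun x => `[< S x >].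
have Scl : submod_closed S'.
  split=> [|a x y /asboolP Sx /asboolP Sy]; apply/asboolP => //; apply: (SD _ _) => //.
  apply: (@cclosed D L S) => //.
  - by move=> k z Sz; rewrite csc_restr; apply: SZ.
  by move=> i z Sz; apply: (SZ _ z Sz).
have [all0|allS] := L_simple.2 S' Scl; last by move=> u'; apply/asboolP/(allS u').
have /all0 u00 : (u : L) \in S' by apply/asboolP.
by rewrite u00 eqxx in u0.
Qed.

Lemma presented_no_invariants_iff : - 1 < c -> c < 0 ->
  (forall u : L, \sum_w cgrp D w *: u = 0) <->
  ~ (forall p : V, \sum_i p 0 i = 0 ->
       exists u : L, forall f : Kx, f.@[fun i => p 0 i] != 0 -> cpoly D f *: u != 0).
Proof.
by move=> c1 c0; apply: (no_invariants_iff_proper_support c1 c0 act presented_generators presented_simple).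
Qed.

End PresentedModule.

Lemma alg_quot_scalar_form (K : fieldType) (A : lalgType K) (r : A -> Prop) (n : nat)
    (k l : K) (a : 'I_n -> 'I_n -> K) (b : 'I_n * 'I_n -> K) (g : 'I_n -> 'I_n -> alg_quot r) :
  (forall p, a p.1 p.2 = b p) ->
  k *: (1 : alg_quot r) - l *: \sum_i \sum_j a i j *: g i j =
  k *: (1 : alg_quot r) - (l *: (1 : alg_quot r) : alg_quot r) *
    \sum_p (b p *: (1 : alg_quot r) : alg_quot r) * g p.1 p.2.
Proof.
move=> ab; rewrite pair_bigA -alg_quot_scalerAl mul1r; congr (_ - _ *: _).
by apply: eq_bigr => p _; rewrite -alg_quot_scalerAl mul1r ab.
Qed.

(** * The rational Cherednik algebra satisfies the presentation *)

Section CherednikPresentation.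
Variables (K : numClosedFieldType) (n : nat) (c : K).
Local Notation H := (cherednik n c).
Local Notation Kx := (mpoly n K).
Local Notation h := (frakh K n).
Local Notation hdual := (frakh_dual K n).
Hypothesis n_gt0 : (0 < n)%N.

Lemma hdual_act_coord (w : 'S_n) i : hdual_act w (hcoordX K i) = hcoordX K (w^-1%g i).
Proof.
apply/lfunP => y; rewrite hdual_actE !lfunE /= /hcoord val_h_act mxE.
by [].
Qed.

Lemma sum_hcoordX : \sum_(i < n) hcoordX K i = 0 :> hdual.
Proof.
apply/lfunP => y; rewrite sum_lfunE zero_lfunE.
have := subvsP y; rewrite mem_hspace => /eqP E; rewrite -[RHS]E.
by apply: eq_bigr => i _; rewrite lfunE.
Qed.

Lemma vsproj_val (y : h) : vsproj (hspace K n) (vsval y) = y.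
Proof. by apply: val_inj; rewrite /= vsprojK // subvsP. Qed.

Lemma h_act_vsproj (w : 'S_n) (v : 'rV[K]_n) : \sum_i v 0 i = 0 ->
  h_act w (vsproj (hspace K n) v) = vsproj (hspace K n) (col_perm w v).
Proof.
by move=> v0; rewrite /h_act vsprojK // mem_hspace v0.
Qed.

(** The projections v_i to h of the standard basis vectors satisfy y = sum of the y_i v_i for y in
    h, so the values of x on them serve as coefficients. *)
Lemma hdual_decomp (x : hdual) : exists a : 'I_n -> K, x = \sum_i a i *: hcoordX K i.
Proof.
pose v i : 'rV[K]_n := delta_mx 0 i - const_mx n%:R^-1.
have n0 : n%:R != 0 :> K by rewrite pnatr_eq0 -lt0n.
have vh i : v i \in hspace K n.
  rewrite mem_hspace; apply/eqP.
  transitivity (\sum_j (j == i)%:R - \sum_(j < n) n%:R^-1 : K).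
    by rewrite -sumrB; apply: eq_bigr => j _; rewrite !mxE eqxx.
  rewrite sumr_const card_ord -[_ *+ n]mulr_natl divff // (bigD1 i) //= eqxx big1 ?addr0 ?subrr //.
  by move=> j /negPf ->.
exists (fun i => x (vsproj (hspace K n) (v i))); apply/lfunP => y.
have yE : y = \sum_i vsval y 0 i *: vsproj (hspace K n) (v i).
  apply: val_inj; rewrite /= linear_sum /=.
  have := subvsP y; rewrite mem_hspace => /eqP y0.
  apply/rowP => j; rewrite summxE (eq_bigr (fun i => vsval y 0 i * (i == j)%:R - vsval y 0 i * n%:R^-1)).
    rewrite sumrB -mulr_suml y0 mul0r subr0 (bigD1 j) //= eqxx mulr1 big1 ?addr0 //.
    by move=> i /negPf ->; rewrite mulr0.
  move=> i _; rewrite /= vsprojK // !mxE eqxx /= mulrBr; congr (_ * _%:R - _).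
  by rewrite eq_sym.
rewrite sum_lfunE {1}yE linear_sum; apply: eq_bigr => i _.
by rewrite linearZ scale_lfunE lfunE; apply: mulrC.
Qed.

Definition Hscal (k : K) : H := k *: (1 : H).
Definition Hyv (v : 'rV[K]_n) : H := Hy c (vsproj (hspace K n) v).

Lemma HscalM k (a : H) : Hscal k * a = k *: a.
Proof. exact: etrans (esym (cherednik_scalerAl k 1 a)) (congr1 _ (mul1r a)). Qed.

Lemma Hscal_central k (a : H) : a * Hscal k = Hscal k * a.
Proof.
apply: etrans (esym (HscalM k a)).
exact: etrans (esym (cherednik_scalerAr k a 1)) (congr1 _ (mulr1 a)).
Qed.

Lemma HpolyC k : Hpoly c (k%:MP : Kx) = Hscal k.
Proof.
have -> : k%:MP = k *: 1 :> Kx by rewrite -mul_mpolyC mulr1.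
apply: etrans (HpolyZ c k 1) _.
by congr (_ *: _); exact: Hpoly1.
Qed.

Lemma Hgrp_HpolyX w i :
  Hgrp c w * Hpoly c ('X_i : Kx) = Hpoly c ('X_(w^-1%g i) : Kx) * Hgrp c w :> H.
Proof.
apply: etrans (congr1 _ (HpolyX c i)) _; apply: etrans (Hgrp_Hx c w (hcoordX K i)) _.
by rewrite hdual_act_coord; congr (_ * _); apply/esym/HpolyX.
Qed.

Lemma Hgrp_Hyv w (v : 'rV[K]_n) : \sum_i v 0 i = 0 ->
  Hgrp c w * Hyv v = Hyv (col_perm w v) * Hgrp c w :> H.
Proof.
move=> v0; apply: etrans (Hgrp_Hy c w (vsproj (hspace K n) v)) _.
by rewrite h_act_vsproj.
Qed.

Lemma Hyv_HpolyX (v : 'rV[K]_n) j : \sum_i v 0 i = 0 ->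
  Hyv v * Hpoly c ('X_j : Kx) - Hpoly c ('X_j : Kx) * Hyv v = Hscal (v 0 j) -
  Hscal (c / 2) * \sum_p Hscal ((v 0 p.1 - v 0 p.2) * xcoroot K j p.1 p.2) *
     Hgrp c (tperm p.1 p.2) :> H.
Proof.
move=> v0; have vv : vsval (vsproj (hspace K n) v) = v by rewrite vsprojK // mem_hspace v0.
have XE : Hpoly c ('X_j : Kx) = Hx c (hcoordX K j) := HpolyX c j.
have nz2 : (2 : K) != 0 by rewrite pnatr_eq0.
rewrite XE; apply: etrans (Hcross2 c (vsproj (hspace K n) v) (hcoordX K j) nz2) _.
have -> : hcoordX K j (vsproj (hspace K n) v) = v 0 j by rewrite lfunE /= /hcoord vv.
apply: (@alg_quot_scalar_form K _ (@cherednik_rel K n c) n (v 0 j) (c / 2) _ _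
  (fun i k => Hgrp c (tperm i k))) => p.
rewrite alphaE vv lfunE /= /hcoord val_alpha_vee !mxE eqxx /=.
by [].
Qed.

Lemma Hpoly_sumX : Hpoly c (\sum_i 'X_i : Kx) = 0 :> H.
Proof.
have E (s : seq 'I_n) : Hpoly c (\sum_(i <- s) 'X_i : Kx) = Hx c (\sum_(i <- s) hcoordX K i) :> H.
  elim: s => [|i s IH]; first by rewrite !big_nil linear0 /Hpoly msupp0 big_nil.
  rewrite !big_cons; apply: etrans (HpolyD _ _ _) _.
  apply: etrans (esym (raddfD _ _ _)); congr (_ + _) => //; exact: HpolyX.
by apply: etrans (E _) _; rewrite sum_hcoordX linear0.
Qed.

Lemma Hclosed (L : lmodType H) (P : L -> Prop) : P 0 ->
  (forall u v, P u -> P v -> P (u + v)) -> (forall k u, P u -> P (Hscal k *: u)) ->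
  (forall w u, P u -> P ((Hgrp c w : H) *: u)) ->
  (forall (v : 'rV[K]_n) u, \sum_i v 0 i = 0 -> P u -> P (Hyv v *: u)) ->
  (forall i u, P u -> P ((Hpoly c ('X_i : Kx) : H) *: u)) -> forall (a : H) u, P u -> P (a *: u).
Proof.
move=> P0 PD PZ Pg Py Px; apply: (@cherednik_closed K n c L P P0 PD PZ Pg) => [y|x] u Pu.
  rewrite -(vsproj_val y); apply: Py => //.
  by have := subvsP y; rewrite mem_hspace => /eqP.
have [a ->] := hdual_decomp x.
have -> : Hx c (\sum_i a i *: hcoordX K i) = \sum_i Hscal (a i) * Hpoly c ('X_i : Kx) :> H.
  apply: etrans (linear_sum (@Hx K n c) _ _ _) _; apply: eq_bigr => i _.
  apply: etrans (linearZ _ _) _; apply: etrans (esym (HscalM _ _)).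
  by congr (_ *: _); apply/esym/HpolyX.
rewrite scaler_suml; elim/big_ind: _ => // i _.
by rewrite -scalerA; apply/PZ/Px.
Qed.

Definition cherednik_pres : cherednik_presentation n c H :=
  @CherednikPresentation K n c H Hscal (@Hpoly K n c) (@Hgrp K n c) Hyv
    Hscal_central (@HpolyD K n c) (@HpolyM K n c) (@Hpoly1 K n c) HpolyC (@Hgrp1 K n c)
    (@HgrpM K n c) Hgrp_HpolyX Hgrp_Hyv Hyv_HpolyX Hpoly_sumX Hclosed.

End CherednikPresentation.

(** * Generators of a quotient of the standard module *)

Section StandardQuotient.
Variables (K : fieldType) (Q : pzRingType) (sc : K -> Q) (d : nat).
Hypotheses (sc0 : sc 0 = 0) (sc1 : sc 1 = 1).

Let tens (v : 'rV[K]_d) : 'rV[Q]_d := \row_i sc (v 0 i).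

Lemma tens_delta_decomp (x : 'rV[Q]_d) : x = \sum_j x 0 j *: tens (delta_mx 0 j).
Proof.
apply/rowP => i; rewrite summxE (bigD1 i) //= !mxE !eqxx sc1 mulr1.
rewrite big1 ?addr0 // => j /negPf ji.
by rewrite !mxE eqxx eq_sym ji sc0 mulr0.
Qed.

Variables (B : 'rV[Q]_d -> Prop) (L : lmodType Q) (f : {linear mod_quot B -> L}).
Hypothesis f_onto : forall u, exists v, f v = u.

Definition standard_gen (j : 'I_d) : L := f (mod_pi B (tens (delta_mx 0 j))).

Lemma mod_quot_rel x y : B (x - y) -> f (mod_pi B x) = f (mod_pi B y).
Proof. by move=> Bxy; congr (f _); apply/mod_piP/asboolP/Submod_gen. Qed.

Lemma standard_gen_row (x : 'rV[Q]_d) : f (mod_pi B x) = \sum_j x 0 j *: standard_gen j.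
Proof.
rewrite {1}[x]tens_delta_decomp !linear_sum; apply: eq_bigr => j _.
by rewrite !linearZ.
Qed.

Lemma standard_gen_span u : exists a : 'I_d -> Q, u = \sum_j a j *: standard_gen j.
Proof.
have [v <-] := f_onto u; elim/mod_quotW: v => x.
by exists (x 0); apply: standard_gen_row.
Qed.

Lemma standard_gen_act (a : Q) (v : 'rV[K]_d) j : B (a *: tens (delta_mx 0 j) - tens v) ->
  a *: standard_gen j = \sum_l sc (v 0 l) *: standard_gen l.
Proof.
move=> /mod_quot_rel; rewrite !linearZ /= => ->; rewrite standard_gen_row.
by apply: eq_bigr => l _; rewrite mxE.
Qed.

Lemma standard_gen_kill (a : Q) j : B (a *: tens (delta_mx 0 j) - tens 0) ->
  a *: standard_gen j = 0.
Proof.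
move=> /standard_gen_act ->; apply: big1 => l _.
by rewrite mxE sc0 scale0r.
Qed.

End StandardQuotient.

Lemma scaled_sum_killP (Q : pzRingType) (L : lmodType Q) (W : finType) (g : W -> Q)
    (b b' a : Q) : b' * b = 1 -> a = b * \sum_w g w ->
  (forall u : L, a *: u = 0) <-> (forall u : L, \sum_w g w *: u = 0).
Proof.
move=> b'b ->; split=> H u; last by rewrite -scalerA scaler_suml H scaler0.
by rewrite -scaler_suml -[LHS]scale1r -b'b -scalerA [b *: _]scalerA H scaler0.
Qed.

Lemma hsupport_properP (K : fieldType) (n : nat) (c : K) (L : lmodType (cherednik n c)) :
  hsupport L <> [set: frakh K n]%classic <->
  ~ (forall p : 'rV[K]_n, \sum_i p 0 i = 0 ->
     exists u : L, forall f : mpoly n K, f.@[fun i => p 0 i] != 0 -> (Hpoly c f : cherednik n c) *: u != 0).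
Proof.
split=> proper full; apply: proper.
  apply/seteqP; split=> // y _; apply: (full (vsval y)).
  by have := subvsP y; rewrite mem_hspace => /eqP.
move=> p p0; have /(congr1 (fun S => S (vsproj (hspace K n) p))) := full.
rewrite /hsupport /poly_at vsprojK ?mem_hspace ?p0 // => E.
by have : (setT (vsproj (hspace K n) p))%classic by []; rewrite -E.
Qed.

Lemma slope_bounds (K : numFieldType) (r m : nat) : (1 <= r)%N -> (r <= m - 1)%N ->
  - 1 < - (r%:R / m%:R) :> K /\ - (r%:R / m%:R) < 0 :> K.
Proof.
move=> r_ge1 r_le; have lt_rm : (r < m)%N by case: m r_le => [|m]; rewrite ?subn1 // leqNgt r_ge1.
have m_gt0 : 0 < m%:R :> K by rewrite ltr0n (leq_trans _ lt_rm).
by rewrite ltrN2 ltr_pdivrMr // mul1r ltr_nat oppr_lt0 divr_gt0 // ltr0n.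
Qed.

Theorem proposition4p5 (R : realType) (n m r : nat)
  (m_ge2 : (2 <= m)%N) (m_le_n : (m <= n)%N)
  (r_ge1 : (1 <= r)%N) (r_le : (r <= m - 1)%N)
  (c : R[i]) (c_def : c = - (r%:R / m%:R))
  (d : nat) (tau : mx_representation R[i] [set: 'S_n] d)
  (tau_irr : mx_irreducible tau)
  (L : lmodType (cherednik n c))
  (L_tau : irreducible_quotient (standard_module c tau) L) :
  aspherical L <-> hsupport L <> [set: frakh R[i] n]%classic.
Proof.
have n_gt0 : (0 < n)%N by apply: leq_trans m_le_n; apply: leq_trans m_ge2.
have [c1 c0] := slope_bounds R[i] r_ge1 r_le; rewrite -c_def in c1 c0.
have [L_simple [f f_onto]] := L_tau.
have sc0 : @Hscal R[i] n c 0 = 0 := scale0r _.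
have sc1 : @Hscal R[i] n c 1 = 1 := scale1r _.
have gen := @standard_gen_span R[i] (cherednik n c) (@Hscal _ n c) d sc0 sc1 _ L f f_onto.
have t_grp w j := @standard_gen_act R[i] (cherednik n c) (@Hscal _ n c) d sc0 sc1 _ L f _ _ j
  (Balanced_grp c tau w (delta_mx 0 j)).
have t_y (v : 'rV_n) j (_ : \sum_i v 0 i = 0) :=
  @standard_gen_kill R[i] (cherednik n c) (@Hscal _ n c) d sc0 sc1 _ L f _ j
  (Balanced_y c tau (vsproj (hspace R[i] n) v) (delta_mx 0 j)).
have main := @presented_no_invariants_iff R[i] n c (cherednik n c) (cherednik_pres c n_gt0) L d
  _ _ L_simple gen t_grp t_y c1 c0.
(* The order of the group is invertible, so [sym_idem] and the plain sum over the group kill [L]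
   simultaneously. *)
have W0 : #|[set: 'S_n]|%:R != 0 :> R[i] by rewrite pnatr_eq0 -lt0n cardG_gt0.
have sc_inv : Hscal n c #|[set: 'S_n]|%:R * Hscal n c (#|[set: 'S_n]|%:R^-1) = 1.
  by rewrite HscalM scalerA divff // scale1r.
have avg := @scaled_sum_killP (cherednik n c) L _ (Hgrp c) _ _ (sym_idem n c) sc_inv
  (esym (HscalM _ _)).
split=> [[_ Le]|proper].
  by apply/hsupport_properP/main/avg.
by split; [exact: L_simple.1 | apply/avg/main/hsupport_properP].
Qed.
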